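(* Let $\Gamma$ be a discrete subgroup of $\mathrm{PSL}(2,\mathbb{R})$ whose action on the hyperbolic plane $\mathbb{H}^2$ by Möbius transformations is free (of fixed points) and such that the quotient $\Gamma\backslash\mathbb{H}^2$ is compact. Then the horocycle flow $(\theta_t^{\mathcal X})_{t\in\mathbb{R}}$ on the unit tangent bundle $\mathcal X=T^1(\Gamma\backslash\mathbb{H}^2)$ is positive strong kinematic expansive, i.e. every time change of $(\theta_t^{\mathcal X})_{t\in\mathbb{R}}$ is positive kinematic expansive.
   Context: Hyperbolic plane: $\mathbb{H}^2=\{(x,y)\in\mathbb{R}^2: y>0\}$ with the metric $ds^2=\frac{dx^2+dy^2}{y^2}$. The group $\mathrm{PSL}(2,\mathbb{R})=\mathrm{SL}(2,\mathbb{R})/\{\pm E_2\}$ ($E_2$ the $2\times 2$ unit matrix) acts on it by Möbius transformations $z\mapsto\frac{az+b}{cz+d}$. The unit tangent bundle $T^1(\Gamma\backslash\mathbb{H}^2)$ carries the Sasaki metric induced by the natural Riemannian metric on $\Gamma\backslash\mathbb{H}^2$, and $d$ denotes the resulting distance function; $\mathcal X$ is a compact metric space. Horocycle flow: let $b_t\in\mathrm{PSL}(2,\mathbb{R})$ be the class of $\begin{pmatrix}1&t\\0&1\end{pmatrix}$. Put $X=\Gamma\backslash\mathrm{PSL}(2,\mathbb{R})=\{\Gamma g: g\in\mathrm{PSL}(2,\mathbb{R})\}$ and $\theta^X_t(\Gamma g)=\Gamma g b_t$ for $t\in\mathbb{R}$. There is a natural isometry $\Xi:T^1(\Gamma\backslash\mathbb{H}^2)\to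 X$ for the natural Riemannian metric on $X$ (it is induced by the standard identification of $\mathrm{PSL}(2,\mathbb{R})$ with $T^1\mathbb{H}^2$ sending $g$ to the image, under the derivative of $g$, of the upward unit vector at the point $i$). The horocycle flow on $\mathcal X$ is $\theta^{\mathcal X}_t=\Xi^{-1}\circ\theta^X_t\circ\Xi$, $t\in\mathbb{R}$. Time change: for continuous flows $\phi,\psi:\mathbb{R}\times M\to M$ on a metric space $M$, $(\phi_t)_{t\in\mathbb{R}}$ is a time change of $(\psi_t)_{t\in\mathbb{R}}$ if for every $x\in M$ the orbits $\phi_{\mathbb{R}}(x)$ and $\psi_{\mathbb{R}}(x)$ and their orientations coincide (the orbit through $x$ is the same set and is traversed in the same direction by both flows, i.e. for each $x$ there is an increasing homeomorphism $s_x:\mathbb{R}\to\mathbb{R}$ with $s_x(0)=0$ and $\phi_t(x)=\psi_{s_x(t)}(x)$ for all $t$). Positive kinematic expansive: a continuous flow $\phi:\mathbb{R}\times M\to M$ on a compact metric space $(M,d)$ is positive kinematic expansive if for each $\varepsilon>0$ there exists $\delta>0$ such that whenever $x,y\in M$ satisfy $d(\phi_t(x),\phi_t(y))<\delta$ for all $t\in[0,+\infty)$, then $y=\phi_\tau(x)$ for some $\tau\in(-\varepsilon,\varepsilon)$. *)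

(* Defs.v *)
From HB Require Import structures.
From mathcomp Require Import all_boot all_order all_algebra.
From mathcomp Require Import all_classical all_reals all_analysis.
From mathcomp Require Import complex ring lra.

Set Implicit Arguments.
Unset Strict Implicit.
Unset Printing Implicit Defensive.

Import Order.TTheory GRing.Theory Num.Theory.
Import numFieldNormedType.Exports.

Local Open Scope classical_set_scope.
Local Open Scope complex_scope.
Local Open Scope quotient_scope.
Local Open Scope ring_scope.

Record gaction (G : groupType) (T : Type) := GAction {
  act :> G -> T -> T;
  act1 : forall x, act 1%g x = x;
  actM : forall g h x, act (g * h)%g x = act g (act h x) }.

Section OrbitSpace.
Context {G : groupType} {T : choiceType}.
Variables (Gamma : groupClosed G) (to : gaction G T).

Definition orbit_rel : rel T :=
  fun x y => `[< exists2 g, g \in Gamma & y = to g x >].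

Lemma orbit_rel_refl : reflexive orbit_rel.
Proof. by move=> x; apply/asboolP; exists 1%g; rewrite ?gpred1 ?act1. Qed.

Lemma orbit_rel_sym : symmetric orbit_rel.
Proof.
suff H x y : orbit_rel x y -> orbit_rel y x by move=> x y; apply/idP/idP; exact: H.
move=> /asboolP[g gG ->]; apply/asboolP; exists (g^-1)%g; first by rewrite gpredV.
by rewrite -actM mulVg act1.
Qed.

Lemma orbit_rel_trans : transitive orbit_rel.
Proof.
move=> y x z /asboolP[g gG ->] /asboolP[h hG ->]; apply/asboolP.
by exists (h * g)%g; [rewrite gpredM|rewrite actM].
Qed.

Canonical orbit_equiv :=
  EquivRel orbit_rel orbit_rel_refl orbit_rel_sym orbit_rel_trans.

Definition orbit_space := {eq_quot orbit_equiv}.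

Lemma orbit_spaceP (x y : T) :
  (\pi_orbit_space x = \pi_orbit_space y) <->
  (exists2 g, g \in Gamma & y = to g x).
Proof.
split=> [/eqquotP/asboolP//|H].
by apply/eqquotP/asboolP.
Qed.

End OrbitSpace.
Arguments orbit_space {G T} Gamma to.

Section SL2.
Variable R : realType.

Definition mx2 (a b c d : R) : 'M[R]_2 :=
  \matrix_(i, j) if i == 0 then (if j == 0 then a else b)
                 else (if j == 0 then c else d).

Lemma det2E (M : 'M[R]_2) : \det M = M 0 0 * M 1 1 - M 0 1 * M 1 0.
Proof.
rewrite (expand_det_row _ 0) !big_ord_recl big_ord0 /cofactor !det_mx11 !mxE.
rewrite /= expr0 expr1 mul1r addr0 mulN1r mulrN.
by congr (_ * M _ _ - M _ _ * M _ _); apply/val_inj.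
Qed.

Lemma mx2E a b c d : ((mx2 a b c d 0 0 = a) * (mx2 a b c d 0 1 = b) *
  (mx2 a b c d 1 0 = c) * (mx2 a b c d 1 1 = d))%type.
Proof. by rewrite !mxE. Qed.

Lemma mx2_eqP (M N : 'M[R]_2) : M 0 0 = N 0 0 -> M 0 1 = N 0 1 ->
  M 1 0 = N 1 0 -> M 1 1 = N 1 1 -> M = N.
Proof.
move=> e00 e01 e10 e11; apply/matrixP => i j.
have E (k : 'I_2) : k = 0 \/ k = 1.
  by case: k => -[|[|//]] ?; [left|right]; exact: val_inj.
by case: (E i) => ->; case: (E j) => ->.
Qed.

Lemma mulmx2E (M N : 'M[R]_2) i j : (M *m N) i j = M i 0 * N 0 j + M i 1 * N 1 j.
Proof.
rewrite mxE !big_ord_recl big_ord0 addr0.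
by congr (_ + M i _ * N _ j); exact: val_inj.
Qed.

Definition SL2 : Type := [set M : 'M[R]_2 | \det M = 1].

HB.instance Definition _ := Choice.on SL2.
HB.instance Definition _ := Topological.on SL2.

Definition mxval (g : SL2) : 'M[R]_2 := val g.

Lemma det_SL2 (g : SL2) : \det (mxval g) = 1.
Proof. exact: set_valP g. Qed.

Definition toSL2 (M : 'M[R]_2) (h : \det M = 1) : SL2 := exist _ M (mem_set h).

Fact SL2_mul_subproof (g h : SL2) : \det (mxval g *m mxval h) = 1.
Proof. by rewrite det_mulmx !det_SL2 mulr1. Qed.
Fact SL2_inv_subproof (g : SL2) : \det (invmx (mxval g)) = 1.
Proof. by rewrite det_inv det_SL2 invr1. Qed.

Definition SL2_one : SL2 := toSL2 (det1 R 2).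
Definition SL2_mul (g h : SL2) : SL2 := toSL2 (SL2_mul_subproof g h).
Definition SL2_inv (g : SL2) : SL2 := toSL2 (SL2_inv_subproof g).

Lemma SL2_unitmx (g : SL2) : mxval g \in unitmx.
Proof. by rewrite unitmxE det_SL2 unitr1. Qed.

Lemma SL2_mulA : associative SL2_mul.
Proof. by move=> g h k; apply: val_inj; exact: mulmxA. Qed.
Lemma SL2_mul1g : left_id SL2_one SL2_mul.
Proof. by move=> g; apply: val_inj; exact: mul1mx. Qed.
Lemma SL2_mulg1 : right_id SL2_one SL2_mul.
Proof. by move=> g; apply: val_inj; exact: mulmx1. Qed.
Lemma SL2_mulVg : left_inverse SL2_one SL2_inv SL2_mul.
Proof. by move=> g; apply: val_inj; exact/mulVmx/SL2_unitmx. Qed.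
Lemma SL2_mulgV : right_inverse SL2_one SL2_inv SL2_mul.
Proof. by move=> g; apply: val_inj; exact/mulmxV/SL2_unitmx. Qed.

HB.instance Definition _ := isGroup.Build SL2
  SL2_mulA SL2_mul1g SL2_mulg1 SL2_mulVg SL2_mulgV.

End SL2.

Section PSL2.
Variable R : realType.
Implicit Types g h k : SL2 R.

Definition psl_rel : rel (SL2 R) :=
  fun g h => (mxval g == mxval h) || (mxval g == - mxval h).

Lemma psl_rel_refl : reflexive psl_rel.
Proof. by move=> g; rewrite /psl_rel eqxx. Qed.
Lemma psl_rel_sym : symmetric psl_rel.
Proof. by move=> g h; rewrite /psl_rel eq_sym -[X in _ || X]eqr_oppLR eq_sym
  [X in _ || X]eq_sym. Qed.
Lemma psl_rel_trans : transitive psl_rel.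
Proof.
move=> h g k /orP[] /eqP gh /orP[] /eqP hk; rewrite /psl_rel gh hk ?opprK eqxx //.
all: by rewrite orbT.
Qed.

Canonical psl_equiv :=
  EquivRel psl_rel psl_rel_refl psl_rel_sym psl_rel_trans.

Definition PSL2 : Type := quotient_topology {eq_quot psl_equiv}.

HB.instance Definition _ := Topological.on PSL2.
HB.instance Definition _ := Quotient.on PSL2.

Definition psl (g : SL2 R) : PSL2 := \pi_PSL2 g.

Lemma psl_eqP g h : psl g = psl h <-> mxval g = mxval h \/ mxval g = - mxval h.
Proof.
split=> [/eqquotP/orP[]/eqP ->|H]; [by left|by right|].
by apply/eqquotP/orP; case: H => ->; [left|right].
Qed.

Lemma psl_repr (x : PSL2) : psl (repr x) = x.
Proof. exact: reprK. Qed.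

Definition PSL2_mul (x y : PSL2) : PSL2 := psl (repr x * repr y)%g.
Definition PSL2_inv (x : PSL2) : PSL2 := psl (repr x)^-1%g.

Lemma repr_psl g : mxval (repr (psl g)) = mxval g \/ mxval (repr (psl g)) = - mxval g.
Proof. exact/psl_eqP/psl_repr. Qed.

Lemma psl_mul g h : PSL2_mul (psl g) (psl h) = psl (g * h)%g.
Proof.
have E (a b : SL2 R) : mxval (a * b)%g = mxval a *m mxval b by [].
apply/psl_eqP; rewrite !E.
by case: (repr_psl g) => ->; case: (repr_psl h) => ->;
  rewrite ?mulNmx ?mulmxN ?opprK; [left|right|right|left].
Qed.

Lemma psl_inv g : PSL2_inv (psl g) = psl (g^-1)%g.
Proof.
rewrite /PSL2_inv.
have mx_inv (a : SL2 R) : mxval (a^-1)%g = invmx (mxval a) by [].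
apply/psl_eqP; rewrite !mx_inv.
case: (repr_psl g) => ->; first by left.
right; rewrite -scaleN1r invmxZ ?unitrN1 ?unitr1 ?SL2_unitmx//.
by rewrite invrN invr1 scaleN1r.
by rewrite unitmxZ ?SL2_unitmx ?unitrN1.
Qed.

Lemma PSL2_mulA : associative PSL2_mul.
Proof.
by move=> x y z; rewrite -(psl_repr x) -(psl_repr y) -(psl_repr z) !psl_mul mulgA.
Qed.
Lemma PSL2_mul1g : left_id (psl 1%g) PSL2_mul.
Proof. by move=> x; rewrite -(psl_repr x) psl_mul mul1g. Qed.
Lemma PSL2_mulg1 : right_id (psl 1%g) PSL2_mul.
Proof. by move=> x; rewrite -(psl_repr x) psl_mul mulg1. Qed.
Lemma PSL2_mulVg : left_inverse (psl 1%g) PSL2_inv PSL2_mul.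
Proof. by move=> x; rewrite -(psl_repr x) psl_inv psl_mul mulVg. Qed.
Lemma PSL2_mulgV : right_inverse (psl 1%g) PSL2_inv PSL2_mul.
Proof. by move=> x; rewrite -(psl_repr x) psl_inv psl_mul mulgV. Qed.

HB.instance Definition _ := isGroup.Build PSL2
  PSL2_mulA PSL2_mul1g PSL2_mulg1 PSL2_mulVg PSL2_mulgV.

Lemma pslM g h : psl (g * h)%g = (psl g * psl h)%g.
Proof. exact/esym/psl_mul. Qed.

End PSL2.

Section HyperbolicPlane.
Variable R : realType.

Definition H2 : Type := [set z : R * R | 0 < z.2].

HB.instance Definition _ := Topological.on H2.

Definition coordH (z : H2) : R * R := val z.

Definition toH2 (z : R * R) (h : 0 < z.2) : H2 :=
  exist _ z (@mem_set _ [set z : R * R | 0 < z.2] z h).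

Lemma H2_gt0 (z : H2) : 0 < (coordH z).2.
Proof. exact: set_valP z. Qed.

(* The squared norm at [z] of the tangent vector [v] for (dx^2 + dy^2) / y^2. *)
Definition hnorm2 (z : H2) (v : R * R) : R :=
  (v.1 ^+ 2 + v.2 ^+ 2) / (coordH z).2 ^+ 2.

Definition T1H2 : Type := [set u : H2 * (R * R) | hnorm2 u.1 u.2 = 1].

HB.instance Definition _ := Topological.on T1H2.

Definition base (u : T1H2) : H2 := (val u).1.
Definition dir (u : T1H2) : R * R := (val u).2.

Definition toT1H2 (z : H2) (v : R * R) (h : hnorm2 z v = 1) : T1H2 :=
  exist _ (z, v) (@mem_set _ [set u : H2 * (R * R) | hnorm2 u.1 u.2 = 1] (z, v) h).

Lemma hnorm2_dir (u : T1H2) : hnorm2 (base u) (dir u) = 1.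
Proof. exact: set_valP u. Qed.

Lemma T1H2_eqP (u w : T1H2) : base u = base w -> dir u = dir w -> u = w.
Proof.
rewrite /base /dir => e1 e2; apply: val_inj.
by rewrite [LHS]surjective_pairing [RHS]surjective_pairing e1 e2.
Qed.

Definition toC (p : R * R) : R[i] := p.1 +i* p.2.
Definition ofC (z : R[i]) : R * R := (complex.Re z, complex.Im z).

Lemma toCK : cancel toC ofC. Proof. by case. Qed.
Lemma ofCK : cancel ofC toC. Proof. by case. Qed.

(* [num M z] and [den M z] are az + b and cz + d. *)
Definition num (M : 'M[R]_2) (z : R[i]) : R[i] := (M 0 0)%:C * z + (M 0 1)%:C.
Definition den (M : 'M[R]_2) (z : R[i]) : R[i] := (M 1 0)%:C * z + (M 1 1)%:C.

Definition sqabs (z : R[i]) : R := complex.Re z ^+ 2 + complex.Im z ^+ 2.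

Lemma sqabs_eq0 z : (sqabs z == 0) = (z == 0).
Proof.
by case: z => a b; rewrite /sqabs paddr_eq0 ?sqr_ge0// !sqrf_eq0 eq_complex.
Qed.

Lemma sqabsM z w : sqabs (z * w) = sqabs z * sqabs w.
Proof. by case: z => a b; case: w => c d; rewrite /sqabs /=; ring. Qed.

Lemma sqabs1 : sqabs 1 = 1. Proof. by rewrite /sqabs /= expr1n expr0n /= addr0. Qed.

Lemma sqabsV z : sqabs z^-1 = (sqabs z)^-1.
Proof.
have [->|z0] := eqVneq z 0; first by rewrite !invr0 /sqabs /= expr0n /= addr0 invr0.
have s0 : sqabs z != 0 by rewrite sqabs_eq0.
by apply: (mulfI s0); rewrite -sqabsM !mulfV// sqabs1.
Qed.

Lemma sqabsX z n : sqabs (z ^+ n) = sqabs z ^+ n.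
Proof. by elim: n => [|n IH]; rewrite ?expr0 ?sqabs1// !exprS sqabsM IH. Qed.

Lemma den_neq0 (g : SL2 R) (z : H2) : den (mxval g) (toC (coordH z)) != 0.
Proof.
have := H2_gt0 z; have := det_SL2 g; rewrite det2E /den.
case: (coordH z) => x y /= D y0; rewrite eq_complex /=.
apply/negP => /andP[/eqP E1 /eqP E2].
have c0 : mxval g 1 0 = 0.
  apply/eqP; have := E2; rewrite !(mul0r, addr0, add0r) => /eqP.
  by rewrite mulf_eq0 (gt_eqF y0) orbF.
have d0 : mxval g 1 1 = 0 by have := E1; rewrite c0 !(mul0r, oppr0, addr0, add0r).
by move: D; rewrite c0 d0 !mulr0 subr0 => /eqP; rewrite eq_sym oner_eq0.
Qed.

Lemma Im_mobius (g : SL2 R) (z : H2) :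
  complex.Im (num (mxval g) (toC (coordH z)) / den (mxval g) (toC (coordH z))) =
  (coordH z).2 / sqabs (den (mxval g) (toC (coordH z))).
Proof.
have := den_neq0 g z; rewrite -sqabs_eq0; have := det_SL2 g; rewrite det2E.
rewrite /den /num /sqabs; case: (coordH z) => x y /=.
move: (mxval g 0 0 : R) (mxval g 0 1 : R) (mxval g 1 0 : R) (mxval g 1 1 : R).
move=> a b c d D; rewrite !(mul0r, addr0, add0r, subr0) => n0.
rewrite -[X in _ = X / _]mulr1 -D.
by field.
Qed.

Fact mobius_subproof (g : SL2 R) (z : H2) :
  0 < (ofC (num (mxval g) (toC (coordH z)) / den (mxval g) (toC (coordH z)))).2.
Proof.
rewrite [ltRHS]Im_mobius divr_gt0 ?H2_gt0// lt_def sqabs_eq0 den_neq0/=.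
by rewrite /sqabs addr_ge0 ?sqr_ge0.
Qed.

Definition mobius (g : SL2 R) (z : H2) : H2 := toH2 (mobius_subproof g z).

(* The derivative of z |-> (az + b)/(cz + d) is multiplication by
   1/(cz + d)^2, because ad - bc = 1. *)
Definition dmobius (g : SL2 R) (z : H2) (v : R * R) : R * R :=
  ofC (toC v / den (mxval g) (toC (coordH z)) ^+ 2).

Lemma hnorm2E z v : hnorm2 z v = sqabs (toC v) / (coordH z).2 ^+ 2.
Proof. by []. Qed.

Lemma dmobius_isometry g z v : hnorm2 (mobius g z) (dmobius g z v) = hnorm2 z v.
Proof.
rewrite !hnorm2E /dmobius ofCK sqabsM sqabsV sqabsX.
have -> : (coordH (mobius g z)).2 =
  (coordH z).2 / sqabs (den (mxval g) (toC (coordH z))) by exact: Im_mobius.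
have := H2_gt0 z; have := den_neq0 g z; rewrite -sqabs_eq0 => n0 y0.
by field; rewrite n0 gt_eqF.
Qed.

Lemma toC_mobius g z : toC (coordH (mobius g z)) =
  num (mxval g) (toC (coordH z)) / den (mxval g) (toC (coordH z)).
Proof. exact: ofCK. Qed.

Lemma denM g h z : den (mxval (g * h)%g) (toC (coordH z)) =
  den (mxval g) (toC (coordH (mobius h z))) * den (mxval h) (toC (coordH z)).
Proof.
have E : mxval (g * h)%g = mxval g *m mxval h by [].
have := den_neq0 h z; rewrite toC_mobius /num /den E !mulmx2E.
move: (toC _) => w n0; rewrite !(rmorphD, rmorphM) /=.
by field.
Qed.

Lemma numM g h z : num (mxval (g * h)%g) (toC (coordH z)) =
  num (mxval g) (toC (coordH (mobius h z))) * den (mxval h) (toC (coordH z)).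
Proof.
have E : mxval (g * h)%g = mxval g *m mxval h by [].
have := den_neq0 h z; rewrite toC_mobius /num /den E !mulmx2E.
move: (toC _) => w n0; rewrite !(rmorphD, rmorphM) /=.
by field.
Qed.

Lemma coordH_inj : injective coordH. Proof. exact: val_inj. Qed.

Lemma mobiusM g h z : mobius (g * h)%g z = mobius g (mobius h z).
Proof.
apply/coordH_inj/(can_inj toCK); rewrite !toC_mobius numM denM -toC_mobius.
by rewrite -mulf_div mulfV ?den_neq0// mulr1.
Qed.

Lemma dmobiusM g h z v :
  dmobius (g * h)%g z v = dmobius g (mobius h z) (dmobius h z v).
Proof.
by rewrite /dmobius denM ofCK exprMn invfM mulrA mulrAC.
Qed.

Lemma den1 z : den (mxval (1%g : SL2 R)) z = 1.
Proof.
have E : mxval (1%g : SL2 R) = 1%:M by [].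
by rewrite /den E !mxE /= mul0r add0r.
Qed.

Lemma mobius1 z : mobius 1%g z = z.
Proof.
apply/coordH_inj/(can_inj toCK); rewrite toC_mobius den1 divr1 /num.
have E : mxval (1%g : SL2 R) = 1%:M by [].
by rewrite E !mxE /= mul1r addr0.
Qed.

Lemma dmobius1 z v : dmobius 1%g z v = v.
Proof. by rewrite /dmobius den1 expr1n divr1 toCK. Qed.

Lemma mobius_psl g h z : psl g = psl h -> mobius g z = mobius h z.
Proof.
move=> /psl_eqP[] E; first by congr mobius; exact: val_inj.
apply/coordH_inj/(can_inj toCK); rewrite !toC_mobius /num /den E !mxE !rmorphN /=.
by rewrite !mulNr -!opprD mulNr invrN mulrN opprK.
Qed.

Lemma dmobius_psl g h z v : psl g = psl h -> dmobius g z v = dmobius h z v.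
Proof.
move=> /psl_eqP[] E; first by congr dmobius; exact: val_inj.
by rewrite /dmobius /den E !mxE !rmorphN /= mulNr -opprD sqrrN.
Qed.

Definition actH2_fun (g : PSL2 R) (z : H2) : H2 := mobius (repr g) z.

Definition actT1_fun (g : PSL2 R) (u : T1H2) : T1H2 :=
  toT1H2 (etrans (dmobius_isometry (repr g) (base u) (dir u)) (hnorm2_dir u)).

Lemma actH2_fun1 z : actH2_fun 1%g z = z.
Proof. by rewrite -[RHS]mobius1; apply: mobius_psl; rewrite psl_repr. Qed.

Lemma actH2_funM g h z : actH2_fun (g * h)%g z = actH2_fun g (actH2_fun h z).
Proof.
rewrite /actH2_fun -mobiusM; apply: mobius_psl.
by rewrite psl_repr pslM !psl_repr.
Qed.

Lemma actT1_fun1 u : actT1_fun 1%g u = u.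
Proof.
apply: T1H2_eqP; first exact: actH2_fun1.
by rewrite -[RHS](dmobius1 (base u)); apply: dmobius_psl; rewrite psl_repr.
Qed.

Lemma actT1_funM g h u : actT1_fun (g * h)%g u = actT1_fun g (actT1_fun h u).
Proof.
apply: T1H2_eqP; first exact: actH2_funM.
rewrite [RHS]/(dir _) /= -[RHS]dmobiusM; apply: dmobius_psl.
by rewrite psl_repr pslM !psl_repr.
Qed.

Definition actH2 : gaction (PSL2 R) H2 := GAction actH2_fun1 actH2_funM.
Definition actT1 : gaction (PSL2 R) T1H2 := GAction actT1_fun1 actT1_funM.

End HyperbolicPlane.

Section Frame.
Variable R : realType.

Definition iH : H2 R := @toH2 R (0, 1) ltr01.

Fact upi_subproof : hnorm2 iH (0, 1) = 1 :> R.
Proof. by rewrite /hnorm2 /= expr0n /= add0r expr1n divr1. Qed.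

Definition upi : T1H2 R := toT1H2 upi_subproof.

Definition frame_to_T1 (g : PSL2 R) : T1H2 R := actT1 R g upi.

(* The inverse of [frame_to_T1]: if g = (a b; c d) sends [upi] to the vector v
   at z, then i / (c i + d)^2 = v and a i + b = z (c i + d). *)
Definition frame_w (u : T1H2 R) : R[i] := sqrtc ('i / toC (dir u)).
Definition frame_mx (u : T1H2 R) : 'M[R]_2 :=
  let w := frame_w u in let zw := toC (coordH (base u)) * w in
  mx2 (complex.Im zw) (complex.Re zw) (complex.Im w) (complex.Re w).

Lemma sqabs_dir (u : T1H2 R) : sqabs (toC (dir u)) = (coordH (base u)).2 ^+ 2.
Proof.
have := hnorm2_dir u; rewrite hnorm2E => /(congr1 ( *%R^~ ((coordH (base u)).2 ^+ 2))).
by rewrite mul1r divfK// expf_neq0// gt_eqF ?H2_gt0.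
Qed.

Lemma toC_dir_neq0 (u : T1H2 R) : toC (dir u) != 0.
Proof. by rewrite -sqabs_eq0 sqabs_dir expf_neq0// gt_eqF ?H2_gt0. Qed.

Lemma sqabs_ge0 (z : R[i]) : 0 <= sqabs z.
Proof. by rewrite addr_ge0 ?sqr_ge0. Qed.

Lemma sqabs_frame_w (u : T1H2 R) : sqabs (frame_w u) = (coordH (base u)).2^-1.
Proof.
apply/eqP; rewrite -(eqrXn2 (n := 2)) ?sqabs_ge0 ?invr_ge0 ?(ltW (H2_gt0 _))//.
rewrite -sqabsX sqr_sqrtc sqabsM sqabsV sqabs_dir exprVn.
by rewrite /sqabs /= expr0n /= add0r expr1n mul1r.
Qed.

Fact frame_det (u : T1H2 R) : \det (frame_mx u) = 1.
Proof.
rewrite det2E /frame_mx !mx2E.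
have := sqabs_frame_w u; have := H2_gt0 (base u); rewrite /sqabs.
case: (frame_w u) => d c; case: (coordH (base u)) => x y /= y0 E.
rewrite -[RHS](mulfV (lt0r_neq0 y0)) -E; ring.
Qed.

Definition frame (u : T1H2 R) : PSL2 R := psl (toSL2 (frame_det u)).

Lemma toC_num_i (g : SL2 R) :
  num (mxval g) (toC (coordH iH)) = mxval g 0 1 +i* mxval g 0 0.
Proof. by rewrite /num /toC /=; simpc. Qed.

Lemma toC_den_i (g : SL2 R) :
  den (mxval g) (toC (coordH iH)) = mxval g 1 1 +i* mxval g 1 0.
Proof. by rewrite /den /toC /=; simpc. Qed.

Lemma base_frame_to_T1 g : toC (coordH (base (frame_to_T1 (psl g)))) =
  (mxval g 0 1 +i* mxval g 0 0) / (mxval g 1 1 +i* mxval g 1 0).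
Proof.
rewrite -toC_num_i -toC_den_i -toC_mobius; congr (toC (coordH _)).
by apply: mobius_psl; rewrite psl_repr.
Qed.

Lemma dir_frame_to_T1 g : toC (dir (frame_to_T1 (psl g))) =
  'i / (mxval g 1 1 +i* mxval g 1 0) ^+ 2.
Proof.
rewrite -toC_den_i -[RHS]ofCK; congr toC.
by apply: (@dmobius_psl R _ _ iH (0, 1)); rewrite psl_repr.
Qed.

Lemma frameK : cancel frame frame_to_T1.
Proof.
move=> u; set w := frame_w u.
have w0 : w != 0.
  by rewrite -sqabs_eq0 sqabs_frame_w invr_eq0 gt_eqF ?H2_gt0.
have eqC (z : R[i]) : complex.Re z +i* complex.Im z = z by case: z.
have i0 : ('i : R[i]) != 0 by rewrite eq_complex /= oner_eq0 andbF.
apply: T1H2_eqP.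
  apply/coordH_inj/(can_inj (@toCK R)).
  by rewrite base_frame_to_T1 /mxval [val _]/(frame_mx u) !mx2E !eqC mulfK.
apply: (can_inj (@toCK R)).
by rewrite dir_frame_to_T1 /mxval [val _]/(frame_mx u) !mx2E eqC sqr_sqrtc invfM
  invrK mulrA mulfV ?mul1r.
Qed.

Lemma frame_to_T1_inj : injective frame_to_T1.
Proof.
move=> x y; rewrite -(psl_repr x) -(psl_repr y).
move: (repr x) (repr y) => g h E.
have := congr1 (fun u => toC (coordH (base u))) E.
have := congr1 (fun u => toC (dir u)) E.
rewrite !base_frame_to_T1 !dir_frame_to_T1.
have i0 : ('i : R[i]) != 0 by rewrite eq_complex /= oner_eq0 andbF.
have := den_neq0 g iH; have := den_neq0 h iH; rewrite !toC_den_i => h0 g0.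
move=> /(mulfI i0)/invr_inj/eqP; rewrite eqf_sqr => /orP[]/eqP W.
  rewrite W => /(mulIf (invr_neq0 h0)) Z; apply/psl_eqP; left.
  by case: W Z => e1 e2 [e3 e4]; apply: mx2_eqP.
rewrite W invrN mulrN -mulNr => /(mulIf (invr_neq0 h0)) Z; apply/psl_eqP; right.
move: W Z; rewrite -[- (_ +i* _)]/(_ +i* _) => -[e1 e2].
move=> /(congr1 -%R); rewrite opprK => -[e3 e4].
by apply: mx2_eqP; rewrite !mxE // -?e3 -?e4 ?opprK.
Qed.

Lemma frame_to_T1K : cancel frame_to_T1 frame.
Proof. by move=> g; apply: frame_to_T1_inj; rewrite frameK. Qed.

Lemma frame_to_T1M g h : frame_to_T1 (g * h)%g = actT1 R g (frame_to_T1 h).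
Proof. exact: actM. Qed.

Lemma frameM g u : frame (actT1 R g u) = (g * frame u)%g.
Proof. by apply: frame_to_T1_inj; rewrite frame_to_T1M !frameK. Qed.

End Frame.

Section Horocycle.
Variables (R : realType) (Gamma : groupClosed (PSL2 R)).

Fact translation1 (G : groupType) (x : G) : (1 * x)%g = x.
Proof. exact: mul1g. Qed.
Fact translationM (G : groupType) (g h x : G) : ((g * h) * x)%g = (g * (h * x))%g.
Proof. by rewrite mulgA. Qed.
Definition translation (G : groupType) : gaction G G :=
  GAction (@translation1 G) (@translationM G).

Definition surface := orbit_space Gamma (actH2 R).

(* For Gamma acting freely and properly discontinuously, the unit tangent
   vectors of the surface are the Gamma-orbits of those of the plane. *)
Definition T1surface := orbit_space Gamma (actT1 R).

Definition cosetX := orbit_space Gamma (translation (PSL2 R)).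

Fact bmx_det (t : R) : \det (mx2 1 t 0 1) = 1.
Proof. by rewrite det2E !mxE /= mulr1 mulr0 subr0. Qed.
Definition bt (t : R) : PSL2 R := psl (toSL2 (bmx_det t)).

Definition thetaX (t : R) (x : cosetX) : cosetX := \pi_cosetX (repr x * bt t)%g.

Lemma thetaX_pi t (g : PSL2 R) :
  thetaX t (\pi_cosetX g) = \pi_cosetX (g * bt t)%g.
Proof.
have /orbit_spaceP[h hG E] := reprK (\pi_cosetX g).
by apply/orbit_spaceP; exists h => //; rewrite [in LHS]E /= mulgA.
Qed.

Definition Xi (p : T1surface) : cosetX := \pi_cosetX (frame (repr p)).
Definition Xi_inv (x : cosetX) : T1surface := \pi_T1surface (frame_to_T1 (repr x)).

Lemma Xi_pi u : Xi (\pi_T1surface u) = \pi_cosetX (frame u).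
Proof.
have /orbit_spaceP[h hG E] := reprK (\pi_T1surface u).
by apply/orbit_spaceP; exists h => //; rewrite [in LHS]E frameM.
Qed.

Lemma Xi_inv_pi g : Xi_inv (\pi_cosetX g) = \pi_T1surface (frame_to_T1 g).
Proof.
have /orbit_spaceP[h hG E] := reprK (\pi_cosetX g).
by apply/orbit_spaceP; exists h => //; rewrite [in LHS]E frame_to_T1M.
Qed.

Lemma XiK : cancel Xi Xi_inv.
Proof. by move=> p; rewrite -(reprK p) Xi_pi Xi_inv_pi frameK. Qed.

Lemma Xi_invK : cancel Xi_inv Xi.
Proof. by move=> x; rewrite -(reprK x) Xi_inv_pi Xi_pi frame_to_T1K. Qed.

Definition horocycle (t : R) (p : T1surface) : T1surface :=
  Xi_inv (thetaX t (Xi p)).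

End Horocycle.

Section SasakiDistance.
Variable R : realType.

Definition C1 (f : R -> R) : Prop :=
  (forall t, derivable f t 1) /\ continuous (derive1 f).

Definition C1_curve (c : R -> T1H2 R) : Prop :=
  [/\ C1 (fun t => (coordH (base (c t))).1),
      C1 (fun t => (coordH (base (c t))).2),
      C1 (fun t => (dir (c t)).1) & C1 (fun t => (dir (c t)).2)].

Definition dbase (c : R -> T1H2 R) (t : R) : R * R :=
  (derive1 (fun s => (coordH (base (c s))).1) t,
   derive1 (fun s => (coordH (base (c s))).2) t).

(* The covariant derivative along the base curve (x, y) of the vector field
   v = (v1, v2): the nonzero Christoffel symbols of (dx^2 + dy^2) / y^2 are
   G^x_xy = G^x_yx = G^y_yy = - 1/y and G^y_xx = 1/y. *)
Definition cov_deriv (c : R -> T1H2 R) (t : R) : R * R :=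
  let y := (coordH (base (c t))).2 in
  let z' := dbase c t in
  let v := dir (c t) in
  (derive1 (fun s => (dir (c s)).1) t - (z'.1 * v.2 + z'.2 * v.1) / y,
   derive1 (fun s => (dir (c s)).2) t + (z'.1 * v.1 - z'.2 * v.2) / y).

Definition sasaki_speed (c : R -> T1H2 R) (t : R) : R :=
  Num.sqrt (hnorm2 (base (c t)) (dbase c t) + hnorm2 (base (c t)) (cov_deriv c t)).

Definition sasaki_length (c : R -> T1H2 R) : R :=
  \int[lebesgue_measure]_(t in `[0, 1]) sasaki_speed c t.

Variable Gamma : groupClosed (PSL2 R).

(* [curve_of_length p q l]: a piecewise C^1 curve of length l joins p to q in
   the unit tangent bundle of the surface. Each C^1 piece is the projection of a
   C^1 curve upstairs, restricted to [0, 1]; consecutive pieces need only match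
   in the quotient. *)
Inductive curve_of_length : T1surface Gamma -> T1surface Gamma -> R -> Prop :=
| curve_nil p : curve_of_length p p 0
| curve_cons (c : R -> T1H2 R) q l : C1_curve c ->
    curve_of_length (\pi_(T1surface Gamma) (c 1)) q l ->
    curve_of_length (\pi_(T1surface Gamma) (c 0)) q (sasaki_length c + l).

(* A finite infimum: any two unit tangent vectors of the plane are joined by a
   C^1 curve. *)
Definition sasaki_dist (p q : T1surface Gamma) : R :=
  inf [set l | curve_of_length p q l].

End SasakiDistance.

Section Flows.
Variables (R : realType) (M : Type) (d : M -> M -> R).
Implicit Types phi psi : R -> M -> M.

Definition continuous_flow phi : Prop :=
  [/\ forall x, phi 0 x = x,
      forall s t x, phi (s + t) x = phi s (phi t x) &
      forall t x (e : R), 0 < e -> exists2 delta : R, 0 < delta &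
        forall s y, `|s - t| < delta -> d x y < delta -> d (phi t x) (phi s y) < e].

Definition increasing_homeo (s : R -> R) : Prop :=
  {homo s : x y / x < y} /\
  exists r : R -> R, [/\ cancel s r, cancel r s, continuous s & continuous r].

Definition time_change phi psi : Prop :=
  forall x, exists s : R -> R,
    [/\ increasing_homeo s, s 0 = 0 & forall t, phi t x = psi (s t) x].

Definition positive_kinematic_expansive phi : Prop :=
  forall e : R, 0 < e -> exists2 delta : R, 0 < delta &
    forall x y, (forall t, 0 <= t -> d (phi t x) (phi t y) < delta) ->
      exists tau : R, - e < tau < e /\ y = phi tau x.

Definition positive_strong_kinematic_expansive psi : Prop :=
  forall phi, continuous_flow phi -> time_change phi psi ->
    positive_kinematic_expansive phi.

End Flows.

Section GroupHypotheses.
Variables (R : realType) (Gamma : groupClosed (PSL2 R)).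

Definition discrete_subgroup : Prop :=
  forall g : PSL2 R, g \in Gamma -> isolated [set h | h \in Gamma] g.

Definition acts_freely : Prop :=
  forall (g : PSL2 R) (z : H2 R), g \in Gamma -> actH2 R g z = z -> g = 1%g.

Definition cocompact : Prop :=
  compact [set: quotient_topology (surface Gamma)].

End GroupHypotheses.

(* Main.v *)
Require Import Defs.
From mathcomp Require Import all_boot all_order all_algebra.
From mathcomp Require Import all_classical all_reals all_analysis.
From mathcomp Require Import complex ring lra.

(* Lift the compact unit tangent bundle to SL2: if the forward phi-orbits of x
   and y stay close, their lifts to SL2 stay close along a single translate, so
   y = x k with u(-s) k u(r) near 1 for unbounded horocycle times s, r.  This
   forces k to be upper triangular, k = geo l * upper b, and it remains to
   exclude l <> 0.  There the phi-time needed for a horocycle segment of length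
   a from x and of length a exp(-2l) from x (geo l) differ by a bounded amount
   for all a >= 0, that is, a cocycle over the horocycle flow is bounded along
   one forward orbit, hence on a minimal set Y.  As in Hedlund's theorem Y is
   invariant under the geodesic flow, so the comparison can be iterated: a
   segment of length exp(2 |l| n) takes phi-time O(n).  By compactness it also
   takes time at least c (exp(2 |l| n) - 1), a contradiction. *)

Set Implicit Arguments.
Unset Strict Implicit.
Unset Printing Implicit Defensive.

Import Order.TTheory GRing.Theory Num.Theory.
Import numFieldNormedType.Exports.

Local Open Scope classical_set_scope.
Local Open Scope ring_scope.

(** * The entry norm on SL2 *)

(** Distance alone cannot exclude l <> 0: the horocycles through x and through x (geo l) stay at
    bounded distance for ever, small if l is small, and a time change may adjust the speeds on the
    two so that companions stay together. What fails is only that such an adjustment would have to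
    persist at every scale. A bound along one forward orbit passes to limits of that orbit, but to
    iterate it one needs a set that inherits the bound and is stable under [geo l]; a minimal subset
    is both. The triangular shape of k comes from a single entry: the bottom right entry of u(-s) k
    u(r) is k10 r + k11. It contains only the second horocycle time, so it can be used before
    anything is known about how s and r compare. The top right entry then compares them, up to a
    bounded error. All estimates are made on SL2 lifts with [dev], the displacement from 1. The
    Sasaki distance is tied to it by two local comparisons, [sasaki_dist_dev] and
    [sasaki_dist_near]. The reparametrisation is given orbit by orbit, and its continuous dependence
    on the point has to be derived. *)

Section EntryNorm.
Variable R : realType.
Implicit Types (M N : 'M[R]_2) (g h k : SL2 R).

Lemma SL2_det g :
  mxval g 0 0 * mxval g 1 1 - mxval g 0 1 * mxval g 1 0 = 1.
Proof. by rewrite -det2E det_SL2. Qed.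

Lemma SL2_mulE g h i j :
  mxval (g * h)%g i j = mxval g i 0 * mxval h 0 j + mxval g i 1 * mxval h 1 j.
Proof. exact: mulmx2E. Qed.

Lemma SL2_oneE : ((mxval (1%g : SL2 R) 0 0 = 1) * (mxval (1%g : SL2 R) 0 1 = 0) *
  (mxval (1%g : SL2 R) 1 0 = 0) * (mxval (1%g : SL2 R) 1 1 = 1))%type.
Proof. by rewrite /mxval /=; split; [split; [split|]|]; rewrite mxE. Qed.

Lemma SL2P g h : mxval g 0 0 = mxval h 0 0 -> mxval g 0 1 = mxval h 0 1 ->
  mxval g 1 0 = mxval h 1 0 -> mxval g 1 1 = mxval h 1 1 -> g = h.
Proof. by move=> *; apply: val_inj; exact: mx2_eqP. Qed.

Definition mkSL2 (a b c d : R) (e : a * d - b * c = 1) : SL2 R :=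
  toSL2 (etrans (det2E (mx2 a b c d))
    (etrans (congr2 (fun x y => x - y)
      (congr2 *%R (mx2E a b c d).1.1.1 (mx2E a b c d).2)
      (congr2 *%R (mx2E a b c d).1.1.2 (mx2E a b c d).1.2)) e)).

Lemma mkSL2E a b c d (e : a * d - b * c = 1) :
  ((mxval (mkSL2 e) 0 0 = a) * (mxval (mkSL2 e) 0 1 = b) *
  (mxval (mkSL2 e) 1 0 = c) * (mxval (mkSL2 e) 1 1 = d))%type.
Proof. exact: mx2E. Qed.

Lemma SL2_invE g : ((mxval g^-1%g 0 0 = mxval g 1 1) *
  (mxval g^-1%g 0 1 = - mxval g 0 1) * (mxval g^-1%g 1 0 = - mxval g 1 0) *
  (mxval g^-1%g 1 1 = mxval g 0 0))%type.
Proof.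
have D : mxval g 1 1 * mxval g 0 0 - (- mxval g 0 1) * (- mxval g 1 0) = 1.
  by rewrite -(SL2_det g); ring.
have -> : (g^-1)%g = mkSL2 D.
  apply: (mulgI g); rewrite mulgV; have := SL2_det g => E.
  by apply: SL2P; rewrite SL2_mulE !mkSL2E SL2_oneE; rewrite -?E; ring.
by rewrite !mkSL2E.
Qed.

Definition nrm M : R := `|M 0 0| + `|M 0 1| + `|M 1 0| + `|M 1 1|.

Lemma nrm_ge0 M : 0 <= nrm M.
Proof. by rewrite /nrm !addr_ge0. Qed.

Lemma nrmD M N : nrm (M + N) <= nrm M + nrm N.
Proof.
rewrite /nrm !mxE.
have := ler_normD (M 0 0) (N 0 0); have := ler_normD (M 0 1) (N 0 1).
have := ler_normD (M 1 0) (N 1 0); have := ler_normD (M 1 1) (N 1 1).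
lra.
Qed.

Lemma nrmN M : nrm (- M) = nrm M.
Proof. by rewrite /nrm !mxE !normrN. Qed.

Lemma nrmB M N : nrm (M - N) = nrm (N - M).
Proof. by rewrite -nrmN opprB. Qed.

Lemma nrmBE M N : nrm (M - N) = `|M 0 0 - N 0 0| + `|M 0 1 - N 0 1| +
  `|M 1 0 - N 1 0| + `|M 1 1 - N 1 1|.
Proof. by rewrite /nrm !mxE. Qed.

Lemma nrmM M N : nrm (M *m N) <= nrm M * nrm N.
Proof.
have T (a b c d : R) : `|a * b + c * d| <= `|a| * `|b| + `|c| * `|d|.
  by rewrite -!normrM ler_normD.
rewrite /nrm !mulmx2E.
have := T (M 0 0) (N 0 0) (M 0 1) (N 1 0).
have := T (M 0 0) (N 0 1) (M 0 1) (N 1 1).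
have := T (M 1 0) (N 0 0) (M 1 1) (N 1 0).
have := T (M 1 0) (N 0 1) (M 1 1) (N 1 1).
have : forall a b : R, 0 <= `|a| * `|b| by move=> a b; rewrite mulr_ge0.
move=> H.
have := H (M 0 0) (N 1 0); have := H (M 0 0) (N 1 1).
have := H (M 0 1) (N 0 0); have := H (M 0 1) (N 0 1).
have := H (M 1 0) (N 1 0); have := H (M 1 0) (N 1 1).
have := H (M 1 1) (N 0 0); have := H (M 1 1) (N 0 1).
rewrite !mulrDl !mulrDr; lra.
Qed.

(** The inverse of a matrix of determinant 1 is its adjugate, so inversion permutes the entries up
    to sign. *)
Lemma nrmV g : nrm (mxval g^-1%g) = nrm (mxval g).
Proof. by rewrite /nrm !SL2_invE !normrN; ring. Qed.

Lemma nrm_entry M i j : `|M i j| <= nrm M.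
Proof.
have E (k : 'I_2) : k = 0 \/ k = 1.
  by case: k => -[|[|//]] ?; [left|right]; exact: val_inj.
have := normr_ge0 (M 0 0); have := normr_ge0 (M 0 1).
have := normr_ge0 (M 1 0); have := normr_ge0 (M 1 1).
by rewrite /nrm; case: (E i) => ->; case: (E j) => -> *; lra.
Qed.

Lemma nrm_eq0 M : nrm M = 0 -> M = 0.
Proof.
move=> N0; have Z i j : M i j = 0.
  by apply/eqP; rewrite -normr_le0 -N0 nrm_entry.
by apply/matrixP => i j; rewrite Z mxE.
Qed.

(** Used as [dev (g^-1 * h)], this plays the part of a left-invariant distance from g to h. In place
    of the triangle inequality, [1 + dev] is submultiplicative. *)
Definition dev g : R := nrm (mxval g - mxval (1%g : SL2 R)).

Lemma devE g : dev g =
  `|mxval g 0 0 - 1| + `|mxval g 0 1| + `|mxval g 1 0| + `|mxval g 1 1 - 1|.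
Proof. by rewrite /dev /nrm !mxE /= !subr0. Qed.

Lemma dev_ge0 g : 0 <= dev g. Proof. exact: nrm_ge0. Qed.

Lemma dev1 : dev 1%g = 0.
Proof. by rewrite devE !SL2_oneE !subrr !normr0 !addr0. Qed.

Lemma devV g : dev g^-1%g = dev g.
Proof. by rewrite !devE !SL2_invE !normrN; ring. Qed.

Lemma mxvalM g h : mxval (g * h)%g = mxval g *m mxval h. Proof. by []. Qed.

Lemma mxval1 : mxval (1%g : SL2 R) = 1%:M. Proof. by []. Qed.

Lemma devM g h : 1 + dev (g * h)%g <= (1 + dev g) * (1 + dev h).
Proof.
have -> : dev (g * h)%g = nrm ((mxval g - 1%:M) *m (mxval h - 1%:M) +
    ((mxval g - 1%:M) + (mxval h - 1%:M))).
  rewrite /dev mxvalM; congr nrm.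
  rewrite mulmxBl !mulmxBr mulmx1 mul1mx mxval1 mul1mx.
  move: (mxval g *m mxval h) => P; move: (mxval g) (mxval h) => A B.
  by apply/matrixP => i j; rewrite !mxE; ring.
have := nrmD ((mxval g - 1%:M) *m (mxval h - 1%:M))
   ((mxval g - 1%:M) + (mxval h - 1%:M)).
have := nrmD (mxval g - 1%:M) (mxval h - 1%:M).
have := nrmM (mxval g - 1%:M) (mxval h - 1%:M).
by rewrite /dev mxval1; lra.
Qed.

Lemma dev_mulV g h : dev (g^-1 * h)%g <= nrm (mxval g) * nrm (mxval h - mxval g).
Proof.
rewrite -nrmV; apply: le_trans (nrmM _ _); rewrite mulmxBr -!mxvalM.
by rewrite mulVg.
Qed.

Lemma dev_conj g k : dev (g * k * g^-1)%g <= nrm (mxval g) ^+ 2 * dev k.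
Proof.
rewrite expr2 mulrAC -[X in _ <= _ * X]nrmV.
have -> : dev (g * k * g^-1)%g =
    nrm ((mxval g *m (mxval k - mxval (1%g : SL2 R))) *m mxval g^-1%g).
  by rewrite mulmxBr mulmxBl -!mxvalM mulg1 mulgV.
apply: le_trans (nrmM _ _) _; rewrite ler_wpM2r ?nrm_ge0//.
exact: nrmM.
Qed.

End EntryNorm.

(** * Orbits of the lattice *)

Section SL2Compactness.
Variable R : realType.

(** Balls for [nrm] are compact: the entries stay in a box of R^4 and the determinant condition is
    closed. Filters are allowed because the chains in Zorn's lemma are not sequences. *)
Lemma SL2_cluster (N : R) (F : set_system (SL2 R)) {PF : ProperFilter F} :
  F [set g | nrm (mxval g) <= N] ->
  exists g : SL2 R, forall (eta : R) (A : set (SL2 R)), 0 < eta -> F A ->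
    exists2 h, A h & nrm (mxval h - mxval g) < eta.
Proof.
move=> FN.
pose q (g : SL2 R) : R * R * R * R :=
  (mxval g 0 0, mxval g 0 1, mxval g 1 0, mxval g 1 1).
pose I : set R := [set` `[- N, N]].
have cK : compact (I `*` I `*` I `*` I).
  by do 3 (apply: compact_setX; last exact: segment_compact); exact: segment_compact.
have FK : F (q @^-1` (I `*` I `*` I `*` I)).
  apply: filterS FN => g /= gN; have B i j : I (mxval g i j).
    by rewrite /I /= in_itv /= -ler_norml (le_trans (nrm_entry _ i j)).
  by do !split; apply: B.
have [p [_ clp]] := cK _ (fmap_proper_filter q PF) FK.
pose D (x : R * R * R * R) := x.1.1.1 * x.2 - x.1.1.2 * x.1.2.
have D1 : D p = 1.
  apply/eqP; apply: contrapT => /negP nD.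
  have cD : {for p, continuous D}.
    have f1 : {for p, continuous (fun x : R * R * R * R => x.1)} by exact: cvg_fst.
    have f2 : {for p, continuous (fun x : R * R * R * R => x.1.1)}.
      by apply: continuous_comp f1 _; exact: cvg_fst.
    have f3 : {for p, continuous (fun x : R * R * R * R => x.1.1.1)}.
      by apply: continuous_comp f2 _; exact: cvg_fst.
    have f4 : {for p, continuous (fun x : R * R * R * R => x.1.1.2)}.
      by apply: continuous_comp f2 _; exact: cvg_snd.
    have f5 : {for p, continuous (fun x : R * R * R * R => x.1.2)}.
      by apply: continuous_comp f1 _; exact: cvg_snd.
    have f6 : {for p, continuous (fun x : R * R * R * R => x.2)} by exact: cvg_snd.
    by apply: cvgB; exact: cvgM.
  have : nbhs p (D @^-1` [set x | x != 1]).
    apply: cD; apply: open_nbhs_nbhs; split; first exact: open_neq.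
    exact: nD.
  move=> /(clp (range q)) [|_ [[g _ <-]] /=].
    by rewrite /fmap /=; apply: filterS (filterT (F := F)) => g _; exists g.
  by rewrite /D /= SL2_det eqxx.
exists (mkSL2 D1) => eta A eta0 FA.
have e4 : 0 < eta / 4 by lra.
have : nbhs p (ball p (eta / 4)) by exact: nbhsx_ballx.
move=> /(clp (q @` A)) [|_ [[g Ag <-]] /= [[[b1 b2] b3] b4]].
  by rewrite /fmap /=; apply: filterS FA => g Ag; exists g.
exists g => //; rewrite nrmB nrmBE !mkSL2E.
move: b1 b2 b3 b4; rewrite /ball /=; lra.
Qed.

Lemma SL2_bolzano_weierstrass (N : R) (u : nat -> SL2 R) :
  (forall n, nrm (mxval (u n)) <= N) ->
  exists g : SL2 R, forall eta n0, 0 < eta ->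
    exists2 n, (n0 <= n)%N & nrm (mxval (u n) - mxval g) < eta.
Proof.
move=> uN; have [|g gP] := @SL2_cluster N (fmap u \oo) _.
  by apply: filterS (filterT (F := \oo)) => n _; exact: uN.
exists g => eta n0 eta0.
have [||_ [n n0n <-] H] := gP eta (u @` [set n | (n0 <= n)%N]) => //.
  by exists n0 => // n n0n; exists n.
by exists n.
Qed.

End SL2Compactness.

Section Lattice.
Variables (R : realType) (Gamma : groupClosed (PSL2 R)).
Implicit Types g h k : SL2 R.

Definition lat g : Prop := psl g \in Gamma.

Lemma latM g h : lat g -> lat h -> lat (g * h)%g.
Proof. by rewrite /lat pslM => *; rewrite gpredM. Qed.
Lemma latV g : lat g -> lat g^-1%g.
Proof. by rewrite /lat => *; rewrite -psl_inv gpredV. Qed.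

(** Every point of the unit tangent bundle has this form. Left multiplication by the lattice
    disappears and the horocycle flow becomes right multiplication by [upper]. *)
Definition pt g : T1surface Gamma :=
  (\pi_(T1surface Gamma) (frame_to_T1 (psl g)))%qT.

Lemma pt_eqP g h : pt g = pt h <-> lat (h * g^-1)%g.
Proof.
rewrite /pt orbit_spaceP; split.
  move=> [x xG]; rewrite -frame_to_T1M => /frame_to_T1_inj E.
  by rewrite /lat pslM E -mulgA -pslM mulgV mulg1.
move=> H; exists (psl (h * g^-1)%g) => //.
by rewrite -frame_to_T1M -pslM -mulgA mulVg mulg1.
Qed.

Lemma pt_lat g h : lat g -> pt (g * h)%g = pt h.
Proof. by move=> gL; apply/esym/pt_eqP; rewrite -mulgA mulgV mulg1. Qed.

Lemma pt_surj p : exists g, p = pt g.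
Proof.
exists (repr (frame (repr p))).
by rewrite /pt psl_repr frameK reprK.
Qed.

Definition upper t : SL2 R := toSL2 (bmx_det t).

Lemma horocycle_pt t g : horocycle t (pt g) = pt (g * upper t)%g.
Proof.
by rewrite /horocycle Xi_pi frame_to_T1K thetaX_pi Xi_inv_pi /pt pslM.
Qed.

Lemma upperE t : ((mxval (upper t) 0 0 = 1) * (mxval (upper t) 0 1 = t) *
  (mxval (upper t) 1 0 = 0) * (mxval (upper t) 1 1 = 1))%type.
Proof. exact: mx2E. Qed.

Lemma upperD s t : upper (s + t) = (upper s * upper t)%g.
Proof. by apply: SL2P; rewrite SL2_mulE !upperE; ring. Qed.

Lemma upper0 : upper 0 = 1%g.
Proof. by apply: SL2P; rewrite !upperE SL2_oneE. Qed.

Lemma upperN t : upper (- t) = (upper t)^-1%g.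
Proof. by apply: (mulgI (upper t)); rewrite -upperD mulgV subrr upper0. Qed.

End Lattice.

Section LatticeHypotheses.
Variables (R : realType) (Gamma : groupClosed (PSL2 R)).
Implicit Types g h k : SL2 R.

Lemma nbhs_SL2 (V : set (SL2 R)) : nbhs (1%g : SL2 R) V ->
  exists2 eta : R, 0 < eta & forall g, dev g < eta -> V g.
Proof.
rewrite nbhsE => -[W [[A oA AW] W1] WV].
have A1 : A (mxval (1%g : SL2 R)) by have := W1; rewrite -AW.
have : nbhs (mxval (1%g : SL2 R)) A by apply: open_nbhs_nbhs.
move=> /nbhs_ballP[e /= e0 eA]; exists e => // g ge; apply: WV; rewrite -AW.
apply: eA; split => // i j; rewrite /ball /= distrC.
have := nrm_entry (mxval g - mxval (1%g : SL2 R)) i j.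
by rewrite !mxE => /le_lt_trans; apply.
Qed.

Lemma discrete_dev : discrete_subgroup Gamma ->
  exists2 eta : R, 0 < eta & forall g, lat Gamma g -> dev g < eta -> g = 1%g.
Proof.
have G1 : (1%g : PSL2 R) \in Gamma by rewrite gpred1.
move=> /(_ 1%g G1) [_ [V V1 VG]].
have : nbhs (1%g : SL2 R) (@psl R @^-1` V).
  exact: (@pi_continuous (SL2 R) {eq_quot (psl_equiv R)}%qT 1%g).
move=> /nbhs_SL2[eta eta0 etaV].
(* Isolation in PSL2 leaves g = 1 or g = -1; the bound 1 discards the latter, whose [dev] is 4. *)
exists (Num.min eta 1); first by rewrite lt_min eta0 ltr01.
move=> g gL; rewrite lt_min => /andP[/etaV Vg g1].
have : [set (1%g : PSL2 R)] (psl g) by rewrite -VG; split.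
move=> /psl_eqP[E|E]; first exact: val_inj.
move: g1; rewrite devE E !mxE /= => g1; exfalso.
have := normr_ge0 (- 0 : R).
have : `|- 1 - 1 : R| = 2 by rewrite ltr0_norm; lra.
by move: g1; lra.
Qed.

(** This is |cz + d|^2 in real coordinates. *)
Definition mobius_den g (z : H2 R) : R :=
  (mxval g 1 0 * (coordH z).1 + mxval g 1 1) ^+ 2 +
  mxval g 1 0 ^+ 2 * (coordH z).2 ^+ 2.

Lemma mobius_coord g z : coordH (mobius g z) =
  (((mxval g 0 0 * (coordH z).1 + mxval g 0 1) *
     (mxval g 1 0 * (coordH z).1 + mxval g 1 1) +
     mxval g 0 0 * mxval g 1 0 * (coordH z).2 ^+ 2) / mobius_den g z,
   (coordH z).2 / mobius_den g z).
Proof.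
have D : sqabs (den (mxval g) (toC (coordH z))) = mobius_den g z.
  rewrite /den /sqabs /mobius_den; case: (coordH z) => x y /=.
  by rewrite !(mul0r, addr0, add0r, subr0) exprMn.
apply: (can_inj (@toCK R)); rewrite toC_mobius.
have := den_neq0 g z; rewrite -sqabs_eq0 D => n0.
have := Im_mobius g z; rewrite D => I.
have eqC (w : R[i]) : w = (complex.Re w +i* complex.Im w)%C by case: w.
rewrite [LHS]eqC I /toC; congr (_ +i* _)%C.
move: n0; rewrite /mobius_den /Defs.num /den; case: (coordH z) => x y /= n0.
rewrite !(mul0r, addr0, add0r, subr0, mulr0).
rewrite exprMn; move: n0; set d := (X in X != 0) => d0.
by rewrite -/d; field.
Qed.

Lemma mobius_den_gt0 g z : 0 < mobius_den g z.
Proof.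
by have := H2_gt0 (mobius g z); rewrite mobius_coord /= pmulr_rgt0 ?H2_gt0// invr_gt0.
Qed.

Lemma mobius_formula_continuous (T : topologicalType) (x y : T -> R) (a b c d : R) :
  let D t := (c * x t + d) ^+ 2 + c ^+ 2 * y t ^+ 2 in
  continuous x -> continuous y -> (forall t, 0 < D t) ->
  continuous (fun t => ((a * x t + b) * (c * x t + d) + a * c * y t ^+ 2) / D t) /\
  continuous (fun t => y t / D t).
Proof.
move=> D cx cy D0.
have cl (p q : R) : continuous (fun t => p * x t + q).
  by move=> t; apply: cvgD; [apply: cvgM; [exact: cvg_cst|exact: cx]|exact: cvg_cst].
have cq (p : R) : continuous (fun t => p * y t ^+ 2).
  by move=> t; apply: cvgM; [exact: cvg_cst|apply: cvgM; exact: cy].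
have cV : continuous (fun t => (D t)^-1).
  move=> t; apply: cvgV; first by rewrite gt_eqF.
  by apply: cvgD; [apply: cvgM; exact: cl|exact: cq].
split=> t; apply: cvgM; [|exact: cV|exact: cy|exact: cV].
by apply: cvgD; [apply: cvgM; exact: cl|exact: cq].
Qed.

Lemma mobius_continuous g : continuous (fun z => (coordH (mobius g z)).1) /\
  continuous (fun z => (coordH (mobius g z)).2).
Proof.
have cH : continuous (@coordH R) by exact: initial_continuous.
have c1 : continuous (fun z : H2 R => (coordH z).1).
  by move=> z; apply: continuous_comp (cH z) _; exact: cvg_fst.
have c2 : continuous (fun z : H2 R => (coordH z).2).
  by move=> z; apply: continuous_comp (cH z) _; exact: cvg_snd.
have [] := mobius_formula_continuous (mxval g 0 0) (mxval g 0 1) c1 c2 (mobius_den_gt0 g).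
move=> h1 h2; split.
  by rewrite (_ : (fun _ => _) = (fun z => (coordH (mobius g z)).1)) // in h1;
     apply/funext => z; rewrite mobius_coord.
by rewrite (_ : (fun _ => _) = (fun z => (coordH (mobius g z)).2)) // in h2;
   apply/funext => z; rewrite mobius_coord.
Qed.

(** The images in the surface of the boxes |x| < n, 1/n < y < n are open, increasing and exhaust it,
    so one of them is the whole surface. Matrices that send i into a fixed box have bounded
    entries. *)
Lemma cocompact_bounded : cocompact Gamma ->
  exists N : R, forall g, exists2 k, lat Gamma k & nrm (mxval (k * g)%g) <= N.
Proof.
move=> /compact_near_coveringP cpt.
pose S : Type := quotient_topology (surface Gamma).
pose proj : H2 R -> S := fun z => (\pi_(surface Gamma) z)%qT.
pose box (n : nat) (z : H2 R) := [/\ `|(coordH z).1| < n%:R, (coordH z).2 < n%:R &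
   n%:R^-1 < (coordH z).2].
pose P (n : nat) (x : S) := exists2 z, proj z = x & box n z.
have projE z w : proj z = proj w <-> exists2 k, lat Gamma k & w = mobius k z.
  rewrite /proj orbit_spaceP; split=> [[x xG ->]|[k kL ->]].
    by exists (repr x); rewrite // /lat psl_repr.
  by exists (psl k) => //; apply: mobius_psl; rewrite psl_repr.
have oP n : open (P n).
  rewrite /open /= /quotient_open openE => z [w /esym/projE[k kL ->]] [b1 b2 b3].
  have [c1 c2] := mobius_continuous k.
  have N1 := @cvgr_norm_lt _ _ _ _ (nbhs_filter z) _ _ (c1 z) _ b1.
  have N2 := @cvgr_lt _ _ _ (nbhs_filter z) _ _ (c2 z) _ b2.
  have N3 := @cvgr_gt _ _ _ (nbhs_filter z) _ _ (c2 z) _ b3.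
  apply: (@filterS _ _ (nbhs_filter z) _ _ _
    (@filterI _ _ (nbhs_filter z) _ _ (@filterI _ _ (nbhs_filter z) _ _ N1 N2) N3)).
  move=> y [[e1 e2] e3]; exists (mobius k y); last by [].
  by apply/esym/projE; exists k.
have mP m n x : (m <= n)%N -> (0 < m)%N -> P m x -> P n x.
  move=> mn m0 [z zx [b1 b2 b3]].
  have mnR : m%:R <= n%:R :> R by rewrite ler_nat.
  have m0R : 0 < m%:R :> R by rewrite ltr0n.
  exists z => //; split; [exact: lt_le_trans mnR|exact: lt_le_trans mnR|].
  apply: le_lt_trans b3; rewrite lef_pV2// posrE; exact: lt_le_trans mnR.
have [x _|n _ nP] := cpt nat \oo P _ _.
  have [z zx] : exists z, proj z = x by exists (repr x); exact: reprK.
  have z0 := H2_gt0 z.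
  pose M := `|(coordH z).1| + (coordH z).2 + (coordH z).2^-1.
  have Mi : 0 < (coordH z).2^-1 by rewrite invr_gt0.
  have M1 := normr_ge0 (coordH z).1.
  have [m mM] : exists m, M < m.+1%:R by exists (Num.trunc M); exact: truncnS_gt.
  have Pm : P m.+1 x.
    exists z => //; split; [rewrite /M in mM; lra|rewrite /M in mM; lra|].
    rewrite -[ltRHS]invrK ltf_pV2 ?posrE ?ltr0n//; rewrite /M in mM; lra.
  exists (P m.+1, [set n | (m.+1 <= n)%N]) => /=.
    split; last by exists m.+1.
    exact: (@open_nbhs_nbhs (quotient_topology (surface Gamma)) x (P m.+1) (conj (oP _) Pm)).
  by move=> [y n] /= [Py mn]; exact: mP mn _ Py.
(* Each of the four entries will be at most (n + 1)^2. *)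
exists (4 * (n%:R + 1) * (n%:R + 1)) => g.
have [w /esym/projE[k kL ->] [b1 b2 b3]] := nP n (leqnn n) (proj (mobius g (iH R))) I.
exists k => //; rewrite -mobiusM in b1 b2 b3; move: (k * g)%g b1 b2 b3 => h.
rewrite mobius_coord /mobius_den /=.
have := SL2_det h; rewrite /nrm !(mulr0, add0r, expr1n, mulr1).
move: (mxval h 0 0) (mxval h 0 1) (mxval h 1 0) (mxval h 1 1) => a b c d E.
have n0 : 0 <= n%:R :> R by exact: ler0n.
move: (n%:R : R) n0 => N; rewrite le_eqVlt => /orP[/eqP<- |N0 h1 h2 h3].
  by rewrite ltNge normr_ge0.
pose D := d ^+ 2 + c ^+ 2; rewrite -/D in h1 h2 h3.
have D0 : 0 < D by rewrite -invr_gt0 -[ltRHS]mul1r; apply: lt_trans h3; rewrite invr_gt0.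
have DN : D < N by move: h3; rewrite div1r ltf_pV2.
pose q := (b * d + a * c) / D; rewrite -/q in h1.
have qD : b * d + a * c = q * D by rewrite /q divfK// gt_eqF.
(* For z = h i this says |ai + b|^2 = |z|^2 |ci + d|^2, as z has real part [q] and height
   [1 / D]. *)
have ab : a ^+ 2 + b ^+ 2 = D * q ^+ 2 + 1 / D.
  apply: (mulIf (lt0r_neq0 D0)); rewrite [RHS]mulrDl divfK ?gt_eqF//.
  have -> : D * q ^+ 2 * D = (q * D) ^+ 2 by ring.
  have E2 : (a * d - b * c) ^+ 2 = 1 by rewrite E expr1n.
  by rewrite -qD -[in RHS]E2 /D; ring.
have q2 : q ^+ 2 <= N ^+ 2 by rewrite -real_normK ?num_real// lerXn2r// ?nnegrE ?ltW.
have qD2 : D * q ^+ 2 <= N * N ^+ 2 by rewrite ler_pM ?sqr_ge0 ?(ltW D0) ?(ltW DN).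
have a0 := sqr_ge0 a; have b0 := sqr_ge0 b; have c0 := sqr_ge0 c; have d0 := sqr_ge0 d.
have B x : x ^+ 2 <= N ^+ 3 + N -> `|x| <= (N + 1) * (N + 1).
  move=> xN; rewrite -(@ler_pXn2r _ 2)// ?nnegrE ?mulr_ge0 ?addr_ge0 ?(ltW N0)//.
  rewrite real_normK ?num_real//; apply: le_trans xN _.
  have -> : ((N + 1) * (N + 1)) ^+ 2 =
    (N ^+ 3 + N) + (N ^+ 4 + 3 * N ^+ 3 + 6 * N ^+ 2 + 3 * N + 1) by ring.
  by rewrite lerDl !addr_ge0 ?mulr_ge0 ?exprn_ge0 ?(ltW N0)// ler0n.
have N3 : 0 <= N ^+ 3 by rewrite exprn_ge0 ?ltW.
have NE : N * N ^+ 2 = N ^+ 3 by ring.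
have Ba : `|a| <= (N + 1) * (N + 1) by apply: B; lra.
have Bb : `|b| <= (N + 1) * (N + 1) by apply: B; lra.
have Bc : `|c| <= (N + 1) * (N + 1) by apply: B; rewrite /D in DN; lra.
have Bd : `|d| <= (N + 1) * (N + 1) by apply: B; rewrite /D in DN; lra.
lra.
Qed.

(** A lattice translate moves g into the ball of radius N, where conjugation enlarges [dev] by a
    factor of at most N^2. The isolation radius at 1, divided by N^2, therefore serves
    everywhere. *)
Lemma injectivity_radius : discrete_subgroup Gamma -> cocompact Gamma ->
  exists2 eta : R, 0 < eta & forall g k, lat Gamma k -> dev (g^-1 * k * g)%g < eta ->
    k = 1%g.
Proof.
move=> /discrete_dev[eta eta0 etaP] /cocompact_bounded[N NP].
have N1 : 0 < N ^+ 2.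
  have [k _] := NP 1%g; have := nrm_ge0 (mxval (k * 1)%g).
  rewrite le_eqVlt => /orP[/eqP/esym/nrm_eq0 E|k0 kN]; last first.
    by rewrite exprn_gt0// (lt_le_trans k0).
  by have := SL2_det (k * 1)%g; rewrite E !mxE mul0r subrr => /eqP; rewrite eq_sym oner_eq0.
exists (eta / N ^+ 2); first by rewrite divr_gt0.
move=> g k kL dk; have [m mL mN] := NP g; set h := (m * g)%g in mN.
have E : (m * k * m^-1 = h * (g^-1 * k * g) * h^-1)%g.
  by rewrite /h invgM !mulgA !mulgK.
have : (m * k * m^-1 = 1)%g.
  apply: etaP; first by apply: latM (latV mL); exact: latM.
  rewrite E; apply: le_lt_trans (dev_conj _ _) _.
  rewrite (le_lt_trans (y := N ^+ 2 * dev (g^-1 * k * g)%g))//.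
    by rewrite ler_wpM2r ?dev_ge0// lerXn2r// ?nnegrE ?nrm_ge0// (le_trans (nrm_ge0 _) mN).
  by rewrite mulrC -ltr_pdivlMr.
by move=> /(congr1 (fun x => m^-1 * x * m)%g); rewrite mulg1 mulVg !mulgA mulVg mul1g mulgVK.
Qed.

End LatticeHypotheses.

(** * Lower bounds for the Sasaki distance *)

Section Displacement.
Variable R : realType.
Notation mu := (@lebesgue_measure R).

Lemma continuous_integrable_segment (f : R -> R) (a b : R) : continuous f ->
  mu.-integrable `[a, b] (EFin \o f).
Proof.
move=> cf; apply: continuous_compact_integrable; first exact: segment_compact.
exact: continuous_subspaceT.
Qed.

Lemma displacement_le_integral (f s : R -> R) (M t : R) : C1 f -> continuous s ->
  (forall u, 0 <= s u) -> 0 <= M -> (forall u, 0 <= u <= 1 -> `|derive1 f u| <= M * s u) ->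
  0 <= t <= 1 -> `|f t - f 0| <= M * \int[mu]_(u in `[0, 1]) s u.
Proof.
move=> [df cf'] cs s0 M0 fs /andP[]; rewrite le_eqVlt => /orP[/eqP <- _|t0 t1].
  by rewrite subrr normr0 mulr_ge0// Rintegral_ge0.
have cf : continuous f by move=> u; exact/differentiable_continuous/derivable1_diffP.
have cMs : continuous (fun u => M * s u).
  by move=> u; apply: cvgM; [exact: cvg_cst|exact: cs].
have E : \int[mu]_(u in `[0, t]) (derive1 f u) = f t - f 0.
  rewrite /Rintegral (@continuous_FTC2 _ _ f)//.
  - exact: continuous_subspaceT.
  - split => [u _| |]; first exact: df.
    + by apply: cvg_at_right_filter; exact: cf.
    + by apply: cvg_at_left_filter; exact: cf.
rewrite -E; apply: le_trans (le_normr_Rintegral _ (continuous_integrable_segment _ _ cf')) _ => //.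
have cn : continuous (fun u => `|derive1 f u|).
  by move=> u; apply: cvg_norm; exact: cf'.
apply: (@le_trans _ _ (\int[mu]_(u in `[0, t]) (M * s u))).
  apply: le_Rintegral => //; try exact: continuous_integrable_segment.
  move=> u; rewrite /= in_itv /= => /andP[u0 ut]; apply: fs.
  by rewrite u0 (le_trans ut).
rewrite RintegralZl//; last exact: continuous_integrable_segment.
apply: ler_wpM2l => //; rewrite /Rintegral; apply: fine_le.
- exact: integrable_fin_num (continuous_integrable_segment _ _ cs).
- exact: integrable_fin_num (continuous_integrable_segment _ _ cs).
apply: ge0_subset_integral => //=.
- by have /integrableP[] := continuous_integrable_segment 0 1 cs.
- by move=> u _; rewrite lee_fin.
- by apply: subset_itvl; rewrite bnd_simp.
Qed.

Lemma Rintegral01_le (s : R -> R) (M : R) : continuous s ->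
  (forall u, 0 <= u <= 1 -> s u <= M) -> \int[mu]_(u in `[0, 1]) s u <= M.
Proof.
move=> cs sM; apply: (@le_trans _ _ (\int[mu]_(u in `[0, 1]) M)).
  apply: le_Rintegral => //; try exact: continuous_integrable_segment.
    by apply: continuous_integrable_segment => u; exact: cvg_cst.
by rewrite Rintegral_cst//= lebesgue_measure_itv/= lte01 EFinN sube0 mulr1.
Qed.

End Displacement.

Section RealContinuity.
Variable R : realType.
Implicit Types f g : R -> R.

Lemma contD f g : continuous f -> continuous g -> continuous (fun x => f x + g x).
Proof. by move=> cf cg x; apply: cvgD; [exact: cf|exact: cg]. Qed.
Lemma contB f g : continuous f -> continuous g -> continuous (fun x => f x - g x).
Proof. by move=> cf cg x; apply: cvgB; [exact: cf|exact: cg]. Qed.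
Lemma contM f g : continuous f -> continuous g -> continuous (fun x => f x * g x).
Proof. by move=> cf cg x; apply: cvgM; [exact: cf|exact: cg]. Qed.
Lemma contX f n : continuous f -> continuous (fun x => f x ^+ n).
Proof.
move=> cf; elim: n => [|n IH]; first by move=> x; exact: cvg_cst.
by under eq_fun do rewrite exprS; exact: contM.
Qed.
Lemma cont_div f g : continuous f -> continuous g -> (forall x, g x != 0) ->
  continuous (fun x => f x / g x).
Proof. by move=> cf cg g0 x; apply: cvgM; [exact: cf|apply: cvgV => //; exact: cg]. Qed.

Lemma C1_is_derive f (t : R) : C1 f -> is_derive t 1 f (derive1 f t).
Proof. by move=> [df _]; rewrite derive1E; exact: derivableP. Qed.

Lemma C1_continuous f : C1 f -> continuous f.
Proof. by move=> [df _] u; exact/differentiable_continuous/derivable1_diffP. Qed.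

Lemma derive1_is_derive f (f' : R -> R) :
  (forall t : R, is_derive t 1 f (f' t)) -> derive1 f = f'.
Proof.
by move=> df; apply/funext => t; rewrite derive1E; have := df t => d; exact: derive_val.
Qed.

Lemma C1I f (f' : R -> R) : (forall t : R, is_derive t 1 f (f' t)) -> continuous f' -> C1 f.
Proof.
move=> df cf'; split; last by rewrite (derive1_is_derive df).
by move=> t; have := df t => d; exact: ex_derive.
Qed.

Lemma is_derive_div f g (t a b : R) : g t != 0 -> is_derive t 1 f a ->
  is_derive t 1 g b -> is_derive t 1 (fun x => f x / g x) (a / g t - f t * b / g t ^+ 2).
Proof.
move=> g0 df dg; have dV := is_deriveV g0 dg.
apply: is_derive_eq; rewrite /GRing.scale /=.
by field.
Qed.

End RealContinuity.

Section SasakiLowerBound.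
Variables (R : realType) (c : R -> T1H2 R).
Hypothesis Cc : C1_curve c.

Let x t := (coordH (base (c t))).1.
Let y t := (coordH (base (c t))).2.
Let v1 t := (dir (c t)).1.
Let v2 t := (dir (c t)).2.

Let y0 t : 0 < y t. Proof. exact: H2_gt0. Qed.
Let yn t : y t != 0. Proof. by rewrite gt_eqF. Qed.

Let Cx : C1 x. Proof. by case: Cc. Qed.
Let Cy : C1 y. Proof. by case: Cc. Qed.
Let Cv1 : C1 v1. Proof. by case: Cc. Qed.
Let Cv2 : C1 v2. Proof. by case: Cc. Qed.

Let p t := derive1 v1 t - (derive1 x t * v2 t + derive1 y t * v1 t) / y t.
Let q t := derive1 v2 t + (derive1 x t * v1 t - derive1 y t * v2 t) / y t.

Lemma sasaki_speedE t : sasaki_speed c t = Num.sqrt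
  ((derive1 x t ^+ 2 + derive1 y t ^+ 2 + p t ^+ 2 + q t ^+ 2) / y t ^+ 2).
Proof.
rewrite /sasaki_speed /hnorm2 -mulrDl; congr (Num.sqrt (_ / _)).
by rewrite !addrA.
Qed.

Lemma sasaki_speed_ge0 t : 0 <= sasaki_speed c t.
Proof. exact: sqrtr_ge0. Qed.

Lemma sasaki_speed_continuous : continuous (sasaki_speed c).
Proof.
have [[cx' cy'] [cv1' cv2']] := ((Cx.2, Cy.2), (Cv1.2, Cv2.2)).
have [[cx cy] [cv1 cv2]] := ((C1_continuous Cx, C1_continuous Cy),
  (C1_continuous Cv1, C1_continuous Cv2)).
have -> : sasaki_speed c = fun t => Num.sqrt
  ((derive1 x t ^+ 2 + derive1 y t ^+ 2 + p t ^+ 2 + q t ^+ 2) / y t ^+ 2).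
  by apply/funext => t; exact: sasaki_speedE.
move=> t; apply: continuous_comp; last exact: sqrt_continuous.
move: t; apply: cont_div; [|exact: contX|by move=> t; rewrite expf_neq0].
have cp : continuous p.
  by apply: contB => //; apply: cont_div => //; apply: contD; exact: contM.
have cq : continuous q.
  by apply: contD => //; apply: cont_div => //; apply: contB; exact: contM.
by repeat (apply: contD); exact: contX.
Qed.

Let sqr_le_speed (a b : R) t : 0 <= b ->
  b + a ^+ 2 = derive1 x t ^+ 2 + derive1 y t ^+ 2 + p t ^+ 2 + q t ^+ 2 ->
  `|a| / y t <= sasaki_speed c t.
Proof.
move=> b0 E; rewrite sasaki_speedE -E.
rewrite -[leLHS]ger0_norm ?divr_ge0 ?(ltW (y0 _))// -sqrtr_sqr; apply: ler_wsqrtr.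
rewrite exprMn exprVn real_normK ?num_real// ler_wpM2r ?invr_ge0 ?sqr_ge0//.
by rewrite lerDr.
Qed.

Let x_le t : `|derive1 x t| / y t <= sasaki_speed c t.
Proof.
apply: (@sqr_le_speed _ (derive1 y t ^+ 2 + p t ^+ 2 + q t ^+ 2)); last by ring.
by rewrite !addr_ge0 ?sqr_ge0.
Qed.
Let y_le t : `|derive1 y t| / y t <= sasaki_speed c t.
Proof.
apply: (@sqr_le_speed _ (derive1 x t ^+ 2 + p t ^+ 2 + q t ^+ 2)); last by ring.
by rewrite !addr_ge0 ?sqr_ge0.
Qed.
Let p_le t : `|p t| / y t <= sasaki_speed c t.
Proof.
apply: (@sqr_le_speed _ (derive1 x t ^+ 2 + derive1 y t ^+ 2 + q t ^+ 2)); last by ring.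
by rewrite !addr_ge0 ?sqr_ge0.
Qed.
Let q_le t : `|q t| / y t <= sasaki_speed c t.
Proof.
apply: (@sqr_le_speed _ (derive1 x t ^+ 2 + derive1 y t ^+ 2 + p t ^+ 2)); last by ring.
by rewrite !addr_ge0 ?sqr_ge0.
Qed.

Let v_unit t : v1 t ^+ 2 + v2 t ^+ 2 = y t ^+ 2.
Proof. exact: (sqabs_dir (c t)). Qed.

Let l := sasaki_length c.

Lemma sasaki_length_ge0 : 0 <= l.
Proof. by apply: Rintegral_ge0 => t _; exact: sasaki_speed_ge0. Qed.

Let disp (f f' : R -> R) (M t : R) : (forall t : R, is_derive t 1 f (f' t)) -> continuous f' ->
  0 <= M -> (forall u : R, 0 <= u <= 1 -> `|f' u| <= M * sasaki_speed c u) ->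
  0 <= t <= 1 -> `|f t - f 0| <= M * l.
Proof.
move=> df cf' M0 H t01; apply: displacement_le_integral => //.
- exact: C1I df cf'.
- exact: sasaki_speed_continuous.
- exact: sasaki_speed_ge0.
- by rewrite (derive1_is_derive df).
Qed.

(** The derivative of ln y is y'/y, which the speed dominates. Intermediate times t are needed to
    control the height all along the curve in [horizontal_displacement]. *)
Lemma ln_height_displacement (t : R) : 0 <= t <= 1 -> `|ln (y t) - ln (y 0)| <= l.
Proof.
move=> t01; rewrite -[l]mul1r.
have dl (u : R) : is_derive u 1 (@ln R \o y) (derive1 y u / y u).
  have d1 := is_derive1_ln (y0 u); have d2 := C1_is_derive u Cy.
  apply: is_derive_eq; rewrite mulrC //.
apply: (disp dl) => //.
  by apply: cont_div => //; [case: Cy|exact: C1_continuous].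
move=> u _; rewrite mul1r normrM normfV (gtr0_norm (y0 u)); exact: y_le.
Qed.

(** v / y is a Euclidean unit vector. Its derivative is the covariant derivative over y, plus or
    minus the connection term x'/y times its other coordinate; each part is at most the speed, hence
    the factor 2. *)
Lemma dir_displacement :
  `|v1 1 / y 1 - v1 0 / y 0| <= 2 * l /\ `|v2 1 / y 1 - v2 0 / y 0| <= 2 * l.
Proof.
have t01 : 0 <= (1 : R) <= 1 by rewrite ler01 lexx.
have [cx' cy'] := (Cx.2, Cy.2); have [cv1' cv2'] := (Cv1.2, Cv2.2).
have [cx cy] := (C1_continuous Cx, C1_continuous Cy).
have [cv1 cv2] := (C1_continuous Cv1, C1_continuous Cv2).
have vy u : `|v1 u / y u| <= 1 /\ `|v2 u / y u| <= 1.
  have vu := v_unit u.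
  by split; rewrite normrM normfV (gtr0_norm (y0 u)) ler_pdivrMr// mul1r
    -(@ler_pXn2r _ 2)// ?nnegrE ?(ltW (y0 _))// real_normK ?num_real// -vu
    ?lerDl ?lerDr sqr_ge0.
split.
- apply: (@disp (fun u => v1 u / y u)
    (fun u => derive1 v1 u / y u - v1 u * derive1 y u / y u ^+ 2)) => //.
  + by move=> u; apply: is_derive_div => //; exact: C1_is_derive.
  + apply: contB; apply: cont_div => //; first exact: contM.
      exact: contX.
    by move=> u; rewrite expf_neq0.
  + move=> u _.
    have -> : derive1 v1 u / y u - v1 u * derive1 y u / y u ^+ 2 =
      p u / y u + (derive1 x u / y u) * (v2 u / y u) by rewrite /p; field; exact: yn.
    apply: le_trans (ler_normD _ _) _; rewrite mulr_natl mulr2n lerD//.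
      by rewrite normrM normfV (gtr0_norm (y0 u)) p_le.
    rewrite normrM -[leRHS]mulr1 ler_pM ?(vy u).2//.
    by rewrite normrM normfV (gtr0_norm (y0 u)) x_le.
- apply: (@disp (fun u => v2 u / y u)
    (fun u => derive1 v2 u / y u - v2 u * derive1 y u / y u ^+ 2)) => //.
  + by move=> u; apply: is_derive_div => //; exact: C1_is_derive.
  + apply: contB; apply: cont_div => //; first exact: contM.
      exact: contX.
    by move=> u; rewrite expf_neq0.
  + move=> u _.
    have -> : derive1 v2 u / y u - v2 u * derive1 y u / y u ^+ 2 =
      q u / y u - (derive1 x u / y u) * (v1 u / y u) by rewrite /q; field; exact: yn.
    apply: le_trans (ler_normB _ _) _; rewrite mulr_natl mulr2n lerD//.
      by rewrite normrM normfV (gtr0_norm (y0 u)) q_le.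
    rewrite normrM -[leRHS]mulr1 ler_pM ?(vy u).1//.
    by rewrite normrM normfV (gtr0_norm (y0 u)) x_le.
Qed.

Lemma horizontal_displacement : `|x 1 - x 0| <= expR l * y 0 * l.
Proof.
have t01 : 0 <= (1 : R) <= 1 by rewrite ler01 lexx.
apply: (@disp x (derive1 x)) => //.
- by move=> u; exact: C1_is_derive.
- by case: Cx.
- by rewrite mulr_ge0 ?expR_ge0 ?(ltW (y0 _)).
move=> u u01; have := x_le u; rewrite ler_pdivrMr// => /le_trans; apply.
rewrite mulrC ler_wpM2r ?sasaki_speed_ge0// -ler_ln ?posrE ?mulr_gt0 ?expR_gt0//.
rewrite lnM ?posrE ?expR_gt0// expRK -lerBlDr.
by apply: le_trans (ler_norm _) (ln_height_displacement u01).
Qed.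

End SasakiLowerBound.

Section FrameDisplacement.
Variable R : realType.
Implicit Types (g h k : SL2 R).

Lemma expR_sub1_le (t : R) : `|t| <= 1 / 2 -> `|expR t - 1| <= 2 * `|t|.
Proof.
move=> t2.
have H := expR_ge1Dx t; have H' := expR_ge1Dx (- t).
have t0 := normr_ge0 t; have t1 := ler_norm t; have t1' := ler_norm (- t).
rewrite normrN in t1'.
have E0 : 0 < expR t := expR_gt0 t.
have EE : expR t * expR (- t) = 1 by rewrite -expRD subrr expR0.
have : expR t * (1 - t) <= 1 by rewrite -[leRHS]EE ler_pM2l.
rewrite ler_norml => H1; apply/andP; split; first by lra.
case: (leP 0 t) => ht; last first.
  have : expR t <= 1 by nra.
  lra.
rewrite ger0_norm// in t2 *; nra.
Qed.

(* The four entries are those of g0^-1 g1 for two frames in Iwasawa coordinates: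
   r = s^-1 is the square root of the ratio of heights, z the normalised
   horizontal shift, and (C, D) the half-angle unit vectors, so that
   (2CD, D^2 - C^2) are the directions. *)
Lemma near_rotation (C0 D0 C1 D1 z r s l : R) : C0 ^+ 2 + D0 ^+ 2 = 1 ->
  C1 ^+ 2 + D1 ^+ 2 = 1 -> l <= 1 / 2 -> `|z| <= 3 * l -> `|r - 1| <= l ->
  `|s - 1| <= l -> `|2 * C1 * D1 - 2 * C0 * D0| <= 2 * l ->
  `|(D1 ^+ 2 - C1 ^+ 2) - (D0 ^+ 2 - C0 ^+ 2)| <= 2 * l ->
  0 <= D0 * D1 + C0 * C1 ->
  `|D0 * C1 * z + r * D0 * D1 + s * C0 * C1 - 1| +
  `|D0 * D1 * z - r * D0 * C1 + s * C0 * D1| +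
  `|- C0 * C1 * z - r * C0 * D1 + s * D0 * C1| +
  `|- C0 * D1 * z + r * C0 * C1 + s * D0 * D1 - 1| <= 28 * l.
Proof.
move=> u0 u1 l2 zl rl sl w1 w2 cp.
have l0 : 0 <= l by apply: le_trans rl.
have unit_le (a b : R) : a ^+ 2 + b ^+ 2 = 1 -> `|a| <= 1 /\ `|b| <= 1.
  move=> ab; split; rewrite -(@ler_pXn2r _ 2)// ?nnegrE// real_normK ?num_real//
    expr1n -ab; [rewrite lerDl|rewrite lerDr]; exact: sqr_ge0.
have [C0n D0n] := unit_le _ _ u0; have [C1n D1n] := unit_le _ _ u1.
(* Sine and cosine of the difference of the half-angles. The chord between the two directions has
   length 2|e|, but the directions do not see the sign of [c], which comes from the last
   hypothesis. *)
pose e := D0 * C1 - C0 * D1; pose c := D0 * D1 + C0 * C1.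
have ce : c ^+ 2 + e ^+ 2 = 1.
  have -> : c ^+ 2 + e ^+ 2 = (C0 ^+ 2 + D0 ^+ 2) * (C1 ^+ 2 + D1 ^+ 2).
    by rewrite /c /e; ring.
  by rewrite u0 u1 mulr1.
have e4 : 4 * e ^+ 2 = (2 * C1 * D1 - 2 * C0 * D0) ^+ 2 +
   ((D1 ^+ 2 - C1 ^+ 2) - (D0 ^+ 2 - C0 ^+ 2)) ^+ 2.
  have : (2 * C1 * D1 - 2 * C0 * D0) ^+ 2 +
   ((D1 ^+ 2 - C1 ^+ 2) - (D0 ^+ 2 - C0 ^+ 2)) ^+ 2 =
   (C1 ^+ 2 + D1 ^+ 2) ^+ 2 + (C0 ^+ 2 + D0 ^+ 2) ^+ 2 - 2 * c ^+ 2 + 2 * e ^+ 2.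
    by rewrite /c /e; ring.
  move=> ->; rewrite u0 u1; lra.
have sq (a b : R) : `|a| <= b -> a ^+ 2 <= b ^+ 2.
  move=> ab; rewrite -real_normK ?num_real// lerXn2r// nnegrE//.
  exact: le_trans ab.
have e2 : e ^+ 2 <= 2 * l ^+ 2 by have := sq _ _ w1; have := sq _ _ w2; lra.
have el : `|e| <= 2 * l.
  rewrite -(@ler_pXn2r _ 2)// ?nnegrE ?mulr_ge0// real_normK ?num_real//.
  by have := sqr_ge0 l; lra.
have cl : `|c - 1| <= l.
  have [c1 _] := unit_le _ _ ce; rewrite ler_norml in c1.
  have ll : l ^+ 2 <= l * (1 / 2) by rewrite expr2 ler_wpM2l.
  rewrite ler_norml; apply/andP; split; last by lra.
  rewrite -/c in cp; nra.
have P (a b : R) : `|a| <= 1 -> `|b| <= 1 -> `|a * b| <= 1.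
  by move=> ? ?; rewrite normrM -[1]mulr1 ler_pM.
have Q (a b m : R) : `|a| <= 1 -> `|b| <= m -> `|a * b| <= m.
  by move=> ? ?; rewrite normrM -[leRHS]mul1r ler_pM.
have T (w x y : R) (m n o : R) : `|w| <= m -> `|x| <= n -> `|y| <= o ->
    `|w + x + y| <= m + n + o.
  move=> wm xn yo; apply: le_trans (ler_normD _ _) _; apply: lerD => //.
  by apply: le_trans (ler_normD _ _) _; exact: lerD.
(* Each entry is expanded around z = 0, r = s = 1, e = 0, c = 1. The four bounds add up to 26 l. *)
have K00 : `|D0 * C1 * z + r * D0 * D1 + s * C0 * C1 - 1| <= 3 * l + l + (l + l).
  rewrite (_ : _ - 1 = D0 * C1 * z + (D0 * D1) * (r - 1) +
    ((C0 * C1) * (s - 1) + (c - 1))); last by rewrite /c; ring.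
  apply: T; [by apply: Q (P _ _ _ _) _|by apply: Q (P _ _ _ _) _|].
  by apply: le_trans (ler_normD _ _) _; apply: lerD => //; apply: Q (P _ _ _ _) _.
have K01 : `|D0 * D1 * z - r * D0 * C1 + s * C0 * D1| <= 3 * l + l + (l + 2 * l).
  rewrite (_ : _ + _ = D0 * D1 * z + (- D0 * C1) * (r - 1) +
    ((C0 * D1) * (s - 1) + (- e))); last by rewrite /e; ring.
  apply: T; [by apply: Q (P _ _ _ _) _|by apply: Q (P _ _ _ _) _; rewrite ?normrN|].
  apply: le_trans (ler_normD _ _) _; apply: lerD; last by rewrite normrN.
  by apply: Q (P _ _ _ _) _.
have K10 : `|- C0 * C1 * z - r * C0 * D1 + s * D0 * C1| <= 3 * l + l + (l + 2 * l).
  rewrite (_ : _ + _ = - C0 * C1 * z + (- C0 * D1) * (r - 1) +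
    ((D0 * C1) * (s - 1) + e)); last by rewrite /e; ring.
  apply: T; [by apply: Q (P _ _ _ _) _; rewrite ?normrN|
    by apply: Q (P _ _ _ _) _; rewrite ?normrN|].
  apply: le_trans (ler_normD _ _) _; apply: lerD => //.
  by apply: Q (P _ _ _ _) _.
have K11 : `|- C0 * D1 * z + r * C0 * C1 + s * D0 * D1 - 1| <= 3 * l + l + (l + l).
  rewrite (_ : _ - 1 = - C0 * D1 * z + (C0 * C1) * (r - 1) +
    ((D0 * D1) * (s - 1) + (c - 1))); last by rewrite /c; ring.
  apply: T; [by apply: Q (P _ _ _ _) _; rewrite ?normrN|by apply: Q (P _ _ _ _) _|].
  by apply: le_trans (ler_normD _ _) _; apply: lerD => //; apply: Q (P _ _ _ _) _.
lra.
Qed.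

(** This is |ci + d|^2, the inverse of the height of g i. *)
Definition sqden g : R := mxval g 1 0 ^+ 2 + mxval g 1 1 ^+ 2.

Lemma sqden_gt0 g : 0 < sqden g.
Proof.
have := mobius_den_gt0 g (iH R); rewrite /mobius_den /= mulr0 add0r expr1n mulr1.
by rewrite addrC.
Qed.

Lemma base_frame g : coordH (base (frame_to_T1 (psl g))) =
  ((mxval g 0 0 * mxval g 1 0 + mxval g 0 1 * mxval g 1 1) / sqden g, (sqden g)^-1).
Proof.
have -> : base (frame_to_T1 (psl g)) = mobius g (iH R).
  by apply: mobius_psl; rewrite psl_repr.
rewrite mobius_coord /mobius_den /sqden /= !(mulr0, add0r, expr1n, mulr1, div1r).
by rewrite [X in X / _]addrC [in X in X^-1]addrC [X in _ / X]addrC.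
Qed.

Lemma dir_frame g : dir (frame_to_T1 (psl g)) =
  (2 * mxval g 1 0 * mxval g 1 1 / sqden g ^+ 2,
   (mxval g 1 1 ^+ 2 - mxval g 1 0 ^+ 2) / sqden g ^+ 2).
Proof.
apply: (can_inj (@toCK R)); rewrite dir_frame_to_T1 /toC /=.
have := sqden_gt0 g; rewrite /sqden => /gt_eqF/negbT n0.
have eqC (w : R[i]) : w = (complex.Re w +i* complex.Im w)%C by case: w.
apply/(mulIf (x := (mxval g 1 1 +i* mxval g 1 0)%C ^+ 2)).
  rewrite sqrf_eq0 -sqabs_eq0 /sqabs /=; by rewrite addrC.
rewrite divfK; last first.
  by rewrite sqrf_eq0 -sqabs_eq0 /sqabs /=; rewrite addrC.
by rewrite expr2; apply/eqP; rewrite eq_complex /=; apply/andP; split; apply/eqP; field.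
Qed.

Lemma exists_opp g : exists2 h, psl h = psl g & mxval h = - mxval g.
Proof.
have D : \det (- mxval g) = 1 by rewrite -scaleN1r detZ det_SL2 sqrrN expr1n mul1r.
exists (toSL2 D) => //; apply/psl_eqP; by right.
Qed.

(** The relation ai + b = z (ci + d), with z = x + i / sqden g, recovers the top row from the bottom
    row and the base point. *)
Lemma frame_entries g (x : R) : (coordH (base (frame_to_T1 (psl g)))).1 = x ->
  mxval g 0 0 = x * mxval g 1 0 + mxval g 1 1 / sqden g /\
  mxval g 0 1 = x * mxval g 1 1 - mxval g 1 0 / sqden g.
Proof.
move=> <-.
rewrite base_frame /= ; have := SL2_det g; have := sqden_gt0 g; rewrite /sqden.
move: (mxval g 0 0) (mxval g 0 1) (mxval g 1 0) (mxval g 1 1) => a b c d /gt_eqF/negbT n0 E.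
by split; [rewrite -[X in _ + X / _]mulr1|rewrite -[X in _ - X / _]mulr1];
  rewrite -E; field.
Qed.

Lemma frame_displacement (c : R -> T1H2 R) g0 g1 : C1_curve c ->
  c 0 = frame_to_T1 (psl g0) -> c 1 = frame_to_T1 (psl g1) ->
  sasaki_length c <= 1 / 2 ->
  exists2 k, psl (g0 * k)%g = psl g1 & dev k <= 28 * sasaki_length c.
Proof.
move=> Cc c0 c1; have l0 := sasaki_length_ge0 c.
have t01 : 0 <= (1 : R) <= 1 by rewrite ler01 lexx.
have := ln_height_displacement Cc t01; have := horizontal_displacement Cc.
have [] := dir_displacement Cc; move: (sasaki_length c) l0 => l l0.
rewrite c0 c1 => w1 w2 dx dy l2.
(* Replacing g1 by -g1 leaves [psl g1] unchanged and reverses this sign. *)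
wlog cp : g1 c1 w1 w2 dx dy / 0 <= mxval g0 1 1 * mxval g1 1 1 + mxval g0 1 0 * mxval g1 1 0.
  move=> H.
  have [/H|/ltW n] := leP 0 (mxval g0 1 1 * mxval g1 1 1 + mxval g0 1 0 * mxval g1 1 0).
    exact.
  have [h hE hN] := exists_opp g1; rewrite -hE; apply: H; rewrite ?hE// hN !mxE.
  by rewrite !mulrN -opprD oppr_ge0.
exists (g0^-1 * g1)%g; first by rewrite mulVKg.
pose S0 := Num.sqrt (sqden g0); pose S1 := Num.sqrt (sqden g1).
have S0p : 0 < S0 by rewrite sqrtr_gt0 sqden_gt0.
have S1p : 0 < S1 by rewrite sqrtr_gt0 sqden_gt0.
have S0n : S0 != 0 by rewrite gt_eqF.
have S1n : S1 != 0 by rewrite gt_eqF.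
have S0E : S0 ^+ 2 = sqden g0 by rewrite sqr_sqrtr ?ltW ?sqden_gt0.
have S1E : S1 ^+ 2 = sqden g1 by rewrite sqr_sqrtr ?ltW ?sqden_gt0.
have [a0 b0] := frame_entries (erefl (coordH (base (frame_to_T1 (psl g0)))).1).
have [a1 b1] := frame_entries (erefl (coordH (base (frame_to_T1 (psl g1)))).1).
have dir1 g : (dir (frame_to_T1 (psl g))).1 = 2 * mxval g 1 0 * mxval g 1 1 / sqden g ^+ 2.
  by rewrite dir_frame.
have dir2 g : (dir (frame_to_T1 (psl g))).2 =
    (mxval g 1 1 ^+ 2 - mxval g 1 0 ^+ 2) / sqden g ^+ 2.
  by rewrite dir_frame.
move: w1 w2 dx dy a0 b0 a1 b1; rewrite !dir1 !dir2.
have y0 : (coordH (base (frame_to_T1 (psl g0)))).2 = (sqden g0)^-1 by rewrite base_frame.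
have y1 : (coordH (base (frame_to_T1 (psl g1)))).2 = (sqden g1)^-1 by rewrite base_frame.
rewrite y0 y1 -S0E -S1E.
move: (coordH (base (frame_to_T1 (psl g0)))).1 (coordH (base (frame_to_T1 (psl g1)))).1.
move=> x0 x1 w1 w2 dx dy a0 b0 a1 b1.
pose r := S0 / S1; pose s := S1 / S0; pose z := S0 * S1 * (x1 - x0).
rewrite /sqden in S0E S1E.
rewrite devE !SL2_mulE !SL2_invE a0 b0 a1 b1.
move: (mxval g0 1 0) (mxval g0 1 1) (mxval g1 1 0) (mxval g1 1 1) cp S0E S1E w1 w2.
move=> C0 D0 C1 D1 cp S0E S1E w1 w2.
(* Half the logarithm of the ratio of heights: hence the bound l / 2 here, and l for |r - 1| and |s
   - 1| after [expR_sub1_le]. *)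
pose t := ln S0 - ln S1.
have tl : `|t| <= l / 2.
  move: dy; rewrite !lnV ?posrE ?exprn_gt0// !lnXn//.
  rewrite (_ : - _ - _ = 2 * t); last by rewrite /t; ring.
  rewrite normrM ger0_norm//; lra.
have rE : r = expR t by rewrite /t expRD expRN !lnK ?posrE.
have sE : s = expR (- t) by rewrite /t opprB expRD expRN !lnK ?posrE.
have t2 : `|t| <= 1 / 2 by lra.
have rl : `|r - 1| <= l by rewrite rE; apply: le_trans (expR_sub1_le t2) _; lra.
have sl : `|s - 1| <= l.
  by rewrite sE; apply: le_trans (expR_sub1_le _) _; rewrite normrN //; lra.
have zl : `|z| <= 3 * l.
  rewrite /z normrM gtr0_norm ?mulr_gt0//.
  (* Since l <= 1/2, exp l <= 2 and s <= 3/2, whence the constant 3. *)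
  apply: (@le_trans _ _ (expR l * s * l)).
    rewrite (_ : expR l * s * l = S0 * S1 * (expR l * (S0 ^+ 2)^-1 * l)).
      by rewrite ler_pM2l ?mulr_gt0.
    by rewrite /s; field.
  have l2' : `|l| <= 1 / 2 by rewrite ger0_norm.
  have := expR_sub1_le l2'; rewrite [`|l|]ger0_norm// ler_norml => /andP[_ el].
  move: sl; rewrite ler_norml => /andP[_ sl].
  rewrite ler_wpM2r//; have s0 : 0 < s by rewrite divr_gt0.
  have e0 := expR_gt0 l.
  have : expR l * s <= 2 * (3 / 2) by apply: ler_pM; rewrite ?(ltW e0) ?(ltW s0)//; lra.
  lra.
have := @near_rotation (C0 / S0) (D0 / S0) (C1 / S1) (D1 / S1) z r s l _ _ l2 zl rl sl _ _ _.
rewrite (_ : D0 / S0 * (C1 / S1) * z + r * (D0 / S0) * (D1 / S1) + s * (C0 / S0) * (C1 / S1) =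
  D0 * (x1 * C1 + D1 / S1 ^+ 2) + - (x0 * D0 - C0 / S0 ^+ 2) * C1); last first.
  by rewrite /z /r /s; field; rewrite ?S0n ?S1n.
rewrite (_ : D0 / S0 * (D1 / S1) * z - r * (D0 / S0) * (C1 / S1) + s * (C0 / S0) * (D1 / S1) =
  D0 * (x1 * D1 - C1 / S1 ^+ 2) + - (x0 * D0 - C0 / S0 ^+ 2) * D1); last first.
  by rewrite /z /r /s; field; rewrite ?S0n ?S1n.
rewrite (_ : - (C0 / S0) * (C1 / S1) * z - r * (C0 / S0) * (D1 / S1) + s * (D0 / S0) * (C1 / S1) =
  - C0 * (x1 * C1 + D1 / S1 ^+ 2) + (x0 * C0 + D0 / S0 ^+ 2) * C1); last first.
  by rewrite /z /r /s; field; rewrite ?S0n ?S1n.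
rewrite (_ : - (C0 / S0) * (D1 / S1) * z + r * (C0 / S0) * (C1 / S1) + s * (D0 / S0) * (D1 / S1) =
  - C0 * (x1 * D1 - C1 / S1 ^+ 2) + (x0 * C0 + D0 / S0 ^+ 2) * D1); last first.
  by rewrite /z /r /s; field; rewrite ?S0n ?S1n.
apply.
- by rewrite !exprMn !exprVn -mulrDl -S0E mulfV// expf_neq0.
- by rewrite !exprMn !exprVn -mulrDl -S1E mulfV// expf_neq0.
- rewrite (_ : _ - _ = 2 * C1 * D1 / (S1 ^+ 2) ^+ 2 / (S1 ^+ 2)^-1 -
    2 * C0 * D0 / (S0 ^+ 2) ^+ 2 / (S0 ^+ 2)^-1) //.
  by field; rewrite ?S0n ?S1n.
- rewrite (_ : _ - _ = (D1 ^+ 2 - C1 ^+ 2) / (S1 ^+ 2) ^+ 2 / (S1 ^+ 2)^-1 -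
    (D0 ^+ 2 - C0 ^+ 2) / (S0 ^+ 2) ^+ 2 / (S0 ^+ 2)^-1) //.
  by field; rewrite ?S0n ?S1n.
- rewrite (_ : _ + _ = (D0 * D1 + C0 * C1) / (S0 * S1)).
    by rewrite divr_ge0 ?mulr_ge0 ?(ltW S0p) ?(ltW S1p).
  by field; rewrite ?S0n ?S1n.
Qed.

End FrameDisplacement.

(** * Upper bounds for the Sasaki distance *)

Section ExplicitCurves.
Variable R : realType.
Implicit Types (g h k : SL2 R).

Fact mkT1_subproof (x y w1 w2 : R) (y0 : 0 < y) (w : w1 ^+ 2 + w2 ^+ 2 = 1) :
  hnorm2 (@toH2 R (x, y) y0) (y * w1, y * w2) = 1.
Proof. by rewrite /hnorm2 /= !exprMn -mulrDr w mulr1 mulfV// expf_neq0// gt_eqF. Qed.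

Definition mkT1 (x y w1 w2 : R) (y0 : 0 < y) (w : w1 ^+ 2 + w2 ^+ 2 = 1) : T1H2 R :=
  toT1H2 (mkT1_subproof x y0 w).

Variables (x0 y0 w1 w2 X L T : R).
Hypotheses (y0_gt0 : 0 < y0) (w_unit : w1 ^+ 2 + w2 ^+ 2 = 1).

Let y t := y0 * expR (L * t).
Let u1 t := w1 * cos (T * t) - w2 * sin (T * t).
Let u2 t := w1 * sin (T * t) + w2 * cos (T * t).

Let y_gt0 t : 0 < y t. Proof. by rewrite mulr_gt0 ?expR_gt0. Qed.

Let u_unit t : u1 t ^+ 2 + u2 t ^+ 2 = 1.
Proof.
have E := cos2Dsin2 (T * t).
rewrite (_ : _ + _ = (w1 ^+ 2 + w2 ^+ 2) * (cos (T * t) ^+ 2 + sin (T * t) ^+ 2)).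
  by rewrite E mulr1.
by rewrite /u1 /u2; ring.
Qed.

(** Affine horizontal motion, exponential height and uniform rotation: any two frames are joined
    this way, and the Sasaki speed has a closed form. *)
Definition explicit_curve t : T1H2 R := mkT1 (x0 + X * t) (y_gt0 t) (u_unit t).

Lemma base_explicit_curve t :
  coordH (base (explicit_curve t)) = (x0 + X * t, y0 * expR (L * t)).
Proof. by []. Qed.

Lemma dir_explicit_curve t : dir (explicit_curve t) =
  (y0 * expR (L * t) * (w1 * cos (T * t) - w2 * sin (T * t)),
   y0 * expR (L * t) * (w1 * sin (T * t) + w2 * cos (T * t))).
Proof. by []. Qed.

Let dx (t : R) : is_derive t 1 (fun t : R => x0 + X * t) X.
Proof. by apply: is_derive_eq; rewrite /GRing.scale /=; ring. Qed.
Let dy (t : R) : is_derive t 1 y (L * y t).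
Proof. by apply: is_derive_eq; rewrite /GRing.scale /= /y; ring. Qed.
Let du1 (t : R) : is_derive t 1 u1 (- T * u2 t).
Proof. by apply: is_derive_eq; rewrite /GRing.scale /= /u2; ring. Qed.
Let du2 (t : R) : is_derive t 1 u2 (T * u1 t).
Proof. by apply: is_derive_eq; rewrite /GRing.scale /= /u1; ring. Qed.

Let cont (f f' : R -> R) : (forall t : R, is_derive t 1 f (f' t)) -> continuous f.
Proof.
move=> df t; have d := df t.
by apply/differentiable_continuous/derivable1_diffP; exact: ex_derive.
Qed.

Let dM (f g : R -> R) (a b t : R) : is_derive t 1 f a -> is_derive t 1 g b ->
  is_derive t 1 (fun s => f s * g s) (a * g t + f t * b).
Proof. by move=> df dg; apply: is_derive_eq; rewrite /GRing.scale /=; ring. Qed.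

Let v1' t := L * y t * u1 t + y t * (- T * u2 t).
Let v2' t := L * y t * u2 t + y t * (T * u1 t).
Let dv1 (t : R) : is_derive t 1 (fun s => y s * u1 s) (v1' t).
Proof. exact: dM. Qed.
Let dv2 (t : R) : is_derive t 1 (fun s => y s * u2 s) (v2' t).
Proof. exact: dM. Qed.

Let ccst (a : R) : continuous (fun _ : R => a).
Proof. by move=> t; exact: cvg_cst. Qed.

Lemma explicit_curve_C1 : C1_curve explicit_curve.
Proof.
have cy := cont dy; have cu1 := cont du1; have cu2 := cont du2.
split.
- exact: (C1I dx).
- change (C1 y); apply: (C1I dy).
  by apply: contM => //; exact: ccst.
- change (C1 (fun s => y s * u1 s)); apply: (C1I dv1).
  by apply: contD; (apply: contM => //; apply: contM => //; exact: ccst).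
- change (C1 (fun s => y s * u2 s)); apply: (C1I dv2).
  by apply: contD; (apply: contM => //; apply: contM => //; exact: ccst).
Qed.

Lemma explicit_curve_length :
  sasaki_length explicit_curve <= 2 * (`|X| * expR `|L| / y0) + `|L| + `|T|.
Proof.
apply: Rintegral01_le; first exact: sasaki_speed_continuous explicit_curve_C1.
move=> t /andP[t0 t1]; rewrite /sasaki_speed /hnorm2 /cov_deriv /dbase /=.
rewrite (derive1_is_derive dx) (derive1_is_derive dy) (derive1_is_derive dv1)
  (derive1_is_derive dv2).
rewrite /v1' /v2' -/(y t) -/(u1 t) -/(u2 t).
have yt := y_gt0 t; have uu := u_unit t; have yn : y t != 0 by rewrite gt_eqF.
pose Z := X / y t.
(* The direction turns at rate T in coordinates and at rate T + Z relative to parallel transport. *)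
rewrite [X in Num.sqrt X](_ : _ = Z ^+ 2 + L ^+ 2 + (T + Z) ^+ 2 * (u1 t ^+ 2 + u2 t ^+ 2)); last first.
  by rewrite /Z; field.
rewrite uu mulr1.
have Zb : `|Z| <= `|X| * expR `|L| / y0.
  rewrite /Z normrM normfV (gtr0_norm yt) -mulrA ler_wpM2l// /y invfM [leRHS]mulrC.
  rewrite ler_wpM2l ?invr_ge0 ?(ltW y0_gt0)// -expRN ler_expR.
  have := ler_norm (- L); rewrite normrN; have := normr_ge0 L => n0 nL.
  case: (leP 0 L) => hL; first by nra.
  by have := ltr0_norm hL; nra.
apply: (@le_trans _ _ (2 * `|Z| + `|L| + `|T|)); last by lra.
rewrite -[leRHS]ger0_norm; last by rewrite !addr_ge0 ?mulr_ge0.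
rewrite -sqrtr_sqr ler_wsqrtr//.
have n1 := normr_ge0 Z; have n2 := normr_ge0 L; have n3 := normr_ge0 T.
have e1 := real_normK (num_real Z); have e2 := real_normK (num_real L).
have e3 := real_normK (num_real T).
have : T * Z <= `|T| * `|Z| by rewrite -normrM ler_norm.
have p1 := mulr_ge0 n1 n2; have p2 := mulr_ge0 n1 n3; have p3 := mulr_ge0 n2 n3.
nra.
Qed.

End ExplicitCurves.

Section SasakiUpperBound.
Variables (R : realType) (Gamma : groupClosed (PSL2 R)).
Implicit Types (g h k : SL2 R).

Lemma T1H2P (u v : T1H2 R) : coordH (base u) = coordH (base v) -> dir u = dir v -> u = v.
Proof. by move=> /coordH_inj E1 E2; exact: T1H2_eqP. Qed.

Let den_sqrt g : 0 < Num.sqrt (sqden g) /\ Num.sqrt (sqden g) ^+ 2 = sqden g.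
Proof. by rewrite sqrtr_gt0 sqr_sqrtr ?sqden_gt0 ?ltW ?sqden_gt0. Qed.

(** If the bottom row (c, d) is proportional to (sin beta, cos beta), the direction has angle pi/2 -
    2 beta. Here [a] is the increment of beta, so the joining curve turns by -2a. *)
Lemma curve_of_length_pt g h (a : R) :
  cos a = (mxval g 1 1 * mxval h 1 1 + mxval g 1 0 * mxval h 1 0) /
    (Num.sqrt (sqden g) * Num.sqrt (sqden h)) ->
  sin a = (mxval g 1 1 * mxval h 1 0 - mxval g 1 0 * mxval h 1 1) /
    (Num.sqrt (sqden g) * Num.sqrt (sqden h)) ->
  exists2 l, curve_of_length (pt Gamma g) (pt Gamma h) l &
  l <= 2 * (`|(coordH (base (frame_to_T1 (psl h)))).1 -
              (coordH (base (frame_to_T1 (psl g)))).1| *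
       expR `|ln (sqden g / sqden h)| / (sqden g)^-1) +
    `|ln (sqden g / sqden h)| + `|- 2 * a|.
Proof.
have [S0p S0E] := den_sqrt g; have [S1p S1E] := den_sqrt h.
have D0p := sqden_gt0 g; have D1p := sqden_gt0 h.
set S0 := Num.sqrt (sqden g) in S0p S0E *; set S1 := Num.sqrt (sqden h) in S1p S1E *.
move=> ca sa.
have y0p : 0 < (sqden g)^-1 by rewrite invr_gt0.
have S0n : S0 != 0 by rewrite gt_eqF.
have S1n : S1 != 0 by rewrite gt_eqF.
pose w1 := 2 * mxval g 1 0 * mxval g 1 1 / sqden g.
pose w2 := (mxval g 1 1 ^+ 2 - mxval g 1 0 ^+ 2) / sqden g.
have w : w1 ^+ 2 + w2 ^+ 2 = 1.
  have n0 : sqden g != 0 by rewrite gt_eqF.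
  have -> : w1 ^+ 2 + w2 ^+ 2 = sqden g ^+ 2 / sqden g ^+ 2.
    by rewrite /w1 /w2; move: n0; rewrite /sqden => n0; field.
  by rewrite mulfV// expf_neq0.
pose X := (coordH (base (frame_to_T1 (psl h)))).1 -
              (coordH (base (frame_to_T1 (psl g)))).1.
pose c := explicit_curve (coordH (base (frame_to_T1 (psl g)))).1 X
   (ln (sqden g / sqden h)) (- 2 * a) y0p w.
have c0 : c 0 = frame_to_T1 (psl g).
  apply: T1H2P.
    rewrite base_explicit_curve !mulr0 addr0 expR0 mulr1 [RHS]surjective_pairing.
    by congr pair; rewrite base_frame.
  rewrite dir_explicit_curve !mulr0 expR0 cos0 sin0 !mulr1 !mulr0 subr0 add0r dir_frame.
  by congr pair; rewrite /w1 /w2; field; rewrite gt_eqF.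
have c1 : c 1 = frame_to_T1 (psl h).
  have Y : (sqden g)^-1 * expR (ln (sqden g / sqden h) * 1) = (sqden h)^-1.
    rewrite mulr1 lnK ?posrE ?divr_gt0// mulrA mulVf ?mul1r//; exact: lt0r_neq0.
  apply: T1H2P.
    rewrite base_explicit_curve Y mulr1 /X addrC subrK [RHS]surjective_pairing.
    by congr pair; rewrite base_frame.
  have s2 : sin (- 2 * a * 1) = - (2 * sin a * cos a).
    rewrite (_ : - 2 * a * 1 = - (a + a)); last by ring.
    by rewrite sinN sinD; ring.
  have c2 : cos (- 2 * a * 1) = cos a ^+ 2 - sin a ^+ 2.
    rewrite (_ : - 2 * a * 1 = - (a + a)); last by ring.
    by rewrite cosN cosD; ring.
  rewrite dir_explicit_curve Y s2 c2 ca sa dir_frame /w1 /w2 -S0E -S1E.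
  have Sg : mxval g 1 0 ^+ 2 + mxval g 1 1 ^+ 2 = S0 ^+ 2 by rewrite S0E.
  move: (mxval g 1 0) (mxval g 1 1) (mxval h 1 0) (mxval h 1 1) Sg => C0 D0 C1 D1 Sg.
  congr pair.
    apply: (@etrans _ _ (2 * C1 * D1 * (C0 ^+ 2 + D0 ^+ 2) ^+ 2 / (S0 ^+ 4 * S1 ^+ 4))).
      by field; rewrite ?S0n ?S1n.
    by rewrite Sg; field; rewrite ?S0n ?S1n.
  apply: (@etrans _ _ ((D1 ^+ 2 - C1 ^+ 2) * (C0 ^+ 2 + D0 ^+ 2) ^+ 2 / (S0 ^+ 4 * S1 ^+ 4))).
    by field; rewrite ?S0n ?S1n.
  by rewrite Sg; field; rewrite ?S0n ?S1n.
exists (sasaki_length c + 0); last by rewrite addr0; exact: explicit_curve_length.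
by rewrite /pt -c0 -c1; apply: curve_cons; [exact: explicit_curve_C1|exact: curve_nil].
Qed.

End SasakiUpperBound.

(** * Comparison of the Sasaki distance with the entry norm *)

Section SasakiProximity.
Variables (R : realType) (Gamma : groupClosed (PSL2 R)).
Implicit Types (g h k : SL2 R).

Lemma exists_angle (p q : R) : p ^+ 2 + q ^+ 2 = 1 -> exists2 a, cos a = p & sin a = q.
Proof.
move=> pq.
have p1 : -1 <= p <= 1.
  rewrite -ler_norml -(@ler_pXn2r _ 2)// ?nnegrE// real_normK ?num_real//.
  by rewrite expr1n -pq lerDl sqr_ge0.
have q2 : Num.sqrt (1 - p ^+ 2) = `|q| by rewrite -pq addrC addKr sqrtr_sqr.
case: (leP 0 q) => q0; [exists (acos p)|exists (- acos p)].
- by rewrite acosK// in_itv.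
- by rewrite sin_acos// q2 ger0_norm.
- by rewrite cosN acosK// in_itv.
- by rewrite sinN sin_acos// q2 ltr0_norm ?opprK.
Qed.

Let cos_sin_unit g h :
  ((mxval g 1 1 * mxval h 1 1 + mxval g 1 0 * mxval h 1 0) /
    (Num.sqrt (sqden g) * Num.sqrt (sqden h))) ^+ 2 +
  ((mxval g 1 1 * mxval h 1 0 - mxval g 1 0 * mxval h 1 1) /
    (Num.sqrt (sqden g) * Num.sqrt (sqden h))) ^+ 2 = 1.
Proof.
rewrite !exprMn !exprVn exprMn !sqr_sqrtr ?(ltW (sqden_gt0 _))//.
rewrite -mulrDl [X in X / _](_ : _ = sqden g * sqden h); last by rewrite /sqden; ring.
by rewrite mulfV// mulf_neq0// gt_eqF ?sqden_gt0.
Qed.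

Lemma curve_of_length_ge0 p q l : @curve_of_length R Gamma p q l -> 0 <= l.
Proof.
by elim=> {p q l} [//|c q l Cc _ l0]; rewrite addr_ge0// sasaki_length_ge0.
Qed.

Lemma has_inf_curve_of_length p q : has_inf [set l | @curve_of_length R Gamma p q l].
Proof.
have [g ->] := pt_surj p; have [h ->] := pt_surj q.
have [a ca sa] := exists_angle (cos_sin_unit g h).
split; last by exists 0 => l; exact: curve_of_length_ge0.
by have [l Cl _] := @curve_of_length_pt R Gamma g h a ca sa; exists l.
Qed.

(** Each piece multiplies the lift on the right by a factor whose [1 + dev] is at most 1 + 28 l <=
    exp (28 l), and these bounds multiply. At a junction the lift is corrected by a lattice element
    on the left, which does not affect the right factors. *)
Lemma curve_of_length_dev p q l g : @curve_of_length R Gamma p q l -> p = pt Gamma g ->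
  l <= 1 / 2 -> exists2 k, q = pt Gamma (g * k)%g & 1 + dev k <= expR (28 * l).
Proof.
move=> H; elim: H g => {p q l} [p|c q l Cc Cq IH] g E l2.
  by exists 1%g; rewrite ?mulg1// dev1 mulr0 expR0 addr0.
have lc0 := sasaki_length_ge0 c; have l0 := curve_of_length_ge0 Cq.
have FE (u : T1H2 R) : u = frame_to_T1 (psl (repr (frame u))) by rewrite psl_repr frameK.
have [|k kE kd] := frame_displacement Cc (FE _) (FE _); first lra.
move: kE E; set g0 := repr (frame (c 0)); set g1 := repr (frame (c 1)) => kE.
rewrite {1}[c 0]FE -/g0 => /(pt_eqP Gamma g0 g) L.
have [||m mE md] := IH (g * k)%g; last 1 first.
- exists (k * m)%g; first by rewrite mulgA.
  apply: le_trans (devM _ _) _; rewrite [28 * _]mulrDr expRD ler_pM ?addr_ge0 ?dev_ge0//.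
  by apply: le_trans (expR_ge1Dx _); rewrite lerD2l.
- have -> : (g * k = g * g0^-1 * (g0 * k))%g by rewrite mulgA mulgVK.
  by rewrite pt_lat// /pt kE -FE.
- lra.
Qed.

Lemma sasaki_dist_dev (eta : R) : 0 < eta -> exists2 delta : R, 0 < delta &
  forall g h, sasaki_dist (pt Gamma g) (pt Gamma h) < delta ->
    exists2 k, lat Gamma k & dev (g^-1 * k * h)%g < eta.
Proof.
move=> eta0.
have ln0 : 0 < ln (1 + eta) by rewrite ln_gt0// ltrDl.
exists (Num.min (1 / 2) (ln (1 + eta) / 28)); first by rewrite lt_min !divr_gt0.
move=> g h /(inf_lt (has_inf_curve_of_length _ _).1)[l Cl].
rewrite lt_min => /andP[l2 le].
have [k kE kd] := curve_of_length_dev Cl erefl (ltW l2).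
exists (g * k * h^-1)%g; first exact/pt_eqP.
rewrite !mulgA mulVg mul1g mulgVK -(ltrD2l 1); apply: le_lt_trans kd _.
by rewrite -[ltRHS]lnK ?posrE ?ltr_wpDr// ?ltr_expR; [rewrite mulrC -ltr_pdivlMr|lra].
Qed.

Lemma sasaki_dist_self p : @sasaki_dist R Gamma p p <= 0.
Proof.
apply: ge_inf; last exact: curve_nil.
by case: (has_inf_curve_of_length p p).
Qed.

(** The filter of [nrm]-neighbourhoods of g, so that the length bound of [curve_of_length_pt] can be
    treated by limit arithmetic. *)
Let ball_filter g : set_system (SL2 R) :=
  filter_from [set e : R | 0 < e] (fun e => [set h | nrm (mxval h - mxval g) < e]).

Let ball_filterP g : Filter (ball_filter g).
Proof.
apply: filter_from_filter; first by exists 1; rewrite /= ltr01.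
move=> a b a0 b0; exists (Num.min a b); first by rewrite /= lt_min a0.
by move=> h /=; rewrite lt_min => /andP.
Qed.

Let cvg_entry g i j : (fun h => mxval h i j) @ ball_filter g --> mxval g i j.
Proof.
have FF := ball_filterP g.
apply/cvgrPdist_lt => e e0; exists e => // h /= he.
apply: le_lt_trans he; rewrite distrC.
by have := nrm_entry (mxval h - mxval g) i j; rewrite !mxE.
Qed.

(** The length bound of [curve_of_length_pt] tends to 0 as h tends to g, provided that the angle is
    chosen continuously. *)
Lemma sasaki_dist_near g (delta : R) : 0 < delta -> exists2 eta : R, 0 < eta &
  forall h, nrm (mxval h - mxval g) < eta -> sasaki_dist (pt Gamma g) (pt Gamma h) < delta.
Proof.
move=> delta0; have FF := ball_filterP g.
have Dg := sqden_gt0 g; have Dn : sqden g != 0 by rewrite gt_eqF.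
have cE i j : (fun h => mxval h i j) @ ball_filter g --> mxval g i j by exact: cvg_entry.
have [cc cd] := (cE 1 0, cE 1 1); have [ca cb] := (cE 0 0, cE 0 1).
have cD : @sqden R @ ball_filter g --> sqden g.
  by apply: cvgD; rewrite expr2; under eq_fun do rewrite expr2; exact: cvgM.
have cDV : (fun h => (sqden h)^-1) @ ball_filter g --> (sqden g)^-1 by exact: cvgV.
have cS : (fun h => Num.sqrt (sqden g) * Num.sqrt (sqden h)) @ ball_filter g -->
    Num.sqrt (sqden g) * Num.sqrt (sqden g).
  apply: cvgM; first exact: cvg_cst.
  by apply: continuous_cvg cD; exact: sqrt_continuous.
have Sn : Num.sqrt (sqden g) * Num.sqrt (sqden g) != 0.
  by rewrite -expr2 sqr_sqrtr// ltW.
pose q h := (mxval g 1 1 * mxval h 1 0 - mxval g 1 0 * mxval h 1 1) /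
    (Num.sqrt (sqden g) * Num.sqrt (sqden h)).
pose p h := mxval g 1 1 * mxval h 1 1 + mxval g 1 0 * mxval h 1 0.
have cq : q @ ball_filter g --> (0 : R).
  have -> : (0 : R) = q g by rewrite /q [mxval g 1 1 * _]mulrC subrr mul0r.
  apply: cvgM; last exact: cvgV.
  by apply: cvgB; (apply: cvgM; first exact: cvg_cst).
have cp : p @ ball_filter g --> sqden g.
  have -> : sqden g = p g by rewrite /sqden /p addrC.
  by apply: cvgD; (apply: cvgM; first exact: cvg_cst).
pose lam h := ln (sqden g / sqden h).
have clam : lam @ ball_filter g --> (0 : R).
  have -> : (0 : R) = lam g by rewrite /lam mulfV// ln1.
  apply: continuous_cvg; first by apply: continuous_ln; rewrite divr_gt0.
  by apply: cvgM; first exact: cvg_cst.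
pose X h := (coordH (base (frame_to_T1 (psl h)))).1 -
              (coordH (base (frame_to_T1 (psl g)))).1.
have cX : X @ ball_filter g --> (0 : R).
  have -> : (0 : R) = X g by rewrite /X subrr.
  apply: cvgB; last exact: cvg_cst.
  under eq_fun do rewrite base_frame /=; rewrite base_frame /=.
  by apply: cvgM cDV; apply: cvgD; exact: cvgM.
(* Near g the cosine [p] is positive, so [asin] returns the right angle, and it is continuous in
   h. *)
have ca' : (fun h => asin (q h)) @ ball_filter g --> (0 : R).
  have as0 : asin (0 : R) = 0.
    rewrite -[X in asin X](@sin0 R) sinK// in_itv /=.
    by have := @pi_ge0 R => pi0; apply/andP; split; lra.
  rewrite -[X in _ --> X]as0; apply: continuous_cvg cq.
  by apply: continuous_asin; rewrite ltrN10 ltr01.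
pose B h := 2 * (`|X h| * expR `|lam h| / (sqden g)^-1) + `|lam h| + `|- 2 * asin (q h)|.
have cB : B @ ball_filter g --> (0 : R).
  have -> : (0 : R) = 2 * (`|0 : R| * expR `|0 : R| / (sqden g)^-1) + `|0 : R| + `|- 2 * 0 : R|.
    by rewrite mulr0 normr0 !mul0r mulr0 !addr0.
  apply: cvgD; [apply: cvgD|apply: cvg_norm]; last first.
  - by apply: cvgM; first exact: cvg_cst.
  - exact: cvg_norm.
  apply: cvgM; first exact: cvg_cst.
  apply: cvgM; last exact: cvg_cst.
  apply: cvgM; first exact: cvg_norm.
  by apply: continuous_cvg; [exact: continuous_expR|exact: cvg_norm].
have NB := cvgr_lt _ cB _ delta0.
have Np := cvgr_gt _ cp _ Dg.
have [e /= e0 eP] := filterI (NB FF) (Np FF).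
exists e => // h /eP /= [Bd p0].
have pq := cos_sin_unit g h.
have S0 : 0 < Num.sqrt (sqden g) * Num.sqrt (sqden h).
  by rewrite mulr_gt0 ?sqrtr_gt0 ?sqden_gt0.
have q1 : -1 <= q h <= 1.
  rewrite -ler_norml -(@ler_pXn2r _ 2)// ?nnegrE// real_normK ?num_real//.
  by rewrite expr1n -pq lerDr sqr_ge0.
have sa : sin (asin (q h)) = q h by rewrite asinK// in_itv.
have cosa : cos (asin (q h)) = p h / (Num.sqrt (sqden g) * Num.sqrt (sqden h)).
  rewrite cos_asin// -pq -/(q h) addrK sqrtr_sqr ger0_norm//.
  by rewrite divr_ge0 ?(ltW p0) ?(ltW S0).
have [l Cl lB] := @curve_of_length_pt R Gamma g h _ cosa sa.
apply: le_lt_trans Bd; apply: le_trans lB; apply: ge_inf => //.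
by case: (has_inf_curve_of_length (pt Gamma g) (pt Gamma h)).
Qed.

End SasakiProximity.

(** * Horocycle orbits and minimal sets *)

Section HorocycleGeometry.
Variables (R : realType) (Gamma : groupClosed (PSL2 R)).
Implicit Types (g h k : SL2 R).

Lemma dev_upper t : dev (upper t : SL2 R) = `|t|.
Proof. by rewrite devE !upperE !subrr !normr0 add0r !addr0. Qed.

Fact geo_det (l : R) : expR l * expR (- l) - 0 * 0 = 1.
Proof. by rewrite mulr0 subr0 -expRD subrr expR0. Qed.

(** Right multiplication by this is the geodesic flow for time 2l, whence the factor exp (-2l) in
    [upper_geo]. *)
Definition geo (l : R) : SL2 R := mkSL2 (geo_det l).

Lemma geoE l : ((mxval (geo l) 0 0 = expR l) * (mxval (geo l) 0 1 = 0) *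
  (mxval (geo l) 1 0 = 0) * (mxval (geo l) 1 1 = expR (- l)))%type.
Proof. exact: mkSL2E. Qed.

Lemma geoD l m : geo (l + m) = (geo l * geo m)%g.
Proof.
by apply: SL2P; rewrite SL2_mulE !geoE ?opprD ?expRD; ring.
Qed.

Lemma geo0 : geo 0 = 1%g.
Proof. by apply: SL2P; rewrite geoE SL2_oneE ?oppr0 ?expR0. Qed.

Lemma upper_geo t l : (upper t * geo l = geo l * upper (t * expR (- 2 * l)))%g.
Proof.
have E : expR l * expR (- 2 * l) = expR (- l) by rewrite -expRD; congr expR; ring.
move: (expR (- 2 * l)) E => c E.
by apply: SL2P; rewrite !SL2_mulE !geoE !upperE -?E; ring.
Qed.

Lemma upper_inj : injective (@upper R).
Proof. by move=> s t /(congr1 (fun g => mxval g 0 1)); rewrite !upperE. Qed.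

Lemma horocycleD s t p : horocycle (s + t) p = horocycle s (horocycle t p) :> T1surface Gamma.
Proof.
by have [g ->] := pt_surj p; rewrite !horocycle_pt addrC upperD mulgA.
Qed.

Hypotheses (Hd : discrete_subgroup Gamma) (Hc : cocompact Gamma).

(* A closed horocycle is contracted to arbitrarily small length by the geodesic
   flow, which the injectivity radius forbids. *)
Lemma horocycle_free T (p : T1surface Gamma) : horocycle T p = p -> T = 0.
Proof.
have [eta eta0 etaP] := injectivity_radius Hd Hc.
have [g ->] := pt_surj p; rewrite horocycle_pt => /pt_eqP.
rewrite invgM -upperN mulgA => L.
have [l lP] : exists l, `|T| * expR (- 2 * l) < eta.
  exists (`|T| / eta / 2); have T0 := normr_ge0 T.
  have E := expR_ge1Dx (`|T| / eta).
  have -> : - 2 * (`|T| / eta / 2) = - (`|T| / eta) by field; rewrite gt_eqF.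
  rewrite expRN -ltr_pdivlMr ?invr_gt0 ?expR_gt0// invrK.
  rewrite -ltr_pdivrMl//; apply: lt_le_trans E; rewrite mulrC; lra.
have E : (g * upper (- T) * g^-1 = 1)%g.
  apply: (etaP (g * geo l)%g) => //.
  rewrite invgM !mulgA mulgVK -[X in dev X]mulgA upper_geo !mulgA mulgVK.
  by rewrite mulVg mul1g dev_upper normrM normrN (ger0_norm (expR_ge0 _)).
have : (upper (- T) = 1 :> SL2 R)%g.
  by move/(congr1 (fun x => g^-1 * x * g)%g): E; rewrite !mulgA mulVg mul1g mulgVK mulg1 mulVg.
by rewrite -upper0 => /upper_inj/eqP; rewrite oppr_eq0 => /eqP.
Qed.

Lemma horocycle_inj (p : T1surface Gamma) : injective (fun t => horocycle t p).
Proof.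
move=> s t /= E; apply/eqP; rewrite -subr_eq0; apply/eqP.
apply: (@horocycle_free _ (horocycle t p)).
by rewrite -horocycleD subrK E.
Qed.

Lemma dev_path_continuous k (s r : R -> R) : continuous s -> continuous r ->
  continuous (fun t => dev (upper (- s t) * k * upper (r t))%g).
Proof.
move=> cs cr.
have cc (a : R) : continuous (fun _ : R => a) by move=> t; exact: cvg_cst.
have cn (f : R -> R) : continuous f -> continuous (fun t => `|f t|).
  by move=> cf t; apply: cvg_norm; exact: cf.
have -> : (fun t => dev (upper (- s t) * k * upper (r t))%g) = (fun t =>
    `|mxval k 0 0 - s t * mxval k 1 0 - 1| +
    `|(mxval k 0 0 - s t * mxval k 1 0) * r t + (mxval k 0 1 - s t * mxval k 1 1)| +
    `|mxval k 1 0| + `|mxval k 1 0 * r t + mxval k 1 1 - 1|).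
  apply/funext => t; rewrite devE !SL2_mulE !upperE.
  by congr (_ + _ + _ + _); congr Num.norm; ring.
have csM (a : R) : continuous (fun t => s t * a) by apply: contM => //; exact: cc.
have cl (a b : R) : continuous (fun t => a - s t * b).
  by apply: contB; [exact: cc|exact: csM].
apply: contD; last first.
  apply: cn; apply: contB; last exact: cc.
  by apply: contD; [apply: contM => //; exact: cc|exact: cc].
apply: contD; last exact: cc.
apply: contD; apply: cn; first by apply: contB; [exact: cl|exact: cc].
by apply: contD; [apply: contM => //; exact: cl|exact: cl].
Qed.

(* Two lifts that stay in the same orbit at small distance cannot jump to
   another translate: the displacement is continuous and, by the injectivity
   radius, omits an interval of values. *)
Lemma tracking : exists2 e0 : R, 0 < e0 & forall e g h (s r : R -> R) T, e < e0 ->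
  continuous s -> continuous r -> 0 <= T ->
  dev (upper (- s 0) * (g^-1 * h) * upper (r 0))%g < e ->
  (forall t, 0 <= t <= T -> exists2 k, lat Gamma k &
     dev (upper (- s t) * (g^-1 * k * h) * upper (r t))%g < e) ->
  dev (upper (- s T) * (g^-1 * h) * upper (r T))%g < e.
Proof.
have [eta eta0 etaP] := injectivity_radius Hd Hc.
(* For e0 <= 1 one has (1 + e0)^2 <= 1 + 3 e0 <= 1 + eta, as needed when two displacements are
   composed. *)
pose e0 := Num.min 1 (eta / 3).
have e00 : 0 < e0 by rewrite lt_min ltr01 divr_gt0.
have e01 : e0 <= 1 by rewrite ge_min lexx.
have e0eta : e0 <= eta / 3 by rewrite ge_min lexx orbT.
exists e0 => // e g h s r T ee0 cs cr T0 d0 H.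
pose f t := dev (upper (- s t) * (g^-1 * h) * upper (r t))%g.
have cf : continuous f by exact: dev_path_continuous.
(* The displacement by 1 and the displacement by the translate k are both below e0, so k is trivial
   by the injectivity radius: no value of f lies in [e, e0). *)
have jump t : 0 <= t <= T -> f t < e0 -> f t < e.
  move=> t0 ft; have [k kL kd] := H t t0.
  suff k1 : k = 1%g by move: kd; rewrite k1 mulg1.
  apply: (etaP (g * upper (s t))%g) => //.
  set A := (upper (- s t) * (g^-1 * k * h) * upper (r t))%g in kd.
  set B := (upper (- s t) * (g^-1 * h) * upper (r t))%g in ft *.
  have -> : ((g * upper (s t))^-1 * k * (g * upper (s t)) = A * B^-1)%g.
    rewrite /A /B !invgM !upperN !invgK !mulgA.
    by rewrite mulgK mulgK.
  rewrite -(ltrD2l 1); apply: le_lt_trans (devM _ _) _; rewrite devV.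
  apply: (@lt_le_trans _ _ ((1 + e0) * (1 + e0))).
    by rewrite ltr_pM ?addr_ge0 ?dev_ge0// ltrD2l// (lt_trans kd).
  by nra.
rewrite -/(f T); case: (ltP (f T) e) => // fT; exfalso.
have fTe0 : e0 <= f T.
  rewrite leNgt; apply/negP => /jump; rewrite lexx T0 => /(_ isT).
  by rewrite ltNge fT.
have [||c] := @IVT R f 0 T e T0.
- exact: continuous_subspaceT.
- have {}d0 : f 0 < e by [].
  have f0T : f 0 < f T by exact: lt_le_trans d0 fT.
  by rewrite minElt maxElt f0T (ltW d0) fT.
move=> /itvP cT fc; have := jump c; rewrite fc ltxx ee0 => /(_ _ isT).
by rewrite !cT => /(_ isT).
Qed.

(** Compactness of the unit tangent bundle in sequential form: counterexamples are moved by the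
    lattice into a bounded set, and the local hypothesis is applied at a cluster point. *)
Lemma compactness_principle (P : nat -> T1surface Gamma -> Prop) :
  (forall m n p, (m <= n)%N -> P m p -> P n p) ->
  (forall g, exists2 eta : R, 0 < eta & exists n, forall h,
     nrm (mxval h - mxval g) < eta -> P n (pt Gamma h)) ->
  exists n, forall p, P n p.
Proof.
move=> Pmono Ploc; have [N NP] := cocompact_bounded Hc.
apply: contrapT => nP.
have bad n : exists g, nrm (mxval g) <= N /\ ~ P n (pt Gamma g).
  have [p np] : exists p, ~ P n p by apply/existsNP => Pn; apply: nP; exists n.
  have [g gp] := pt_surj p; have [k kL kN] := NP g.
  by exists (k * g)%g; split; rewrite // pt_lat// -gp.
have [u uP] := choice bad.
have [|g gP] := @SL2_bolzano_weierstrass R N u; first by move=> n; exact: (uP n).1.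
have [eta eta0 [n0 etaP]] := Ploc g.
have [n n0n un] := gP eta n0 eta0.
by apply: (uP n).2; apply: Pmono n0n _; exact: etaP.
Qed.

End HorocycleGeometry.

Section MinimalSets.
Variables (R : realType) (Gamma : groupClosed (PSL2 R)).
Implicit Types (g h k : SL2 R) (Y Z : set (SL2 R)).

Definition adherent Y g := forall eta : R, 0 < eta ->
  exists2 h, Y h & nrm (mxval h - mxval g) < eta.

(* Closed forward invariant subsets of the quotient, seen as Gamma-invariant
   subsets of SL2. *)
Definition horocycle_invariant Y : Prop :=
  [/\ Y !=set0, (forall g, adherent Y g -> Y g),
      (forall k g, lat Gamma k -> Y g -> Y (k * g)%g) &
      (forall t g, 0 <= t -> Y g -> Y (g * upper t)%g)].

Definition horocycle_minimal Y : Prop := horocycle_invariant Y /\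
  forall Z, Z `<=` Y -> horocycle_invariant Z -> Y `<=` Z.

Lemma adherentS Y Z g : Y `<=` Z -> adherent Y g -> adherent Z g.
Proof. by move=> YZ Yg eta /Yg[h /YZ]; exists h. Qed.

Lemma adherent_mul Y k g : adherent [set h | Y (h * k)%g] g -> adherent Y (g * k)%g.
Proof.
move=> Yg eta eta0; have k0 : 0 < nrm (mxval k) + 1 by rewrite ltr_wpDl ?nrm_ge0.
have [|h Yh hg] := Yg (eta / (nrm (mxval k) + 1)); first by rewrite divr_gt0.
exists (h * k)%g => //; rewrite !mxvalM -mulmxBl; apply: le_lt_trans (nrmM _ _) _.
move: hg; rewrite ltr_pdivlMr// => /(le_lt_trans _); apply.
by rewrite ler_wpM2l ?nrm_ge0// lerDl.
Qed.

Hypotheses (Hd : discrete_subgroup Gamma) (Hc : cocompact Gamma).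

Lemma exists_minimal Z : horocycle_invariant Z ->
  exists2 Y, Y `<=` Z & horocycle_minimal Y.
Proof.
move=> invZ; have [Z0 Zcl Zlat Zup] := invZ.
have [N NP] := cocompact_bounded Hc.
(* Zorn's lemma is stated for unions, so it is applied to complements. *)
pose P := [set A | horocycle_invariant (Z `\` A)].
have chain (F : set (set (SL2 R))) : F `<=` P -> total_on F subset -> P (\bigcup_(X in F) X).
  move=> FP Ftot.
  (* Adding the empty set covers the empty chain and keeps the intersection of the complements
     inside Z. *)
  pose F' := F `|` [set set0].
  have FP' A : F' A -> P A by move=> [/FP//|->]; rewrite /P /= setD0.
  have Ftot' A B : F' A -> F' B -> A `<=` B \/ B `<=` A.
    by move=> [FA|->] [FB|->]; [exact: Ftot|right|left|left].
  have DU : Z `\` \bigcup_(X in F) X = \bigcap_(X in F') (Z `\` X).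
    apply/seteqP; split=> g.
      by move=> [Zg nU] A [FA|->]; split => // Ag; apply: nU; exists A.
    move=> gI; split; first by have [] := gI set0 (or_intror erefl).
    by move=> [A FA Ag]; have [] := gI A (or_introl FA).
  rewrite /P /= DU; split.
  (* By lattice invariance each complement meets the ball of radius N, so compactness of that ball
     gives a common point. *)
  - pose K A := [set g | (Z `\` A) g /\ nrm (mxval g) <= N].
    have K0 A : F' A -> K A !=set0.
      move=> /FP'[[g Zg] _ Alat _]; have [k kL kN] := NP g.
      by exists (k * g)%g; split => //; exact: Alat.
    have PF : ProperFilter (filter_from F' K).
      apply: filter_from_proper => //; apply: filter_from_filter.
        by exists set0; right.
      move=> A B FA FB; have [AB|BA] := Ftot' _ _ FA FB.
        exists B => // g [[Zg nB] gN]; split; split => //; split => //.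
        by move/AB.
      exists A => // g [[Zg nA] gN]; split; split => //; split => //.
      by move/BA.
    have [|g gP] := @SL2_cluster R N (filter_from F' K).
      by exists set0; [right|move=> g []].
    exists g => A FA; have [_ Acl _ _] := FP' A FA.
    apply: Acl => eta eta0.
    have [||h [Ah _] hg] := gP eta (K A) => //; first by exists A.
    by exists h.
  - move=> g gadh A FA; have [_ Acl _ _] := FP' A FA.
    by apply: Acl; apply: adherentS gadh => h /(_ A FA).
  - move=> k g kL gI A FA; have [_ _ Alat _] := FP' A FA.
    by apply: Alat => //; exact: gI.
  - move=> t g t0 gI A FA; have [_ _ _ Aup] := FP' A FA.
    by apply: Aup => //; exact: gI.
have [A [PA Amax]] := Zorn_bigcup chain.
exists (Z `\` A); first by move=> g [].
split=> // Y YZ invY g gZA; apply: contrapT => nYg.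
apply: (Amax (~` Y)); last first.
  rewrite /P /= setDE setCK (_ : Z `&` Y = Y)//.
  by apply/setIidPr => h /YZ[].
split; first by move=> h Ah /YZ[].
by move=> /(_ g nYg); case: gZA.
Qed.

Section Minimal.
Variable Y : set (SL2 R).
Hypothesis minY : horocycle_minimal Y.

(** The g in Y with gk in Y form a closed lattice-invariant set, forward invariant because k
    normalises the semigroup of positive times. Once it is nonempty, minimality makes it all of
    Y. *)
Lemma minimal_mul k : (forall t, 0 <= t -> exists2 t', 0 <= t' &
    (upper t * k = k * upper t')%g) ->
  (exists2 g, Y g & Y (g * k)%g) -> forall g, Y g -> Y (g * k)%g.
Proof.
move=> comm [g0 Yg0 Yg0k]; have [[Y0 Ycl Ylat Yup] Ymin] := minY.
suff /(Ymin [set g | Y g /\ Y (g * k)%g]) H : horocycle_invariant [set g | Y g /\ Y (g * k)%g].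
  by move=> g /H[] // h [].
split.
- by exists g0.
- move=> g gadh; split; first by apply: Ycl; apply: adherentS gadh => h [].
  by apply: Ycl; apply: adherent_mul; apply: adherentS gadh => h [].
- move=> m g mL [Yg Ygk]; split; first exact: Ylat.
  by rewrite -mulgA; exact: Ylat.
- move=> t g t0 [Yg Ygk]; split; first exact: Yup.
  have [t' t'0 tt'] := comm t t0.
  by rewrite -mulgA tt' mulgA; exact: Yup.
Qed.

Lemma minimal_upper t g : Y g -> Y (g * upper t)%g.
Proof.
have [[[g0 Yg0] _ _ Yup] _] := minY.
have [t0|t0] := leP 0 t; first exact: Yup.
apply: minimal_mul.
  by move=> s s0; exists s => //; rewrite -!upperD addrC.
exists (g0 * upper (- t))%g; first by apply: Yup; rewrite // oppr_ge0 ltW.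
by rewrite -mulgA -upperD addNr upper0 mulg1.
Qed.

Lemma minimal_geo_of l : (exists2 g, Y g & Y (g * geo l)%g) ->
  forall g, Y g -> Y (g * geo l)%g.
Proof.
apply: minimal_mul => t t0; exists (t * expR (- 2 * l)); last exact: upper_geo.
by rewrite mulr_ge0 ?expR_ge0.
Qed.

(** Two visits of one orbit, at integer times i < j, to a small neighbourhood of a cluster point.
    Were k = upper t, injectivity of the orbit would give t = j - i >= 1, against |t| < eta <= 1. *)
Lemma minimal_return (eta : R) : 0 < eta -> exists g k,
  [/\ Y g, Y (g * k)%g, dev k < eta & forall t, k <> upper t].
Proof.
wlog eta1 : eta / eta <= 1.
  move=> H eta0; have [||g [k [Yg Ygk kd kU]]] := H (Num.min eta 1).
  - by rewrite ge_min lexx orbT.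
  - by rewrite lt_min eta0 ltr01.
  - by exists g, k; split => //; move: kd; rewrite lt_min => /andP[].
move=> eta0; have [[[y Yy] Ycl Ylat Yup] _] := minY.
have [N NP] := cocompact_bounded Hc.
have N1 : 0 < `|N| + 1 by rewrite ltr_wpDl.
have mP' n : exists k, lat Gamma k /\ nrm (mxval (k * (y * upper n%:R))%g) <= N.
  by have [k kL kN] := NP (y * upper n%:R)%g; exists k.
have [m mP] := choice mP'.
pose z n := (m n * (y * upper n%:R))%g.
have [|w wP] := @SL2_bolzano_weierstrass R N z; first by move=> n; exact: (mP n).2.
have e0 : 0 < eta / (2 * (`|N| + 1)) by rewrite divr_gt0// mulr_gt0.
have [i _ iP] := wP _ 0%N e0; have [j ij jP] := wP _ i.+1 e0.
have Yz n : Y (z n) by apply: Ylat; [exact: (mP n).1|apply: Yup].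
have dk : dev ((z i)^-1 * z j)%g < eta.
  apply: le_lt_trans (dev_mulV _ _) _.
  have d : nrm (mxval (z j) - mxval (z i)) < eta / (`|N| + 1).
    rewrite (_ : _ - _ = (mxval (z j) - mxval w) + (mxval w - mxval (z i))); last first.
      by rewrite addrA subrK.
    apply: le_lt_trans (nrmD _ _) _; rewrite [X in _ + X]nrmB.
    rewrite (_ : eta / (`|N| + 1) = eta / (2 * (`|N| + 1)) + eta / (2 * (`|N| + 1))).
      exact: ltrD.
    by field; rewrite gt_eqF.
  move: d; rewrite ltr_pdivlMr// mulrC => /(le_lt_trans _); apply.
  rewrite ler_wpM2r ?nrm_ge0//; apply: le_trans (mP i).2 _.
  by apply: le_trans (ler_norm _) _; rewrite lerDl.
exists (z i), ((z i)^-1 * z j)%g; split => //; first by rewrite mulVKg.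
move=> t E; move: dk; rewrite E dev_upper => te.
have : pt Gamma (z j) = pt Gamma (z i * upper t)%g by rewrite -E mulVKg.
rewrite /z -!mulgA (pt_lat _ (mP j).1) (pt_lat _ (mP i).1) -upperD -!horocycle_pt.
move=> /(horocycle_inj Hd Hc) E'.
have ijR : i%:R + 1 <= j%:R :> R by rewrite natr1 ler_nat.
move: te; have := ler_norm t; lra.
Qed.

(** Lattice translates bring the base points g into a bounded set; a cluster point w lies in Y, and
    w (geo l) is a limit of the points gk. *)
Lemma minimal_geo_approx l : (forall eta : R, 0 < eta ->
    exists g k, [/\ Y g, Y (g * k)%g & nrm (mxval k - mxval (geo l)) < eta]) ->
  exists2 g, Y g & Y (g * geo l)%g.
Proof.
move=> H; have [[Y0 Ycl Ylat Yup] _] := minY; have [N NP] := cocompact_bounded Hc.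
have H' n : exists p : SL2 R * SL2 R, [/\ Y p.1, Y (p.1 * p.2)%g, nrm (mxval p.1) <= N &
    nrm (mxval p.2 - mxval (geo l)) < n.+1%:R^-1].
  have [|g [k [Yg Ygk kd]]] := H n.+1%:R^-1; first by rewrite invr_gt0.
  have [m mL mN] := NP g; exists ((m * g)%g, k); split => //=; first exact: Ylat.
  by rewrite -mulgA; exact: Ylat.
have [p pP] := choice H'.
have [|w wP] := @SL2_bolzano_weierstrass R N (fun n => (p n).1).
  by move=> n; have [] := pP n.
exists w.
  apply: Ycl => eta eta0; have [n _ nw] := wP _ 0%N eta0.
  by exists (p n).1 => //; have [] := pP n.
have Nw0 := nrm_ge0 (mxval w); have Ng0 := nrm_ge0 (mxval (geo l)).
apply: Ycl => eta eta0.
pose M := nrm (mxval w) + nrm (mxval (geo l)) + 1.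
have M0 : 0 < M by rewrite /M; lra.
have e0 : 0 < Num.min 1 (eta / (2 * M)) by rewrite lt_min ltr01 divr_gt0// mulr_gt0.
set e := Num.min 1 _ in e0.
have [n0 n0P] : exists n0, n0.+1%:R^-1 < e.
  exists (Num.trunc e^-1); rewrite -[ltRHS]invrK ltf_pV2 ?posrE ?invr_gt0 ?ltr0n//.
  exact: truncnS_gt.
have [n nn0 nw] := wP e n0 e0; have [Yn Ynk _ nk] := pP n.
exists ((p n).1 * (p n).2)%g => //.
have nke : nrm (mxval (p n).2 - mxval (geo l)) < e.
  apply: lt_trans nk _; apply: le_lt_trans n0P.
  by rewrite lef_pV2 ?posrE ?ltr0n// ler_nat.
rewrite !mxvalM.
have -> : mxval (p n).1 *m mxval (p n).2 - mxval w *m mxval (geo l) =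
  (mxval (p n).1 - mxval w) *m mxval (p n).2 +
   mxval w *m (mxval (p n).2 - mxval (geo l)).
  by rewrite mulmxBl mulmxBr addrA subrK.
apply: le_lt_trans (nrmD _ _) _.
have b1 := nrmM (mxval (p n).1 - mxval w) (mxval (p n).2).
have b2 := nrmM (mxval w) (mxval (p n).2 - mxval (geo l)).
have b3 : nrm (mxval (p n).2) <= nrm (mxval (geo l)) + 1.
  have -> : mxval (p n).2 = mxval (geo l) + (mxval (p n).2 - mxval (geo l)).
    by rewrite addrC subrK.
  apply: le_trans (nrmD _ _) _; rewrite lerD2l (le_trans (ltW nke))//.
  by rewrite ge_min lexx.
have e2 : e * (2 * M) <= eta.
  by rewrite -ler_pdivlMr ?mulr_gt0// ge_min lexx orbT.
have n1 := nrm_ge0 (mxval (p n).1 - mxval w); have n2 := nrm_ge0 (mxval (p n).2).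
have n3 := nrm_ge0 (mxval (p n).2 - mxval (geo l)).
have b1' : nrm (mxval (p n).1 - mxval w) * nrm (mxval (p n).2) <= e * M.
  by apply: ler_pM => //; [exact: ltW|rewrite /M; lra].
have b2' : nrm (mxval w) * nrm (mxval (p n).2 - mxval (geo l)) <= e * (nrm (mxval w)).
  by rewrite mulrC ler_wpM2r// ltW.
have : e * nrm (mxval w) < e * M by rewrite ltr_pM2l// /M; lra.
lra.
Qed.

End Minimal.
End MinimalSets.

(** * Invariance of minimal sets under the geodesic flow *)

Section MinimalGeodesic.
Variables (R : realType) (Gamma : groupClosed (PSL2 R)).
Hypotheses (Hd : discrete_subgroup Gamma) (Hc : cocompact Gamma).
Implicit Types (g h k : SL2 R).

Lemma nrm_geo_sub (l m : R) : `|m - l| <= 1 / 2 ->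
  nrm (mxval (geo m) - mxval (geo l)) <= 2 * `|m - l| * (expR l + expR (- l)).
Proof.
move=> ml; rewrite nrmBE !geoE !subrr normr0 !addr0.
have E (a b : R) : `|a - b| <= 1 / 2 -> `|expR a - expR b| <= 2 * `|a - b| * expR b.
  move=> ab; have -> : expR a - expR b = (expR (a - b) - 1) * expR b.
    by rewrite mulrBl -expRD subrK mul1r.
  by rewrite normrM (ger0_norm (expR_ge0 _)) ler_wpM2r ?expR_ge0// expR_sub1_le.
rewrite mulrDr lerD ?E//.
have mlN : `|- m - - l| = `|m - l| by rewrite (_ : - m - - l = - (m - l)) ?normrN//; ring.
by rewrite -mlN; apply: E; rewrite mlN.
Qed.

Lemma upper_triangular_decomposition k : mxval k 1 0 = 0 -> 0 < mxval k 0 0 ->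
  exists l b, k = (geo l * upper b)%g.
Proof.
move=> c0 a0; have D := SL2_det k; rewrite c0 mulr0 subr0 in D.
have aE : mxval k 0 0 = expR (ln (mxval k 0 0)) by rewrite lnK.
have dE : mxval k 1 1 = expR (- ln (mxval k 0 0)).
  by rewrite expRN -aE; apply: (mulfI (lt0r_neq0 a0)); rewrite D mulfV// lt0r_neq0.
exists (ln (mxval k 0 0)), (mxval k 0 1 / mxval k 0 0).
apply: SL2P; rewrite SL2_mulE !geoE !upperE -?aE ?c0 ?dE; try ring.
by field; rewrite gt_eqF.
Qed.

(* If yk is in Y with k close to 1 but off the horocycle, then sliding both
   points along their orbits (polynomial divergence) produces two points of Y
   differing by almost [geo l]; when k normalises the flow, powers of its
   diagonal part do the same. *)
Lemma minimal_geo (Y : set (SL2 R)) l : horocycle_minimal Gamma Y ->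
  forall g, Y g -> Y (g * geo l)%g.
Proof.
move=> minY; apply: (minimal_geo_of minY).
apply: (minimal_geo_approx Hc minY) => eta eta0.
pose M := expR l + expR (- l).
have M0 : 0 < M by rewrite addr_gt0 ?expR_gt0.
(* The second bound serves when k10 <> 0. Otherwise 1/4 makes |h| <= 2 dev k small enough for
   [nrm_geo_sub], and the third bound keeps its error 4 (dev k) M below eta / 2. *)
pose e := Num.min (1 / 4) (Num.min eta (eta / (8 * M))).
have e0 : 0 < e by rewrite !lt_min eta0 !divr_gt0// mulr_gt0.
have [g [k [Yg Ygk ke kU]]] := minimal_return Hd Hc minY e0.
move: ke; rewrite !lt_min => /andP[k4 /andP[keta kM]].
have entry i j : `|mxval k i j - mxval (1%g : SL2 R) i j| <= dev k.
  by have := nrm_entry (mxval k - mxval (1%g : SL2 R)) i j; rewrite !mxE.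
have [c0|c0] := eqVneq (mxval k 1 0) 0; last first.
  (* [r] makes the bottom right entry exp (-l) and [s] then kills the top right one. Determinant 1
     forces exp l at the top left, so the result differs from [geo l] only by the bottom left entry
     of k. *)
  pose r := (expR (- l) - mxval k 1 1) / mxval k 1 0.
  pose s := (mxval k 0 0 * r + mxval k 0 1) * expR l.
  exists (g * upper s)%g, (upper (- s) * k * upper r)%g.
  split; first exact: (minimal_upper minY).
    by rewrite -!mulgA (mulgA (upper s)) -upperD subrr upper0 mul1g mulgA;
      exact: (minimal_upper minY).
  have EE : expR l * expR (- l) = 1 by rewrite -expRD subrr expR0.
  have K11 : mxval k 1 0 * r + mxval k 1 1 = expR (- l).
    by rewrite /r mulrC divfK// subrK.
  have D := SL2_det k.
  rewrite nrmBE !SL2_mulE !geoE !upperE.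
  rewrite (_ : _ - expR l = 0); last first.
    apply/eqP; rewrite subr_eq0; apply/eqP.
    rewrite -[RHS]mulr1 -[X in _ = _ * X]D.
    have -> : mxval k 1 1 = expR (- l) - mxval k 1 0 * r by rewrite -K11; ring.
    rewrite /s !mul1r !mulr0 !mulr1 !addr0.
    transitivity (mxval k 0 0 * (expR l * expR (- l)) -
      (mxval k 0 0 * r + mxval k 0 1) * expR l * mxval k 1 0); last by ring.
    by rewrite EE; ring.
  rewrite (_ : (_ + _) * r + _ - 0 = 0); last first.
    transitivity (mxval k 0 0 * r + mxval k 0 1 - s * (mxval k 1 0 * r + mxval k 1 1)).
      by ring.
    by rewrite K11 /s -mulrA EE; ring.
  rewrite (_ : (0 * _ + 1 * _) * r + _ - _ = 0); last by rewrite -K11; ring.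
  rewrite normr0 !(add0r, addr0, mul0r, mulr0, mul1r, mulr1, subr0).
  apply: le_lt_trans keta; have := entry 1 0; by rewrite SL2_oneE subr0.
have a0 : 0 < mxval k 0 0.
  have := entry 0 0; rewrite SL2_oneE ler_norml => /andP[+ _]; lra.
have [h [b kE]] := upper_triangular_decomposition c0 a0.
have aE : mxval k 0 0 = expR h by rewrite kE SL2_mulE !geoE !upperE; ring.
have dE : mxval k 1 1 = expR (- h) by rewrite kE SL2_mulE !geoE !upperE; ring.
have h0 : h != 0.
  by apply/negP => /eqP h0; apply: (kU b); rewrite kE h0 geo0 mul1g.
have Yh : forall g, Y g -> Y (g * geo h)%g.
  apply: (minimal_geo_of minY); exists g => //.
  rewrite (_ : (g * geo h = g * k * upper (- b))%g); last first.
    by rewrite {1}kE -!mulgA -upperD subrr upper0 mulg1.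
  exact: (minimal_upper minY).
have YNh : forall g, Y g -> Y (g * geo (- h))%g.
  apply: (minimal_geo_of minY); exists (g * geo h)%g; first exact: Yh.
  by rewrite -mulgA -geoD subrr geo0 mulg1.
have he : `|h| <= 2 * dev k.
  have A1 : `|expR h - 1| <= dev k by rewrite -aE; have := entry 0 0; rewrite SL2_oneE.
  have A2 : `|expR (- h) - 1| <= dev k by rewrite -dE; have := entry 1 1; rewrite SL2_oneE.
  have B1 := expR_ge1Dx h; have B2 := expR_ge1Dx (- h); have := dev_ge0 k.
  move: A1 A2; rewrite !ler_norml => /andP[_ A1] /andP[_ A2] k0.
  by apply/andP; split; lra.
(* With the sign of l, some natural multiple of [h'] lies within |h| of l. *)
have [h' [h'0 h'E Yh']] : exists h' : R, [/\ h' * l >= 0 /\ h' != 0, `|h'| = `|h| &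
    forall g, Y g -> Y (g * geo h')%g].
  have [hl|hl] := leP 0 (h * l); first by exists h.
  exists (- h); split => //; last by rewrite normrN.
  by rewrite mulNr oppr_ge0 ltW// oppr_eq0.
have Ym (m : nat) : forall g, Y g -> Y (g * geo (m%:R * h'))%g.
  elim: m => [|m IH] u Yu; first by rewrite mul0r geo0 mulg1.
  by rewrite -natr1 mulrDl mul1r geoD mulgA; apply: Yh'; exact: IH.
have [h'l h'n] := h'0.
pose q := l / h'.
have q0 : 0 <= q.
  have -> : q = h' * l / h' ^+ 2 by rewrite /q; field.
  by rewrite divr_ge0 ?sqr_ge0.
have lE : l = q * h' by rewrite /q divfK.
pose m := Num.trunc q.
have [mq1 mq2] : m%:R <= q /\ q < m%:R + 1.
  have /andP[? ?] := truncn_itv q0; split => //; by rewrite natr1.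
have ml : `|m%:R * h' - l| <= `|h|.
  rewrite lE -mulrBl normrM h'E -[leRHS]mul1r ler_wpM2r// ler_norml.
  by apply/andP; split; lra.
exists g, (geo (m%:R * h')); split => //; first exact: Ym.
have ml2 : `|m%:R * h' - l| <= 2 * dev k by exact: le_trans he.
apply: le_lt_trans (nrm_geo_sub _) _; first by lra.
rewrite -/M; apply: (@le_lt_trans _ _ (4 * dev k * M)).
  by rewrite ler_wpM2r ?(ltW M0)//; lra.
move: kM; rewrite ltr_pdivlMr ?mulr_gt0//.
have := mulr_ge0 (dev_ge0 k) (ltW M0); lra.
Qed.

End MinimalGeodesic.

(** * Time changes *)

Section TimeChange.
Variables (R : realType) (Gamma : groupClosed (PSL2 R)).
Hypotheses (Hd : discrete_subgroup Gamma) (Hc : cocompact Gamma).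
Implicit Types (g h k : SL2 R) (p : T1surface Gamma).

Variable phi : R -> T1surface Gamma -> T1surface Gamma.

(* [s p t] is the horocycle time elapsed after [phi]-time [t], and [r p] is the
   inverse reparametrisation. *)
Definition reparametrisation (s r : T1surface Gamma -> R -> R) : Prop := forall p,
  [/\ {homo s p : x y / x < y}, s p 0 = 0, (forall t, phi t p = horocycle (s p t) p) &
      [/\ cancel (s p) (r p), cancel (r p) (s p), continuous (s p) & continuous (r p)]].

Lemma time_change_reparametrisation : time_change phi (@horocycle R Gamma) ->
  exists s r, reparametrisation s r.
Proof.
move=> tc.
have H p : exists sr : (R -> R) * (R -> R), [/\ {homo sr.1 : x y / x < y}, sr.1 0 = 0,
    (forall t, phi t p = horocycle (sr.1 t) p) &
    [/\ cancel sr.1 sr.2, cancel sr.2 sr.1, continuous sr.1 & continuous sr.2]].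
  by have [s [[sh [r [sr rs cs cr]]] repar0 sE]] := tc p; exists (s, r).
have [sr srP] := choice H.
by exists (fun p => (sr p).1), (fun p => (sr p).2).
Qed.

Hypothesis Hphi : continuous_flow (@sasaki_dist R Gamma) phi.
Variables (s r : T1surface Gamma -> R -> R).
Hypothesis sr : reparametrisation s r.

Lemma repar_lt p : {homo s p : x y / x < y}. Proof. by case: (sr p). Qed.
Lemma repar0 p : s p 0 = 0. Proof. by case: (sr p). Qed.
Lemma repar_flowE p t : phi t p = horocycle (s p t) p. Proof. by case: (sr p). Qed.
Lemma reparK p : cancel (s p) (r p). Proof. by case: (sr p) => _ _ _ []. Qed.
Lemma repar_invK p : cancel (r p) (s p). Proof. by case: (sr p) => _ _ _ []. Qed.
Lemma repar_time_continuous p : continuous (s p). Proof. by case: (sr p) => _ _ _ []. Qed.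

Lemma repar_ltE p : {mono s p : x y / x < y}.
Proof.
move=> x y; have [xy|yx|->] := ltrgtP x y; last by rewrite ltxx.
  exact: repar_lt.
by apply/negbTE; rewrite -leNgt ltW// repar_lt.
Qed.
Lemma repar_inv_ltE p : {mono r p : x y / x < y}.
Proof. by move=> x y; rewrite -(repar_ltE p) !repar_invK. Qed.
Lemma repar_inv_leE p : {mono r p : x y / x <= y}.
Proof. by move=> x y; rewrite !leNgt repar_inv_ltE. Qed.
Lemma repar_inv0 p : r p 0 = 0. Proof. by rewrite -[X in r p X](repar0 p) reparK. Qed.

Lemma flow_repar_inv p a : phi (r p a) p = horocycle a p.
Proof. by rewrite repar_flowE repar_invK. Qed.

(** Horocycle orbits are injective, so horocycle time is determined by the point reached and the
    flow law of phi becomes additive. *)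
Lemma repar_cocycle p t u : s p (t + u) = s p t + s (phi t p) u.
Proof.
have [_ phiD _] := Hphi.
apply: (@horocycle_inj _ _ Hd Hc p); rewrite /= -repar_flowE addrC phiD [in RHS]addrC horocycleD.
by rewrite -!repar_flowE.
Qed.

Lemma repar_inv_cocycle p a b : r p (a + b) = r p a + r (horocycle a p) b.
Proof.
by apply: (can_inj (reparK p)); rewrite repar_invK repar_cocycle repar_invK flow_repar_inv repar_invK.
Qed.

(** Continuity of the flow at each time, made uniform on [0, T] by compactness. The lattice element
    may vary with t; [tracking] removes it afterwards. *)
Lemma phi_near_path g (T e : R) : 0 <= T -> 0 < e ->
  exists2 eta : R, 0 < eta & forall h, nrm (mxval h - mxval g) < eta ->
    forall t, 0 <= t <= T -> exists2 k, lat Gamma k &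
     dev (upper (- s (pt Gamma g) t) * (g^-1 * k * h) * upper (s (pt Gamma h) t))%g < e.
Proof.
move=> T0 e0; pose x := pt Gamma g.
pose P (eta t : R) := forall h, nrm (mxval h - mxval g) < eta -> exists2 k, lat Gamma k &
     dev (upper (- s x t) * (g^-1 * k * h) * upper (s (pt Gamma h) t))%g < e.
have e40 : 0 < Num.min 1 (e / 3) by rewrite lt_min ltr01 divr_gt0.
have [d1 d10 d1P] := sasaki_dist_dev Gamma e40.
set e4 := Num.min 1 _ in e40 d1P.
have e41 : e4 <= 1 by rewrite ge_min lexx.
have e4e : e4 <= e / 3 by rewrite ge_min lexx orbT.
have [_ _ phic] := Hphi.
have /compact_near_coveringP cpt := @segment_compact R 0 T.
have [] := cpt R (0 : R)^'+ P _ _.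
  move=> t _; have [d2 d20 d2P] := phic t x d1 d10.
  have [eta eta0 etaP] := sasaki_dist_near Gamma g d20.
  exists (ball t d2, [set z : R | z < eta]) => /=.
    by split; [exact: nbhsx_ballx|exact: nbhs_right_lt].
  move=> [t' z] /= [tt' z_lt] h hz.
  have tt2 : `|t' - t| < d2 by rewrite distrC.
  have H y : sasaki_dist x y < d2 -> sasaki_dist (phi t x) (phi t' y) < d1 by exact: d2P.
  have := H x (le_lt_trans (sasaki_dist_self x) d20).
  have := H (pt Gamma h) (etaP h (lt_trans hz z_lt)).
  rewrite !repar_flowE !horocycle_pt => /d1P[k2 k2L k2d] /d1P[k1 k1L k1d].
  (* [k1] links x at time t to x at time t', and [k2] links x at time t to the point of h at time
     t'; the quotient compares both at t'. *)
  exists (k1^-1 * k2)%g; first by apply: latM => //; exact: latV.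
  set A := ((g * upper (s x t))^-1 * k1 * (g * upper (s x t')))%g in k1d.
  set B := ((g * upper (s x t))^-1 * k2 * (h * upper (s (pt Gamma h) t')))%g in k2d.
  have -> : (upper (- s x t') * (g^-1 * (k1^-1 * k2) * h) * upper (s (pt Gamma h) t') =
    A^-1 * B)%g.
    by rewrite /A /B !invgM !invgK !mulgA upperN !mulgK.
  rewrite -(ltrD2l 1); apply: le_lt_trans (devM _ _) _; rewrite devV.
  apply: (@lt_le_trans _ _ ((1 + e4) * (1 + e4))).
    by rewrite ltr_pM ?addr_ge0 ?dev_ge0// ltrD2l.
  by nra.
move=> /= z z0 zP; exists (z / 2); first by rewrite divr_gt0.
move=> h hz t tT.
have z2 : 0 < z / 2 by rewrite divr_gt0.
apply: (zP (z / 2)) => //=.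
by have z0' : 0 < z by []; rewrite /ball_ /= sub0r normrN gtr0_norm//; lra.
Qed.

(** [tracking] puts u(-S) k u(S') near 1, where k is near 1, and this forces S' near S. *)
Lemma repar_continuous g (t e : R) : 0 <= t -> 0 < e -> exists2 eta : R, 0 < eta &
  forall h, nrm (mxval h - mxval g) < eta -> `|s (pt Gamma h) t - s (pt Gamma g) t| < e.
Proof.
move=> t0 e0; pose S := s (pt Gamma g) t.
have [b b0 track] := tracking Hd Hc.
pose e1 := Num.min (b / 2) (Num.min (1 / 2) (e / (8 * (1 + `|S|)))).
have S0 : 0 < 1 + `|S| by rewrite ltr_pwDl.
have e10 : 0 < e1 by rewrite !lt_min !divr_gt0// mulr_gt0.
have e1b : e1 < b.
  by apply: (@le_lt_trans _ _ (b / 2)); [rewrite ge_min lexx|lra].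
have e12 : e1 <= 1 / 2 by rewrite !ge_min lexx orbT.
have e1e : e1 * (8 * (1 + `|S|)) <= e.
  by rewrite -ler_pdivlMr ?mulr_gt0// !ge_min lexx !orbT.
have [eta eta0 etaP] := phi_near_path g t0 e10.
have g1 : 0 < nrm (mxval g) + 1 by rewrite ltr_wpDl ?nrm_ge0.
exists (Num.min eta (e1 / (nrm (mxval g) + 1))); first by rewrite lt_min eta0 divr_gt0.
move=> h; rewrite lt_min => /andP[/etaP H hg].
have dk : dev (g^-1 * h)%g < e1.
  apply: le_lt_trans (dev_mulV _ _) _.
  move: hg; rewrite ltr_pdivlMr// mulrC => /(le_lt_trans _); apply.
  by rewrite ler_wpM2r ?nrm_ge0// lerDl.
have := track e1 g h (s (pt Gamma g)) (s (pt Gamma h)) t e1b (@repar_time_continuous _) (@repar_time_continuous _) t0 _ H.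
rewrite !repar0 oppr0 upper0 mul1g mulg1 => /(_ dk); rewrite -/S.
set S' := s (pt Gamma h) t; move: (g^-1 * h)%g dk => k dk.
rewrite !devE !SL2_mulE !upperE in dk *.
rewrite !(mul0r, mul1r, mulr0, mulr1, add0r, addr0).
set k00 := mxval k 0 0 + _; set k01 := _ * S' + _; set k11 := _ * S' + _ => dK.
have n1 := normr_ge0 (k00 - 1); have n2 := normr_ge0 k01.
have n3 := normr_ge0 (mxval k 1 0); have n4 := normr_ge0 (k11 - 1).
have m1 := normr_ge0 (mxval k 0 0 - 1); have m2 := normr_ge0 (mxval k 0 1).
have m4 := normr_ge0 (mxval k 1 1 - 1).
have K00 : `|k00 - 1| <= e1 by lra.
have K01 : `|k01| <= e1 by lra.
have kb : `|mxval k 0 1| <= e1 by lra.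
have kd : `|mxval k 1 1 - 1| <= e1 by lra.
(* The top right entry [k01] solved for S' - S. The last term is absorbed since |k00 - 1| <= 1/2,
   and the others total at most 2 e1 (1 + |S|) <= e / 4. *)
have E : S' - S = k01 - mxval k 0 1 + S * (mxval k 1 1 - 1) - (k00 - 1) * S - (k00 - 1) * (S' - S).
  by rewrite /k01 /k00; ring.
have B1 : `|S * (mxval k 1 1 - 1)| <= `|S| * e1 by rewrite normrM ler_wpM2l.
have B2 : `|(k00 - 1) * S| <= e1 * `|S| by rewrite normrM ler_wpM2r.
have B3 : `|(k00 - 1) * (S' - S)| <= 1 / 2 * `|S' - S|.
  by rewrite normrM ler_wpM2r// (le_trans K00).
have T5 (u v w x y : R) : `|u - v + w - x - y| <= `|u| + `|v| + `|w| + `|x| + `|y|.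
  have := ler_normB (u - v + w - x) y; have := ler_normB (u - v + w) x.
  by have := ler_normD (u - v) w; have := ler_normB u v; lra.
have : `|S' - S| <= `|k01| + `|mxval k 0 1| + `|S * (mxval k 1 1 - 1)| +
   `|(k00 - 1) * S| + `|(k00 - 1) * (S' - S)|.
  by rewrite {1}E; exact: T5.
have := normr_ge0 S; nra.
Qed.

(** By monotonicity it is enough that [s] separates a at the two times t - e1 and t + e1. Taking e1
    < t keeps these nonnegative, as [repar_continuous] requires. *)
Lemma repar_inv_continuous g (a e : R) : 0 <= a -> 0 < e -> exists2 eta : R, 0 < eta &
  forall h, nrm (mxval h - mxval g) < eta -> `|r (pt Gamma h) a - r (pt Gamma g) a| < e.
Proof.
rewrite le_eqVlt => /orP[/eqP <- e0|a0 e0].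
  by exists 1 => // h _; rewrite !repar_inv0 subrr normr0.
pose t := r (pt Gamma g) a.
have t0 : 0 < t by rewrite -(repar_inv0 (pt Gamma g)) repar_inv_ltE.
pose e1 := Num.min (e / 2) (t / 2).
have e10 : 0 < e1 by rewrite lt_min !divr_gt0.
have e1e : e1 < e by apply: (@le_lt_trans _ _ (e / 2)); [rewrite ge_min lexx|lra].
have e1t : e1 < t by apply: (@le_lt_trans _ _ (t / 2)); [rewrite ge_min lexx orbT|lra].
pose x := pt Gamma g.
have lo : s x (t - e1) < a by rewrite -(repar_invK x a) repar_ltE -/x -/t; lra.
have hi : a < s x (t + e1) by rewrite -[ltLHS](repar_invK x a) repar_ltE -/x -/t; lra.
have lo' : 0 < a - s x (t - e1) by rewrite subr_gt0.
have hi' : 0 < s x (t + e1) - a by rewrite subr_gt0.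
have [|n1 n10 N1] := @repar_continuous g (t - e1) (a - s x (t - e1)) _ lo'; first lra.
have [|n2 n20 N2] := @repar_continuous g (t + e1) (s x (t + e1) - a) _ hi'; first lra.
exists (Num.min n1 n2); first by rewrite lt_min n10.
move=> h; rewrite lt_min => /andP[/N1 + /N2]; rewrite -/x.
rewrite !ltr_norml => /andP[_ h1] /andP[h2 _].
have : t - e1 < r (pt Gamma h) a by rewrite -(repar_ltE (pt Gamma h)) repar_invK; lra.
have : r (pt Gamma h) a < t + e1 by rewrite -(repar_ltE (pt Gamma h)) repar_invK; lra.
rewrite -/t => *; apply/andP; split; lra.
Qed.

End TimeChange.

(** * Bounded defects and expansiveness *)

Section Expansiveness.
Variables (R : realType) (Gamma : groupClosed (PSL2 R)).
Hypotheses (Hd : discrete_subgroup Gamma) (Hc : cocompact Gamma).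
Implicit Types (g h k : SL2 R) (p : T1surface Gamma).

Definition orbit_continuous (f : T1surface Gamma -> R) : Prop :=
  forall g (e : R), 0 < e -> exists2 eta : R, 0 < eta & forall h,
    nrm (mxval h - mxval g) < eta -> `|f (pt Gamma h) - f (pt Gamma g)| < e.

Lemma orbit_continuous_lower_bound f : orbit_continuous f -> (forall p, 0 < f p) ->
  exists2 c : R, 0 < c & forall p, c <= f p.
Proof.
move=> cf f0.
have [m n p mn H|g|n nP] := @compactness_principle R Gamma Hc (fun n p => n.+1%:R^-1 <= f p).
- by apply: le_trans H; rewrite lef_pV2 ?posrE ?ltr0n// ler_nat.
- have v0 := f0 (pt Gamma g).
  have [|eta eta0 etaP] := cf g (f (pt Gamma g) / 2); first by rewrite divr_gt0.
  exists eta => //; exists (Num.trunc (f (pt Gamma g) / 2)^-1) => h /etaP.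
  rewrite ltr_norml => /andP[H _].
  apply: (@le_trans _ _ (f (pt Gamma g) / 2)); last by lra.
  rewrite -[leRHS]invrK lef_pV2 ?posrE ?invr_gt0 ?divr_gt0 ?ltr0n//.
  exact/ltW/truncnS_gt.
by exists n.+1%:R^-1 => //; rewrite invr_gt0.
Qed.

Lemma orbit_continuous_bounded f : orbit_continuous f -> exists C : R, forall p, f p <= C.
Proof.
move=> cf.
have [m n p mn H|g|n nP] := @compactness_principle R Gamma Hc (fun n p => f p <= n%:R).
- by apply: le_trans H _; rewrite ler_nat.
- have [eta eta0 etaP] := cf g 1 ltr01.
  exists eta => //; exists (Num.trunc (f (pt Gamma g) + 1)).+1 => h /etaP.
  rewrite ltr_norml => /andP[_ H]; apply: ltW.
  by apply: lt_trans (truncnS_gt _); lra.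
by exists n%:R.
Qed.

Variable phi : R -> T1surface Gamma -> T1surface Gamma.
Hypothesis Hphi : continuous_flow (@sasaki_dist R Gamma) phi.
Variables (s r : T1surface Gamma -> R -> R).
Hypothesis sr : reparametrisation phi s r.

Let r_mono p := repar_inv_leE sr p.
Let rD p a b := repar_inv_cocycle Hd Hc Hphi sr p a b.

Let r_unit_bounds : exists c C : R, [/\ 0 < c, forall p, c <= r p 1 & forall p, r p 1 <= C].
Proof.
have cr : orbit_continuous (fun p => r p 1).
  by move=> g e e0; exact: (repar_inv_continuous Hd Hc Hphi sr g ler01 e0).
have [|c c0 cP] := orbit_continuous_lower_bound cr.
  by move=> p; rewrite -(repar_inv0 sr p) (repar_inv_ltE sr).
by have [C CP] := orbit_continuous_bounded cr; exists c, C.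
Qed.

(** The cocycle identity sums the whole unit steps; the incomplete step costs the -1. *)
Let r_linear_growth (c : R) p (a : R) : 0 < c -> (forall p, c <= r p 1) -> 0 <= a ->
  c * (a - 1) <= r p a.
Proof.
move=> c0 cP a0.
have H (n : nat) q : c * n%:R <= r q n%:R.
  elim: n q => [|n IH] q; first by rewrite mulr0 (repar_inv0 sr).
  by rewrite -natr1 addrC rD mulrDr mulr1 lerD.
have /andP[t1 t2] := truncn_itv a0; rewrite -natr1 in t2.
apply: (@le_trans _ _ (c * (Num.trunc a)%:R)); first by rewrite ler_wpM2l ?(ltW c0)//; lra.
by apply: le_trans (H _ p) _; rewrite r_mono.
Qed.

Lemma horocycle_time_diff (C : R) p (a b : R) : (forall p, r p 1 <= C) -> `|a - b| <= 1 ->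
  `|r p a - r p b| <= C.
Proof.
move=> CP; wlog ab : a b / b <= a.
  move=> H; have [/H//|/ltW/H] := leP b a.
  by rewrite distrC [X in _ -> _ -> X <= _]distrC.
rewrite !ger0_norm ?subr_ge0 ?r_mono// => ab1.
have -> : r p a = r p b + r (horocycle b p) (a - b) by rewrite -rD addrC subrK.
by rewrite addrC addKr (le_trans _ (CP (horocycle b p)))// r_mono.
Qed.

(** The phi-time of a horocycle segment minus that of its image under the geodesic flow, which is
    exp (-2l) times as long. In t it is an additive cocycle over the horocycle flow. *)
Definition defect l g t := r (pt Gamma g) t - r (pt Gamma (g * geo l)%g) (t * expR (- 2 * l)).

Let defect0 l g : defect l g 0 = 0. Proof. by rewrite /defect mul0r !(repar_inv0 sr) subrr. Qed.

Let defectD l g a t : defect l g (a + t) = defect l g a + defect l (g * upper a)%g t.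
Proof.
rewrite /defect mulrDl !rD !horocycle_pt -[(g * geo l * _)%g]mulgA -upper_geo mulgA.
by ring.
Qed.

Let defect_continuous l g (t e : R) : 0 <= t -> 0 < e -> exists2 eta : R, 0 < eta &
  forall h, nrm (mxval h - mxval g) < eta -> `|defect l h t - defect l g t| < e.
Proof.
move=> t0 e0; have e20 : 0 < e / 2 by rewrite divr_gt0.
have [n1 n10 N1] := repar_inv_continuous Hd Hc Hphi sr g t0 e20.
have t0' : 0 <= t * expR (- 2 * l) by rewrite mulr_ge0 ?expR_ge0.
have [n2 n20 N2] := repar_inv_continuous Hd Hc Hphi sr (g * geo l)%g t0' e20.
have k0 : 0 < nrm (mxval (geo l)) + 1 by rewrite ltr_wpDl ?nrm_ge0.
exists (Num.min n1 (n2 / (nrm (mxval (geo l)) + 1))); first by rewrite lt_min n10 divr_gt0.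
move=> h; rewrite lt_min => /andP[/N1 h1 hg].
have /N2 h2 : nrm (mxval (h * geo l)%g - mxval (g * geo l)%g) < n2.
  rewrite !mxvalM -mulmxBl; apply: le_lt_trans (nrmM _ _) _.
  move: hg; rewrite ltr_pdivlMr// => /(le_lt_trans _); apply.
  by rewrite ler_wpM2l ?nrm_ge0// lerDl.
rewrite /defect (_ : _ - _ = (r (pt Gamma h) t - r (pt Gamma g) t) -
  (r (pt Gamma (h * geo l)%g) (t * expR (- 2 * l)) -
   r (pt Gamma (g * geo l)%g) (t * expR (- 2 * l)))); last by ring.
by apply: le_lt_trans (ler_normB _ _) _; rewrite [ltRHS](splitr e) ltrD.
Qed.

(* If the defect were bounded on a minimal set, iterating [geo l] would compare the
   phi-time of a horocycle segment of length expR (2 l n) with that of a unit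
   segment up to an error linear in n. *)
Lemma bounded_defect_eq0 l g (C : R) : (forall t, 0 <= t -> `|defect l g t| <= C) -> l = 0.
Proof.
move=> FC; apply/eqP; apply: contrapT => /negP l0.
(* Bounding differences of defects makes B forward invariant: the cocycle term of the elapsed
   segment cancels. Taking u = 0 recovers a bound on the defect itself. *)
pose B := [set h | forall t u, 0 <= t -> 0 <= u -> `|defect l h t - defect l h u| <= 2 * C].
have invB : horocycle_invariant Gamma B.
  split.
  - exists g => t u t0 u0; apply: le_trans (ler_normB _ _) _.
    by have := FC t t0; have := FC u u0; lra.
  - move=> h hadh t u t0 u0; apply/ler_addgt0Pr => e e0.
    have e20 : 0 < e / 2 by rewrite divr_gt0.
    have [n1 n10 N1] := defect_continuous l h t0 e20.
    have [n2 n20 N2] := defect_continuous l h u0 e20.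
    have [|h' Bh'] := hadh (Num.min n1 n2); first by rewrite lt_min n10.
    rewrite lt_min => /andP[/N1 + /N2].
    have := Bh' t u t0 u0; rewrite !ler_norml !ltr_norml.
    move=> /andP[b1 b2] /andP[b3 b4] /andP[b5 b6]; apply/andP; split; lra.
  - move=> k h kL Bh t u t0 u0; rewrite /defect -!mulgA !(pt_lat _ kL).
    exact: Bh.
  - move=> a h a0 Bh t u t0 u0.
    have := Bh (a + t) (a + u) (addr_ge0 a0 t0) (addr_ge0 a0 u0).
    by rewrite !defectD opprD addrACA subrr add0r.
have [Y YB minY] := exists_minimal Hc invB.
have geoY m h : Y h -> Y (h * geo m)%g by exact: (minimal_geo Hd Hc m minY).
have FY h t : Y h -> 0 <= t -> `|defect l h t| <= 2 * C.
  by move=> /YB Bh t0; have := Bh t 0 t0 (lexx 0); rewrite defect0 subr0.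
(* For l < 0 the defect is read backwards from h (geo (-l)), which is in Y by geodesic invariance,
   so that iteration always shortens the segment. *)
have step h t : Y h -> 0 <= t -> r (pt Gamma h) t <=
    2 * C + r (pt Gamma (h * geo `|l|)%g) (t * expR (- 2 * `|l|)).
  move=> Yh t0; case: (leP 0 l) => hl.
    rewrite ger0_norm//; have := FY h t Yh t0; rewrite /defect ler_norml => /andP[_]; lra.
  rewrite ltr0_norm//.
  have := FY (h * geo (- l))%g (t * expR (2 * l)) (geoY _ _ Yh) _.
  rewrite /defect -mulgA -geoD addNr geo0 mulg1 -mulrA -expRD.
  rewrite (_ : 2 * l + - 2 * l = 0); last by ring.
  rewrite expR0 mulr1 mulr_ge0 ?expR_ge0// (_ : - 2 * - l = 2 * l); last by ring.
  by move=> /(_ isT); rewrite ler_norml => /andP[+ _]; lra.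
have [c [C1 [c0 cP CP]]] := r_unit_bounds.
pose E := expR (2 * `|l|).
have E0 : 0 < E := expR_gt0 _.
have iter n h : Y h -> r (pt Gamma h) (E ^+ n) <= n%:R * (2 * C) + C1.
  elim: n h => [|n IH] h Yh; first by rewrite expr0 mul0r add0r.
  apply: le_trans (step h _ Yh _) _; first by rewrite exprn_ge0 ?ltW.
  have -> : E ^+ n.+1 * expR (- 2 * `|l|) = E ^+ n.
    rewrite exprS mulrAC -expRD (_ : 2 * `|l| + - 2 * `|l| = 0); last by ring.
    by rewrite expR0 mul1r.
  by have := IH _ (geoY `|l| _ Yh); rewrite -natr1; lra.
have [[[y Yy] _ _ _] _] := minY.
pose d := E - 1.
have d0 : 0 < d by rewrite subr_gt0 expR_gt1 mulr_gt0 ?normr_gt0.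
have bern (m : nat) : 1 + m%:R * d <= E ^+ m.
  elim: m => [|m IH]; first by rewrite mul0r addr0 expr0.
  rewrite exprS -natr1 (_ : E = 1 + d); last by rewrite /d addrC subrK.
  rewrite (_ : E = 1 + d) in IH; last by rewrite /d addrC subrK.
  have m0 := ler0n R m; have := mulr_ge0 m0 (ltW d0).
  have := ler_wpM2l (addr_ge0 ler01 (ltW d0)) IH; nra.
(* Bernoulli's inequality alone gives linear growth, which cannot beat a linear bound; the exponent
   m + m makes it quadratic. *)
have grow (m : nat) : c * ((m%:R * d) ^+ 2 - 1) <= 2 * m%:R * (2 * C) + C1.
  have := iter (m + m)%N y Yy; have := r_linear_growth (pt Gamma y) c0 cP
    (exprn_ge0 (m + m) (ltW E0)).
  have : (m%:R * d) ^+ 2 <= E ^+ (m + m).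
    rewrite exprD -expr2 lerXn2r ?nnegrE ?exprn_ge0 ?(ltW E0) ?mulr_ge0 ?(ltW d0)//.
    by apply: le_trans (bern m); rewrite lerDr.
  by move=> /(ler_wpM2l (ltW c0)); rewrite natrD !mulrBr; lra.
(* For m >= 1 the right side of [grow], plus c, is at most m M. *)
pose M := 4 * `|C| + `|C1| + c.
have M0 : 0 < M by rewrite /M ltr_wpDl// addr_ge0// mulr_ge0.
have cd : 0 < c * d ^+ 2 by rewrite mulr_gt0// exprn_gt0.
pose m := (Num.trunc (M / (c * d ^+ 2))).+1.
have mM : M < m%:R * (c * d ^+ 2) by rewrite -ltr_pdivrMr// truncnS_gt.
have m1 : 1 <= m%:R :> R by rewrite ler1n.
have := grow m; have := ler_norm C; have := ler_norm C1.
have C0 := normr_ge0 C; have C10 := normr_ge0 C1.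
move: mM m1; rewrite /M; move: (m%:R : R) => x mM m1 a1 a2 a3.
have : x * (4 * `|C| + `|C1| + c) < x * (x * (c * d ^+ 2)) by rewrite ltr_pM2l//; lra.
have : 2 * x * (2 * C) + C1 + c <= x * (4 * `|C| + `|C1| + c) by nra.
have -> : x * (x * (c * d ^+ 2)) = c * (x * d) ^+ 2 by ring.
rewrite mulrBr mulr1 in a3; lra.
Qed.

End Expansiveness.

Theorem theorem3p9 (R : realType) (Gamma : groupClosed (PSL2 R)) :
  discrete_subgroup Gamma -> acts_freely Gamma -> cocompact Gamma ->
  positive_strong_kinematic_expansive (@sasaki_dist R Gamma)
    (@horocycle R Gamma).
Proof.
move=> Hd _ Hc phi Hphi /time_change_reparametrisation[s [r sr]] e e0.
have e20 : 0 < e / 2 by rewrite divr_gt0.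
have cs : orbit_continuous (fun p => s p (e / 2)).
  by move=> g d d0; exact: (repar_continuous Hd Hc Hphi sr g (ltW e20) d0).
(* Phi-time e / 2 covers horocycle time at least [c] from every point; at the end this turns |beta|
   < c into a phi-time below e / 2. *)
have [|c c0 cP] := orbit_continuous_lower_bound Hc cs.
  by move=> p; rewrite -(repar0 sr p) (repar_ltE sr).
have cr : orbit_continuous (fun p => r p 1).
  by move=> g d d0; exact: (repar_inv_continuous Hd Hc Hphi sr g ler01 d0).
have [C CP] := orbit_continuous_bounded Hc cr.
have [b b0 track] := tracking Hd Hc.
pose eta := Num.min c (Num.min (1 / 4) (b / 2)).
have eta0 : 0 < eta by rewrite !lt_min c0 !divr_gt0.
have etab : eta < b by apply: (@le_lt_trans _ _ (b / 2)); [rewrite !ge_min lexx !orbT|lra].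
have eta4 : eta <= 1 / 4 by rewrite !ge_min lexx !orbT.
have etac : eta <= c by rewrite ge_min lexx.
have [d d0 dP] := sasaki_dist_dev Gamma eta0.
exists d => // x y xy.
have [g gE] := pt_surj x; have [h0 h0E] := pt_surj y.
have near t : 0 <= t -> exists2 k, lat Gamma k &
    dev (upper (- s x t) * (g^-1 * k * h0) * upper (s y t))%g < eta.
  move=> /xy; rewrite !(repar_flowE sr) {2}gE {2}h0E !horocycle_pt => /dP[k kL kd].
  by exists k => //; move: kd; rewrite invgM -upperN !mulgA.
have [k0 k0L k0d] := near 0 (lexx 0).
(* The lift of y adapted to time 0; [tracking] shows that it stays adapted at all later times. *)
pose h := (k0 * h0)%g.
have hE : y = pt Gamma h by rewrite h0E pt_lat.
have dev_lt t : 0 <= t -> dev (upper (- s x t) * (g^-1 * h) * upper (s y t))%g < eta.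
  move=> t0; apply: (track eta g h (s x) (s y) t etab) => //.
  - exact: (repar_time_continuous sr).
  - exact: (repar_time_continuous sr).
  - by move: k0d; rewrite /h !mulgA.
  move=> u /andP[/near[k kL kd] _]; exists (k * k0^-1)%g.
    by apply: latM => //; exact: latV.
  by move: kd; rewrite /h !mulgA mulgVK.
have hg : h = (g * (g^-1 * h))%g by rewrite mulVKg.
move: dev_lt hg; move: (g^-1 * h)%g => k dev_lt hg.
have dk : dev k < eta.
  by have := dev_lt 0 (lexx 0); rewrite !(repar0 sr) oppr0 upper0 mul1g mulg1.
have entry m i j : `|mxval m i j - mxval (1%g : SL2 R) i j| <= dev m.
  by have := nrm_entry (mxval m - mxval (1%g : SL2 R)) i j; rewrite !mxE.
have k10 : mxval k 1 0 = 0.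
  apply/eqP; apply: contrapT => /negP n0.
  have n1 : 0 < `|mxval k 1 0| by rewrite normr_gt0.
  (* By horocycle time a on the orbit of y the bottom right entry has moved by exactly 2 eta,
     although it starts and ends within eta of 1. *)
  pose a := 2 * eta / `|mxval k 1 0|.
  have a0 : 0 <= a by rewrite divr_ge0// mulr_ge0// ltW.
  have t0 : 0 <= r y a by rewrite -(repar_inv0 sr y) (repar_inv_leE sr).
  have := le_lt_trans (entry _ 1 1) (dev_lt _ t0).
  have := le_lt_trans (entry _ 1 1) dk.
  rewrite (repar_invK sr) !SL2_mulE !upperE SL2_oneE !(mul0r, mul1r, mulr1, add0r) => d1 d2.
  have : `|mxval k 1 0 * a| < eta + eta.
    rewrite (_ : _ * a = (mxval k 1 0 * a + mxval k 1 1 - 1) - (mxval k 1 1 - 1)); last by ring.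
    by apply: le_lt_trans (ler_normB _ _) _; exact: ltrD.
  rewrite normrM (ger0_norm a0) /a mulrC divfK ?gt_eqF//; lra.
have k00 : 0 < mxval k 0 0.
  have := le_lt_trans (entry _ 0 0) dk; rewrite SL2_oneE ltr_norml => /andP[+ _]; lra.
have [l [beta kE]] := upper_triangular_decomposition k10 k00.
pose q := pt Gamma (g * geo l)%g.
have yq : y = horocycle beta q by rewrite /q horocycle_pt hE hg kE mulgA.
have l0 : l = 0.
  (* In the same phi-time t, x runs horocycle time a and y runs a'. The top right entry puts a exp
     (-2l) and beta + a', both counted from q, within 1 of each other, so their phi-times differ by
     at most C; [r q beta] is the head start of y. *)
  apply: (bounded_defect_eq0 Hd Hc Hphi sr (g := g) (C := C + `|r q beta|)) => a a0.
  have t0 : 0 <= r x a by rewrite -(repar_inv0 sr x) (repar_inv_leE sr).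
  have := dev_lt _ t0; rewrite (repar_invK sr); set t := r x a; set a' := s y t => dt.
  have EE : expR l * expR (- l) = 1 by rewrite -expRD subrr expR0.
  have E2 : expR l * expR (- 2 * l) = expR (- l) by rewrite -expRD; congr expR; ring.
  have := le_lt_trans (entry _ 0 1) dt; rewrite SL2_oneE subr0.
  rewrite (_ : mxval _ 0 1 = expR l * (a' + beta - a * expR (- 2 * l))); last first.
    rewrite kE !SL2_mulE !upperE !geoE.
    transitivity (expR l * (a' + beta) - a * (expR l * expR (- 2 * l))); last by ring.
    by rewrite E2; ring.
  rewrite normrM (gtr0_norm (expR_gt0 l)) => dA.
  have el : expR (- l) <= 1 + eta.
    have := le_lt_trans (entry _ 1 1) dk; rewrite SL2_oneE kE SL2_mulE !geoE !upperE.
    by rewrite mul0r add0r mulr1 ltr_norml => /andP[_]; lra.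
  have d1 : `|a * expR (- 2 * l) - (beta + a')| <= 1.
    rewrite distrC (addrC beta).
    rewrite (_ : `|_| = expR l * `|a' + beta - a * expR (- 2 * l)| * expR (- l)); last first.
      by rewrite mulrAC EE mul1r.
    have := ler_pM (mulr_ge0 (expR_ge0 l) (normr_ge0 _)) (expR_ge0 (- l)) (ltW dA) el.
    nra.
  have rq : r q (beta + a') = r q beta + t.
    by rewrite (repar_inv_cocycle Hd Hc Hphi sr) -yq /a' (reparK sr).
  rewrite /defect -gE -/t -/q (_ : _ - _ =
      - (r q (a * expR (- 2 * l)) - r q (beta + a')) - r q beta); last first.
    by rewrite rq; ring.
  apply: le_trans (ler_normB _ _) _; rewrite normrN lerD2r.
  exact: (horocycle_time_diff Hd Hc Hphi sr).
have kb : k = upper beta by rewrite kE l0 geo0 mul1g.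
have yx : y = horocycle beta x by rewrite yq /q l0 geo0 mulg1 -gE.
have bc : `|beta| < c by apply: lt_le_trans etac; rewrite -dev_upper -kb.
exists (r x beta); split; last by rewrite (flow_repar_inv sr).
(* The bound at x limits the forward time. The bound at phi (-e/2) x, through the cocycle identity,
   gives s x (-e/2) <= -c and limits the backward time. *)
have := cP x; have := cP (phi (- (e / 2)) x).
have : s x (- (e / 2)) + s (phi (- (e / 2)) x) (e / 2) = 0.
  by rewrite -(repar_cocycle Hd Hc Hphi sr) addNr (repar0 sr).
move: bc; rewrite ltr_norml => /andP[b1 b2] s1 c1 c2.
have t1 : - (e / 2) < r x beta by rewrite -(repar_ltE sr x) (repar_invK sr); lra.
have t2 : r x beta < e / 2 by rewrite -(repar_ltE sr x) (repar_invK sr); lra.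
by apply/andP; split; lra.
Qed.
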